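(* Let $F$ be a $2$-adic field and $R_0=\mathbb{Q}$. Let $A=\mathcal{O}_F^{\times2}\cap\mathbb{Z}_2^\times$, so $\mathbb{Z}_2^{\times2}\subseteq A\subseteq\mathbb{Z}_2^\times$. The even part $\omega_{\psi,X}^+$ of the Weil representation can be realised over its character field, which is - $\mathbb{Q}$ if $A=\mathbb{Z}_2^\times$; - $\mathbb{Q}[\sqrt{-2}]$ if $A=[3]$; - $\mathbb{Q}[\sqrt{-1}]$ if $A=[5]$; - $\mathbb{Q}[\sqrt2]$ if $A=[-1]$; - $\mathbb{Q}[\zeta_8]$ if $A=\mathbb{Z}_2^{\times2}$.
   Context: $F$ is a finite extension of $\mathbb{Q}_2$ with ring of integers $\mathcal{O}_F$. For $\alpha\in\mathbb{Z}_2^\times$, $[\alpha]=\langle\alpha,\mathbb{Z}_2^{\times2}\rangle$ is the subgroup of $\mathbb{Z}_2^\times$ generated by $\alpha$ and the squares; $\{1,-1,3,5\}$ represents $\mathbb{Z}_2^\times/\mathbb{Z}_2^{\times2}$. $\mathcal{K}=\bigcup_k\mathbb{Q}[\zeta_{2^k}]$, with $\zeta_n$ a primitive $n$-th root of unity. $\psi:F\to\mathcal{K}^\times$ is a non-trivial smooth character. Weil representation. Let $(W,\langle\ ,\ \rangle)$ be a nonzero symplectic $F$-vector space with a complete polarisation $W=X\oplus Y$ (transverse Lagrangians). The Heisenberg group is $H=W\times F$ with law $(w,t)(w',t')=(w+w',t+t'+\frac12\langle w,w'\rangle)$; $\mathrm{Sp}(W)$ acts by $g\cdot(w,t)=(gw,t)$.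 The Heisenberg representation $\rho_\psi$ is realised on $C_c^\infty(Y,\mathcal{K})$ by $\rho_\psi(x+y,t)f(y')=\psi(t)\psi(\langle y',x\rangle+\frac12\langle y,x\rangle)f(y'+y)$. The metaplectic group $\mathrm{Mp}(W)=\mathrm{Sp}(W)\times_{c_X}\{\pm1\}$ is, up to isomorphism, the non-trivial topological double cover of $\mathrm{Sp}(W)$. The Weil representation $\omega_{\psi,X}$ is the smooth representation of $\mathrm{Mp}(W)$ on $C_c^\infty(Y,\mathcal{K})$ characterised by: the central element $-1$ acts by $-1$; $\omega_{\psi,X}(\tilde g)\rho_\psi(h)\omega_{\psi,X}(\tilde g)^{-1}=\rho_\psi(g\cdot h)$ for $\tilde g$ above $g\in\mathrm{Sp}(W)$ and $h\in H$; and $(n,1)$ above $n\in N(X)$ (unipotent radical of the stabiliser of $X$, which lifts to $\mathrm{Mp}(W)$) acts by $f(y)\mapsto\psi(\frac12\langle by,y\rangle)f(y)$ with $b=(n-\mathrm{id}_W)|_Y:Y\to X$. The even part $\omega_{\psi,X}^+$ is its restriction to the even functions on $Y$; it is admissible and absolutely irreducible. Fields. For an admissible, finitely generated, absolutely irreducible smooth representation $V$ of a locally profinite group $G$ over an algebraic extension $R$ of $R_0$, the character field of $V$ is the subfield of $R$ generated by $R_0$ and the traces on $V$ of the elements of the Hecke algebra $C_c^\infty(G,R_0)$; it equals the fixed field of $\{\sigma\in\mathrm{Aut}(R):V^\sigma\simeq V\}$, where $V^\sigma$ is the twist of $V$ by $\sigma$. $V$ can be realised over a subfield $R'$ of an algebraic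 closure $\bar R$ of $R$ if there is a smooth representation $V'$ of $G$ over $R'$ with $V'\otimes_{R'}\bar R\simeq V\otimes_R\bar R$. *)

(* Defs.v *)
From HB Require Import structures.
From mathcomp Require Import all_boot all_order all_algebra all_field.
From mathcomp Require Import all_classical topology.

Set Implicit Arguments.
Unset Strict Implicit.
Unset Printing Implicit Defensive.
Import Order.TTheory GRing.Theory Num.Theory.
Local Open Scope classical_set_scope.
Local Open Scope ring_scope.

(* Z_2 is the inverse limit of the rings Z/2^n; x n is the residue in [0, 2^n). *)
Record Z2 := MkZ2 {
  Z2res :> nat -> nat;
  Z2resP : `[< forall n, (Z2res n = Z2res n.+1 %% 2 ^ n)%N >] }.

HB.instance Definition _ := [isSub for Z2res].
HB.instance Definition _ := [Choice of Z2 by <:].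

Section Z2ring.
Implicit Types (x y z : Z2) (n : nat).

Lemma Z2_eq x y : (forall n, x n = y n) -> x = y.
Proof. by move=> h; apply: val_inj; apply/funext. Qed.

Lemma Z2_small x n : (x n < 2 ^ n)%N.
Proof. by have/asboolP -> := Z2resP x; rewrite ltn_mod expn_gt0. Qed.

Lemma Z2_mod x n : (x n %% 2 ^ n = x n)%N.
Proof. by rewrite modn_small ?Z2_small. Qed.

Lemma Z2_le x m n : (m <= n)%N -> (x n %% 2 ^ m = x m)%N.
Proof.
elim: n => [|n IHn]; first by rewrite leqn0 => /eqP->; exact: Z2_mod.
rewrite leq_eqVlt => /orP[/eqP->|]; first exact: Z2_mod.
rewrite ltnS => le_mn; have /asboolP/(_ n) e := Z2resP x.
by rewrite -(IHn le_mn) [in RHS]e modn_dvdm // dvdn_exp2l.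
Qed.

Fact Z2_of_subproof (f : nat -> nat) :
  (forall n, f n = f n.+1 %[mod 2 ^ n])%N ->
  `[< forall n, (f n %% 2 ^ n = (f n.+1 %% 2 ^ n.+1) %% 2 ^ n)%N >].
Proof.
move=> h; apply/asboolP => n.
by rewrite modn_dvdm ?h // dvdn_exp2l.
Qed.
Definition Z2_of f h := MkZ2 (@Z2_of_subproof f h).

Fact Z2nat_subproof k n : (k = k %[mod 2 ^ n])%N. Proof. by []. Qed.
Definition Z2nat k := Z2_of (@Z2nat_subproof k).

Fact Z2add_subproof x y n : (x n + y n = x n.+1 + y n.+1 %[mod 2 ^ n])%N.
Proof. by rewrite -[RHS]modnDm !Z2_le. Qed.
Definition Z2add x y := Z2_of (Z2add_subproof x y).

Fact Z2mul_subproof x y n : (x n * y n = x n.+1 * y n.+1 %[mod 2 ^ n])%N.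
Proof. by rewrite -[RHS]modnMm !Z2_le. Qed.
Definition Z2mul x y := Z2_of (Z2mul_subproof x y).

Fact Z2opp_subproof x n : (2 ^ n - x n = 2 ^ n.+1 - x n.+1 %[mod 2 ^ n])%N.
Proof.
apply/eqP; rewrite -(eqn_modDr (x n.+1)) subnK ?(ltnW (Z2_small _ _)) //.
rewrite -modnDmr Z2_le // subnK ?(ltnW (Z2_small _ _)) //.
by rewrite modnn expnS modnMl.
Qed.
Definition Z2opp x := Z2_of (Z2opp_subproof x).

Fact Z2addA : associative Z2add.
Proof. by move=> x y z; apply: Z2_eq => n /=; rewrite modnDmr modnDml addnA. Qed.
Fact Z2addC : commutative Z2add.
Proof. by move=> x y; apply: Z2_eq => n /=; rewrite addnC. Qed.
Fact Z2add0 : left_id (Z2nat 0) Z2add.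
Proof. by move=> x; apply: Z2_eq => n /=; rewrite mod0n add0n Z2_mod. Qed.
Fact Z2addN : left_inverse (Z2nat 0) Z2opp Z2add.
Proof.
move=> x; apply: Z2_eq => n /=; rewrite modnDml subnK ?(ltnW (Z2_small _ _)) //.
by rewrite modnn mod0n.
Qed.
Fact Z2mulA : associative Z2mul.
Proof. by move=> x y z; apply: Z2_eq => n /=; rewrite modnMmr modnMml mulnA. Qed.
Fact Z2mulC : commutative Z2mul.
Proof. by move=> x y; apply: Z2_eq => n /=; rewrite mulnC. Qed.
Fact Z2mul1 : left_id (Z2nat 1) Z2mul.
Proof. by move=> x; apply: Z2_eq => n /=; rewrite modnMml mul1n Z2_mod. Qed.
Fact Z2mulD : left_distributive Z2mul Z2add.
Proof.
by move=> x y z; apply: Z2_eq => n /=; rewrite modnMml modnDml modnDmr mulnDl.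
Qed.
Fact Z2one_neq0 : Z2nat 1 != Z2nat 0.
Proof. by apply/eqP => /(congr1 (fun z : Z2 => z 1%N)). Qed.

HB.instance Definition _ := GRing.isZmodule.Build Z2 Z2addA Z2addC Z2add0 Z2addN.
HB.instance Definition _ :=
  GRing.Zmodule_isComNzRing.Build Z2 Z2mulA Z2mulC Z2mul1 Z2mulD Z2one_neq0.

Definition Z2unit := [pred x : Z2 | `[< exists y, y * x = 1 >]].
Definition Z2inv x : Z2 := xget x [set y | y * x = 1].

Fact Z2mulV : {in Z2unit, left_inverse 1 Z2inv *%R}.
Proof.
move=> x /asboolP[y yx].
exact: (xgetPex x (ex_intro [set y | y * x = 1] y yx)).
Qed.
Fact Z2unitP x y : y * x = 1 -> Z2unit x.
Proof. by move=> yx; apply/asboolP; exists y. Qed.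
Fact Z2inv_out : {in [predC Z2unit], Z2inv =1 id}.
Proof.
move=> x /asboolPn nx.
by rewrite /Z2inv xgetPN // => y yx; apply: nx; exists y.
Qed.

HB.instance Definition _ :=
  GRing.ComNzRing_hasMulInverse.Build Z2 Z2mulV Z2unitP Z2inv_out.

Fact Z2_idomain x y : x * y = 0 -> (x == 0) || (y == 0).
Proof.
move=> xy0; apply/norP => -[x0 y0].
have nz z : z != 0 -> exists n, z n != 0%N.
  move=> z0; apply: contrapT => h; case/eqP: z0; apply: Z2_eq => n /=.
  by rewrite mod0n; apply: contrapT => /eqP zn; apply: h; exists n.
have [[m xm] [n yn]] := (nz _ x0, nz _ y0).
have ndvd z k N : z k != 0%N -> (k <= N)%N -> (0 < z N)%N /\ (logn 2 (z N) < k)%N.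
  move=> zk /Z2_le e; rewrite -(e z) in zk.
  have zN : (0 < z N)%N by rewrite lt0n; apply: contraNneq zk => ->; rewrite mod0n.
  by split; rewrite // ltnNge -pfactor_dvdn.
have [xN lx] := ndvd x m (m + n)%N xm (leq_addr _ _).
have [yN ly] := ndvd y n (m + n)%N yn (leq_addl _ _).
have := congr1 (fun z : Z2 => z (m + n)%N) xy0; rewrite /= mod0n => /eqP.
rewrite -/(dvdn _ _) pfactor_dvdn ?muln_gt0 ?xN // lognM //.
by rewrite leqNgt -addnS leq_add // ltnW.
Qed.

HB.instance Definition _ :=
  GRing.ComUnitRing_isIntegral.Build Z2 Z2_idomain.

End Z2ring.

Notation Q2 := {fraction Z2}.

Definition Z2units : set Z2 := [set a | a \is a GRing.unit].

Definition Z2squares : set Z2 := [set u ^+ 2 | u in Z2units].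

(* the subgroup of the units generated by a and the squares *)
Definition Z2bracket (a : Z2) : set Z2 :=
  smallest [set H : set Z2 | [/\ H `<=` Z2units, H 1 &
                              forall x y, H x -> H y -> H (x / y)]]
           (a |` Z2squares).

Section Integers.
Variable F : fieldExtType Q2.

Definition Z2emb : Z2 -> F := in_alg F \o @FracField.tofrac Z2.
HB.instance Definition _ :=
  GRing.RMorphism.copy Z2emb (in_alg F \o @FracField.tofrac Z2).

Definition OF : set F := [set x | integralOver Z2emb x].

Definition OFunits : set F := [set x | [/\ x != 0, OF x & OF x^-1]].

Definition squares_in_Z2 : set Z2 :=
  [set a | a \is a GRing.unit /\ exists2 u, OFunits u & u ^+ 2 = Z2emb a].

Lemma OF0 : OF 0. Proof. exact: integral0. Qed.
Lemma OF1 : OF 1. Proof. exact: integral1. Qed.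
Lemma OFD x y : OF x -> OF y -> OF (x + y). Proof. exact: integral_add. Qed.
Lemma OFM x y : OF x -> OF y -> OF (x * y). Proof. exact: integral_mul. Qed.
Lemma OFN x : OF x -> OF (- x). Proof. exact: integral_opp. Qed.
Lemma OF_Z2 a : OF (Z2emb a). Proof. exact: integral_id. Qed.

Lemma Q2_denom (r : Q2) :
  exists2 b : Z2, b != 0 & exists c, FracField.tofrac b * r = FracField.tofrac c.
Proof.
elim/quotW: r => x; exists \d_x; first exact: denom_ratioP.
exists \n_x; unlock FracField.tofrac; rewrite -[LHS]FracField.pi_mul.
apply/eqmodP; rewrite /= FracField.equivfE /FracField.mulf /=.
by rewrite !numden_Ratio ?oner_neq0 ?mul1r ?mulr1 ?denom_ratioP // mulrC.
Qed.

Lemma Q2_denoms (s : seq Q2) : exists2 b : Z2, b != 0 &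
  forall r, r \in s -> exists c, FracField.tofrac b * r = FracField.tofrac c.
Proof.
elim: s => [|r s [b b0 hb]]; first by exists 1; rewrite ?oner_neq0.
have [b' b'0 [c' hc']] := Q2_denom r.
exists (b * b'); first by rewrite mulf_neq0.
move=> t; rewrite inE => /predU1P[->|/hb[c hc]].
  by exists (b * c'); rewrite !rmorphM /= -hc' mulrA.
by exists (c * b'); rewrite !rmorphM /= -hc mulrAC.
Qed.

Lemma OF_denom (x : F) : exists2 b, b != 0 /\ OF b & OF (b * x).
Proof.
have [q qE] : exists q : {poly Q2}, minPoly 1%VS x = map_poly (in_alg F) q.
  by apply/polyOver1P; exact: minPolyOver.
have qm : q \is monic.
  by have := monic_minPoly 1%VS x; rewrite qE map_monic.
have [b b0 hb] := Q2_denoms q; pose d := (size q).-1.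
have sq : size q = d.+1 by rewrite prednK // size_poly_gt0 monic_neq0.
exists (Z2emb b).
  split; last exact: OF_Z2.
  by rewrite fmorph_eq0 tofrac_eq0.
pose p := \poly_(i < d.+1) ((q`_i)%:A * Z2emb b ^+ (d - i)).
have pd : p`_d = 1.
  rewrite coef_poly ltnSn subnn mulr1.
  by have /monicP := qm; rewrite /lead_coef sq /= => ->; rewrite scale1r.
have sp : size p = d.+1.
  apply/eqP; rewrite eqn_leq size_poly /= ltnNge; apply/negP => /(nth_default 0).
  by move/eqP; rewrite pd oner_eq0.
apply: (@integral_root_monic _ _ _ _ p).
- by rewrite monicE /lead_coef sp /= pd.
- have : root (minPoly 1%VS x) x by exact: root_minPoly.
  rewrite qE !rootE => /eqP e; rewrite horner_coef sp.
  have -> : \sum_(i < d.+1) p`_i * (Z2emb b * x) ^+ i =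
            Z2emb b ^+ d * (map_poly (in_alg F) q).[x].
    rewrite horner_coef size_map_poly sq mulr_sumr; apply: eq_bigr => i _.
    rewrite coef_poly ltn_ord coef_map /= exprMn.
    rewrite mulrA -(mulrA _%:A) -exprD subnK; last by rewrite -ltnS.
    by rewrite -mulrA mulrCA.
  by rewrite e mulr0.
- apply/(integral_poly _ p) => i; case: (ltnP i d.+1) => [lid|]; last first.
    by rewrite -sp => /(nth_default 0)->; exact: integral0.
  move: lid; rewrite ltnS leq_eqVlt => /orP[/eqP->|lid].
    by rewrite pd; exact: integral1.
  rewrite coef_poly ltnS (ltnW lid).
  have [|c hc] := hb q`_i; first by rewrite mem_nth // sq ltnS ltnW.
  have -> : (d - i = (d - i).-1.+1)%N by rewrite prednK // subn_gt0.
  rewrite exprSr mulrC -mulrA; apply: OFM; first by rewrite -rmorphXn; exact: OF_Z2.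
  suff -> : Z2emb b * (q`_i)%:A = Z2emb c by exact: OF_Z2.
  by rewrite /Z2emb /= -hc mulr_algl scalerA.
Qed.

End Integers.

(* A finite-dimensional F-space with its canonical topology: the sets x + c *: L, *)
(* with 0 != c \in OF and L the OF-lattice spanned by a basis, form a basis of    *)
(* neighbourhoods of x (the topology does not depend on the basis).               *)
Definition adic (F : fieldExtType Q2) (V : vectType F) : Type := V.

Section AdicTopology.
Variables (F : fieldExtType Q2) (V : vectType F).

Definition lattice : set V :=
  [set v | forall i, OF (coord (vbasis {:V}) i v)].

Definition adic_nbhs (x : adic V) : set_system (adic V) :=
  [set U | exists2 c : F, c != 0 /\ OF c &
                          forall v : V, lattice v -> U ((x : V) + c *: v)].

Lemma lattice0 : lattice 0.
Proof. by move=> i; rewrite linear0; exact: OF0. Qed.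
Lemma latticeD u v : lattice u -> lattice v -> lattice (u + v).
Proof. by move=> hu hv i; rewrite linearD; exact: OFD (hu i) (hv i). Qed.
Lemma latticeN u : lattice u -> lattice (- u).
Proof. by move=> hu i; rewrite linearN; exact: OFN (hu i). Qed.
Lemma latticeZ a u : OF a -> lattice u -> lattice (a *: u).
Proof. by move=> ha hu i; rewrite linearZ; exact: OFM ha (hu i). Qed.

HB.instance Definition _ := Vector.on (adic V).
HB.instance Definition _ := hasNbhs.Build (adic V) adic_nbhs.

Fact adic_nbhs_filter (x : adic V) : ProperFilter (nbhs x).
Proof.
split; first by move=> [c _ /(_ 0 lattice0)].
split=> [|P Q [c [c0 oc] hP] [d [d0 od] hQ]|P Q PQ [c hc hP]].
- by exists 1; first by split; [exact: oner_neq0|exact: OF1].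
- exists (c * d); first by split; [exact: mulf_neq0|exact: OFM].
  move=> v hv; split; first by rewrite -scalerA; apply/hP/latticeZ.
  by rewrite mulrC -scalerA; apply/hQ/latticeZ.
- by exists c => // v /hP /PQ.
Qed.

Fact adic_nbhs_singleton (x : adic V) (A : set (adic V)) : nbhs x A -> A x.
Proof. by move=> [c _ /(_ 0 lattice0)]; rewrite scaler0 addr0. Qed.

Fact adic_nbhs_nbhs (x : adic V) (A : set (adic V)) :
  nbhs x A -> nbhs x (nbhs^~ A).
Proof.
move=> [c hc hA]; exists c => // u hu; exists c => // v hv.
by rewrite -addrA -scalerDr; apply/hA/latticeD.
Qed.

HB.instance Definition _ := @Nbhs_isNbhsTopological.Build (adic V)
  adic_nbhs_filter adic_nbhs_singleton adic_nbhs_nbhs.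

End AdicTopology.

Definition locally_constant (T : topologicalType) (U : Type) (f : T -> U) :=
  forall x, \forall z \near x, f z = f x.

Section CompactlySupported.
Variables (T : topologicalType) (R : fieldType).

Definition smooth_compact : {pred (T -> R^o)} := [pred f |
  `[< locally_constant f /\ compact (closure [set x | f x != 0]) >]].

Record Cc := MkCc { Cc_fun :> T -> R^o; CcP : Cc_fun \in smooth_compact }.

HB.instance Definition _ := [isSub for Cc_fun].
HB.instance Definition _ := [Choice of Cc by <:].

Fact smooth_compact_submod : submod_closed smooth_compact.
Proof.
split=> [|a f g /asboolP[lf cf] /asboolP[lg cg]]; apply/asboolP.
  split; first by move=> x; near=> z.
  rewrite (_ : [set x | _] = set0) ?closure0 //; first exact: compact0.
  by rewrite -subset0 => x /=; rewrite eqxx.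
split.
  move=> x; near=> z; rewrite !fctE.
  by rewrite (near (lf x) z) // (near (lg x) z).
apply: (subclosed_compact (@closed_closure _ _) (compactU cf cg)).
rewrite -closureU; apply: closureS => x /=.
apply: contra_neqP => /not_orP[/negP + /negP].
by rewrite !negbK !fctE => /eqP-> /eqP->; rewrite scaler0 addr0.
Unshelve. all: by end_near. Qed.

HB.instance Definition _ :=
  GRing.isSubmodClosed.Build R (T -> R^o) smooth_compact smooth_compact_submod.
HB.instance Definition _ := [SubChoice_isSubLmodule of Cc by <:].

End CompactlySupported.

Section EvenFunctions.
Variables (F : fieldExtType Q2) (V : vectType F) (R : fieldType).

Definition even_fun : {pred Cc (adic V) R} :=
  [pred f : Cc (adic V) R | `[< forall y : V, f (- y) = f y >]].

Record Cc_even := MkCc_even {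
  Cc_even_val :> Cc (adic V) R; Cc_evenP : Cc_even_val \in even_fun }.

HB.instance Definition _ := [isSub for Cc_even_val].
HB.instance Definition _ := [Choice of Cc_even by <:].

Fact even_fun_submod : submod_closed even_fun.
Proof.
split=> [|a f g /asboolP hf /asboolP hg]; apply/asboolP => y //.
by rewrite -[LHS]/(a * f (- y) + g (- y)) hf hg.
Qed.

HB.instance Definition _ :=
  GRing.isSubmodClosed.Build R (Cc (adic V) R) even_fun even_fun_submod.
HB.instance Definition _ := [SubChoice_isSubLmodule of Cc_even by <:].

End EvenFunctions.

HB.mixin Record isTopologicalGroup G & Group G & Topological G := {
  mulg_continuous : continuous (fun x : G * G => (x.1 * x.2)%g);
  invg_continuous : continuous (fun x : G => (x^-1)%g) }.

#[short(type="topologicalGroupType")]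
HB.structure Definition TopologicalGroup :=
  {G of isTopologicalGroup G & Group G & Topological G}.

Section Symplectic.
Variables (F : fieldExtType Q2) (W : vectType F) (B : {skew_symmetric W}).

Record Sp := MkSp { Sp_val :> 'End(W);
  SpP : `[< (forall u v, B (Sp_val u) (Sp_val v) = B u v) /\
            lker Sp_val = 0%VS >] }.

HB.instance Definition _ := [isSub for Sp_val].
HB.instance Definition _ := [Choice of Sp by <:].
HB.instance Definition _ :=
  Topological.copy Sp (initial_topology (Sp_val : Sp -> adic 'End(W))).

Fact Sp_isom (g : Sp) u v : B (g u) (g v) = B u v.
Proof. by have /asboolP[] := SpP g. Qed.
Fact Sp_ker (g : Sp) : lker g == 0%VS.
Proof. by have /asboolP[_ ->] := SpP g. Qed.

Fact Sp1_subproof : `[< (forall u v, B ((\1%VF : 'End(W)) u) ((\1%VF : 'End(W)) v) = B u v) /\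
            lker (\1%VF : 'End(W)) = 0%VS >].
Proof.
apply/asboolP; split=> [u v|]; first by rewrite !id_lfunE.
by apply/eqP/lker0P => u v; rewrite !id_lfunE.
Qed.
Definition Sp1 := MkSp Sp1_subproof.

Fact Spmul_subproof (g h : Sp) : `[< (forall u v, B ((g \o h)%VF u) ((g \o h)%VF v) = B u v) /\
            lker (g \o h)%VF = 0%VS >].
Proof.
apply/asboolP; split=> [u v|]; first by rewrite !comp_lfunE !Sp_isom.
apply/eqP/lker0P => u v; rewrite !comp_lfunE.
by move=> /(lker0P (Sp_ker g)) /(lker0P (Sp_ker h)).
Qed.
Definition Spmul g h := MkSp (Spmul_subproof g h).

Fact Spinv_subproof (g : Sp) : `[< (forall u v, B ((g^-1)%VF u) ((g^-1)%VF v) = B u v) /\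
            lker (g^-1)%VF = 0%VS >].
Proof.
have gK := lker0_lfunVK (Sp_ker g); apply/asboolP; split=> [u v|].
  by rewrite -(Sp_isom g) !gK.
by apply/eqP/lker0P => u v /(congr1 g); rewrite !gK.
Qed.
Definition Spinv g := MkSp (Spinv_subproof g).

Lemma Sp_eq (g h : Sp) : (forall w, g w = h w) -> g = h.
Proof. by move=> gh; apply/val_inj/lfunP. Qed.

Fact SpmulA : associative Spmul.
Proof. by move=> g h k; apply: Sp_eq => w /=; rewrite !comp_lfunE. Qed.
Fact Spmul1g : left_id Sp1 Spmul.
Proof. by move=> g; apply: Sp_eq => w /=; rewrite comp_lfunE id_lfunE. Qed.
Fact Spmulg1 : right_id Sp1 Spmul.
Proof. by move=> g; apply: Sp_eq => w /=; rewrite comp_lfunE id_lfunE. Qed.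
Fact SpmulVg : left_inverse Sp1 Spinv Spmul.
Proof.
move=> g; apply: Sp_eq => w /=.
by rewrite comp_lfunE id_lfunE (lker0_lfunK (Sp_ker g)).
Qed.
Fact SpmulgV : right_inverse Sp1 Spinv Spmul.
Proof.
move=> g; apply: Sp_eq => w /=.
by rewrite comp_lfunE id_lfunE (lker0_lfunVK (Sp_ker g)).
Qed.

HB.instance Definition _ :=
  isGroup.Build Sp SpmulA Spmul1g Spmulg1 SpmulVg SpmulgV.

(* the unipotent radical of the stabiliser of X *)
Definition unipotent_radical (X : {vspace W}) : set Sp :=
  [set n | (forall x, x \in X -> n x = x) /\ (forall w, n w - w \in X)].

End Symplectic.

Definition is_subfield : set (set algC) := [set E : set algC | divring_closed [pred x in E]].

Definition subfield_gen (S : set algC) : set algC := smallest is_subfield S.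

(* Q[zeta_{2^k}], the union of which over k is the coefficient field below *)
Definition cyclo2 (k : nat) : set algC :=
  subfield_gen [set z | (2 ^ k).-primitive_root z].

Definition calK_pred : {pred algC} := [pred x | x \in \bigcup_k cyclo2 k].

Lemma subfield_genP (S : set algC) : is_subfield (subfield_gen S).
Proof.
split=> [|x y|x y]; rewrite !inE.
- by move=> E [/= [h _ _] _]; have := h; rewrite inE.
- move=> hx hy E hE; have [[/= _ h _] _] := hE.
  by have := h x y; rewrite !inE; apply; [exact: hx|exact: hy].
- move=> hx hy E hE; have [[/= _ _ h] _] := hE.
  by have := h x y; rewrite !inE; apply; [exact: hx|exact: hy].
Qed.

Lemma cyclo2_le m n : (m <= n)%N -> cyclo2 m `<=` cyclo2 n.
Proof.
move=> le_mn; apply: smallest_sub; first exact: subfield_genP.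
move=> z /= zm; have [w wn] := C_prim_root_exists (expn_gt0 2 n).
have dv : (2 ^ m %| 2 ^ n)%N by rewrite dvdn_exp2l.
have := dvdn_prim_root wn dv => wm.
have /(prim_rootP wm)[i ->] := prim_expr_order zm.
have /= [w1 _ wV] := subfield_genP [set z | (2 ^ n).-primitive_root z].
have pc : forall x k, x \in [pred x in cyclo2 n] -> x ^+ k \in [pred x in cyclo2 n].
  move=> x k hx; elim: k => [|k IHk]; first by rewrite expr0.
  have kV : x ^- k \in [pred x in cyclo2 n].
    by rewrite -[_^-1]mul1r; exact: (wV 1 (x ^+ k) w1 IHk).
  by rewrite exprS -[x ^+ k]invrK; exact: (wV x (x ^- k) hx kV).
have := pc w; rewrite -exprM => /(_ ((2 ^ n %/ 2 ^ m) * i)%N); rewrite !inE; apply.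
exact: sub_gen_smallest.
Qed.

Fact calK_divring : divring_closed calK_pred.
Proof.
have com x y : x \in calK_pred -> y \in calK_pred ->
    exists n, x \in [pred z in cyclo2 n] /\ y \in [pred z in cyclo2 n].
  rewrite !inE => -[m _ hx] [n _ hy]; exists (maxn m n); rewrite !inE.
  by split; [exact: (cyclo2_le (leq_maxl m n))|exact: (cyclo2_le (leq_maxr m n))].
have in_calK n x : x \in [pred z in cyclo2 n] -> x \in calK_pred.
  by rewrite !inE => hx; exists n.
split=> [|x y hx hy|x y hx hy].
- by apply: (@in_calK 0%N); have [] := subfield_genP [set z | (2 ^ 0).-primitive_root z].
- have [n [xn yn]] := com _ _ hx hy; apply: (@in_calK n).
  by have [_ h _] := subfield_genP [set z | (2 ^ n).-primitive_root z]; exact: h.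
- have [n [xn yn]] := com _ _ hx hy; apply: (@in_calK n).
  by have [_ _ h] := subfield_genP [set z | (2 ^ n).-primitive_root z]; exact: h.
Qed.

HB.instance Definition _ := GRing.isDivringClosed.Build algC calK_pred calK_divring.

Record calK := MkCalK { calK_val :> algC; calKP : calK_val \in calK_pred }.
HB.instance Definition _ := [isSub for calK_val].
HB.instance Definition _ := [Choice of calK by <:].
HB.instance Definition _ := [SubChoice_isSubIntegralDomain of calK by <:].
HB.instance Definition _ := [SubIntegralDomain_isSubField of calK by <:].

Record smooth_rep (G : topologicalGroupType) (R : fieldType) (V : lmodType R) :=
  SmoothRep {
    rep_op :> G -> {linear V -> V};
    rep_one : forall v, rep_op 1%g v = v;
    rep_mul : forall g h v, rep_op (g * h)%g v = rep_op g (rep_op h v);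
    rep_smooth : forall v, open [set g | rep_op g v = v] }.

(* T, with i : V -> T, is the tensor product of V with S along f *)
Definition is_base_change (R S : fieldType) (f : {rmorphism R -> S})
    (V : lmodType R) (T : lmodType S) (i : {linear V -> T | f \; *:%R}) : Prop :=
  forall (U : lmodType S) (h : {linear V -> U | f \; *:%R}),
    exists2 g : {linear T -> U}, (forall v, g (i v) = h v) &
      forall g' : {linear T -> U}, (forall v, g' (i v) = h v) -> g' =1 g.

(* R', embedded by iota', is the subfield E of algC; T is a common model of the   *)
(* base changes of V and V' to algC, on which tau extends both pi and pi'.        *)
Definition realisable_over (G : topologicalGroupType) (R : fieldType)
    (iota : {rmorphism R -> algC}) (V : lmodType R) (pi : smooth_rep G V)
    (E : set algC) : Prop :=
  exists (R' : fieldType) (iota' : {rmorphism R' -> algC})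
         (V' : lmodType R') (pi' : smooth_rep G V')
         (T : lmodType algC) (tau : G -> {linear T -> T})
         (i : {linear V -> T | iota \; *:%R})
         (i' : {linear V' -> T | iota' \; *:%R}),
  [/\ range iota' = E,
      is_base_change i, is_base_change i',
      forall g v, tau g (i v) = i (pi g v) &
      forall g v, tau g (i' v) = i' (pi' g v)].

Section CharacterField.
Variables (G : topologicalGroupType) (R : fieldType) (V : lmodType R).

Definition compact_open (A : set G) := compact A /\ open A.

Definition left_haar (mu : set G -> rat) : Prop :=
  [/\ exists2 A, compact_open A & mu A != 0,
      forall A, compact_open A -> 0 <= mu A,
      forall A C, compact_open A -> compact_open C -> A `&` C = set0 ->
        mu (A `|` C) = mu A + mu C &
      forall g A, compact_open A -> mu [set (g * x)%g | x in A] = mu A].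

(* A locally constant h with compact support has finitely many nonzero values,    *)
(* each on a compact open set. *)
Definition haar_int (mu : set G -> rat) (h : G -> V) : V :=
  \sum_(v \in [set~ 0]) (ratr (mu (h @^-1` [set v])) : R) *: v.

Definition hecke_op (mu : set G -> rat) (pi : smooth_rep G V) (phi : Cc G rat)
    (v : V) : V :=
  haar_int mu (fun g => (ratr (phi g) : R) *: pi g v).

(* the trace of an operator with finite-dimensional image *)
Definition is_trace (T : V -> V) (t : R) : Prop :=
  exists (n : nat) (e : 'I_n -> V) (M : 'M[R]_n),
  [/\ forall c : 'I_n -> R, \sum_i c i *: e i = 0 -> forall i, c i = 0,
      forall v, exists c : 'I_n -> R, T v = \sum_i c i *: e i,
      forall j, T (e j) = \sum_i M i j *: e i &
      t = \tr M].

Definition character_field (iota : R -> algC) (mu : set G -> rat)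
    (pi : smooth_rep G V) : set algC :=
  subfield_gen [set iota t | t in
    [set t | exists phi : Cc G rat, is_trace (hecke_op mu pi phi) t]].

End CharacterField.

Definition double_cover (G : topologicalGroupType) (F : fieldExtType Q2)
    (W : vectType F) (B : {skew_symmetric W}) (p : G -> Sp B) : Prop :=
  [/\ {morph p : x y / (x * y)%g},
      continuous p /\ (forall U, open U -> open (p @` U)),
      set_surj setT setT p,
      exists2 z, z != 1%g & forall x, p x = 1%g <-> x = 1%g \/ x = z &
      exists2 U, open_nbhs 1%g U & set_inj U p].

Definition split_cover (G : topologicalGroupType) (F : fieldExtType Q2)
    (W : vectType F) (B : {skew_symmetric W}) (p : G -> Sp B) : Prop :=
  exists s : Sp B -> G,
    [/\ {morph s : x y / (x * y)%g}, continuous s & cancel s p].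

Record smooth_character (F : fieldExtType Q2) (R : fieldType) := SmoothCharacter {
  char_fun :> F -> R;
  char_neq0 : forall x, char_fun x != 0;
  charD : forall x y, char_fun (x + y) = char_fun x * char_fun y;
  char_smooth : \forall x \near (0 : adic F^o), char_fun x = 1 }.

Section Heisenberg.
Variables (F : fieldExtType Q2) (W : vectType F) (B : {skew_symmetric W}).
Variables (X Y : {vspace W}) (R : fieldType) (psi : smooth_character F R).

Local Notation SY := (Cc (adic (subvs_of Y)) R).

(* rho_psi (x + y, t) on functions on Y, for x in X and y in Y *)
Definition heis_fun (h : W * F) (f : SY) : adic (subvs_of Y) -> R^o :=
  let x := daddv_pi X Y h.1 in
  let y := vsproj Y (daddv_pi Y X h.1) in
  fun y' : subvs_of Y =>
    psi h.2 * psi (B (vsval y') x + 2^-1 * B (vsval y) x) * f (y' + y).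

Lemma OF_denoms (s : seq F) :
  exists2 d, d != 0 /\ OF d & forall x, x \in s -> OF (d * x).
Proof.
elim: s => [|x s [d [d0 od] hd]].
  by exists 1; first by split; [exact: oner_neq0|exact: OF1].
have [e [e0 oe] he] := OF_denom x.
exists (d * e); first by split; [exact: mulf_neq0|exact: OFM].
move=> z; rewrite inE => /predU1P[->|/hd zs].
  by rewrite -mulrA; exact: OFM.
by rewrite (mulrC d) -mulrA; exact: OFM.
Qed.

Lemma lattice_denom (E : vectType F) (l : E -> F) :
  {morph l : x y / x + y} -> (forall a x, l (a *: x) = a * l x) ->
  exists2 d, d != 0 /\ OF d & forall v, lattice v -> OF (d * l v).
Proof.
move=> lD lZ; have l0 : l 0 = 0 by rewrite -(scale0r 0) lZ mul0r.
have [d hd hb] := OF_denoms (map l (vbasis {:E})); exists d => // v hv.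
rewrite (coord_vbasis (memvf v)) (big_morph l lD l0) mulr_sumr.
apply: (big_ind (@OF F)); [exact: OF0|exact: OFD|move=> i _].
rewrite lZ mulrCA; apply: OFM; first exact: hv.
by apply/hb/map_f/mem_nth; rewrite size_tuple.
Qed.

Lemma char_ball : exists2 k, k != 0 /\ OF k & forall z, OF z -> psi (k * z) = 1.
Proof.
have [c [c0 oc] hc] := char_smooth psi.
have [d [d0 od] hd] := OF_denoms
  [seq coord (vbasis {:F^o}) i (1 : F^o) | i : 'I_(\dim {:F^o})].
exists (c * d); first by split; [exact: mulf_neq0|exact: OFM].
move=> z oz; rewrite -mulrA -[c * _]add0r; apply: hc => i.
rewrite -[d * z]mulr1 (linearZ _ (1 : F^o)) /= mulrAC.
by apply: OFM => //; apply/hd/map_f; rewrite mem_enum.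
Qed.

Lemma adic_translate (E : vectType F) (a : E) :
  continuous ((fun y => y + a) : adic E -> adic E).
Proof.
by move=> y U [c hc hU]; exists c => // v /hU; rewrite /= addrAC.
Qed.

Fact heis_subproof h f : heis_fun h f \in @smooth_compact (adic (subvs_of Y)) R.
Proof.
have /asboolP[lf cf] := CcP f.
rewrite /heis_fun; set x := daddv_pi X Y _; set y := vsproj Y _.
apply/asboolP; split=> [y0|].
  have [k [k0 ok] hk] := char_ball.
  have [d [d0 od] hd] := @lattice_denom (subvs_of Y) (fun v => B (vsval v) x)
    (fun u v => linearDl B x (vsval u) (vsval v))
    (fun a v => linearZl_LR B x a (vsval v)).
  have [c [c0 oc] hc] := @adic_translate _ y _ _ (lf (y0 + y : adic _)).
  exists (k * d * c); first by split; [rewrite !mulf_neq0|do !apply: OFM].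
  move=> v hv; have -> : f (y0 + (k * d * c) *: v + y) = f (y0 + y).
    by rewrite mulrC -scalerA; apply/hc/latticeZ => //; exact: OFM.
  congr (_ * _ * _); rewrite linearD linearDl addrAC charD linearZ linearZl_LR /=.
  rewrite -!mulrA hk ?mulr1 // mulrCA.
  by apply: OFM => //; exact: hd.
have tK (b : subvs_of Y) : {within closure [set z | f z != 0],
    continuous ((fun z => z + b) : adic (subvs_of Y) -> adic (subvs_of Y))}.
  by apply: continuous_subspaceT; exact: adic_translate.
have := continuous_compact (tK (- y)) cf.
set P := (X in compact X -> _) => cP.
apply: (subclosed_compact (@closed_closure _ _) cP).
have PE : P = (fun z : adic (subvs_of Y) => z + y) @^-1` closure [set z | f z != 0].
  rewrite predeqE => z; split=> [[u hu <-]|hz]; first by rewrite /= subrK.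
  by exists (z + y); rewrite ?addrK.
have clP : closed P.
  rewrite PE; apply: (proj1 (continuous_closedP _) (@adic_translate _ y)).
  exact: closed_closure.
rewrite [X in _ `<=` X](proj1 (closure_id _) clP) PE.
apply: closureS => z /=; rewrite mulf_eq0 negb_or => /andP[_ fz].
exact: subset_closure.
Qed.

Definition heis (h : W * F) (f : SY) : SY := MkCc (heis_subproof h f).

End Heisenberg.

Section Weil.
Variables (F : fieldExtType Q2) (W : vectType F) (B : {skew_symmetric W}).
Variables (X Y : {vspace W}) (R : fieldType) (psi : smooth_character F R).
Variables (G : topologicalGroupType) (p : G -> Sp B).

(* There is only one such lift on the unipotent radical, as the latter is *)
(* 2-divisible and p has a central kernel of order 2. *)
Definition unipotent_lift (s : Sp B -> G) : Prop :=
  (forall n, unipotent_radical X n -> p (s n) = n) /\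
  (forall n m, unipotent_radical X n -> unipotent_radical X m ->
     s (n * m)%g = (s n * s m)%g).

Definition is_weil_rep (omega : smooth_rep G (Cc (adic (subvs_of Y)) R)) : Prop :=
  [/\ forall z f, p z = 1%g -> z != 1%g -> omega z f = - f,
      forall g h f, omega g (heis B X psi h (omega g^-1%g f)) =
                    heis B X psi (p g h.1, h.2) f &
      exists2 s, unipotent_lift s &
        forall n f (y : subvs_of Y), unipotent_radical X n ->
          omega (s n) f y =
          psi (2^-1 * B (n (vsval y) - vsval y) (vsval y)) * f y].

Definition is_even_part (omega : smooth_rep G (Cc (adic (subvs_of Y)) R))
    (omega_even : smooth_rep G (Cc_even (subvs_of Y) R)) : Prop :=
  forall g f, Cc_even_val (omega_even g f) = omega g (Cc_even_val f).

End Weil.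

(* Main.v *)
Require Import Defs.
From HB Require Import structures.
From mathcomp Require Import all_boot all_order all_algebra all_field.
From mathcomp Require Import all_classical topology.
From mathcomp Require Import ring.

Set Implicit Arguments.
Unset Strict Implicit.
Unset Printing Implicit Defensive.
Import Order.TTheory GRing.Theory Num.Theory.
Local Open Scope classical_set_scope.
Local Open Scope ring_scope.

(* Let sigma_a, for a in Z_2^x, be the automorphism of K raising the 2-power roots *)
(* of unity to the power a, and K^A the subfield fixed by the sigma_a with a in A. *)
(* If a = u^2 with u in F, then T_a f (y) = sigma_a (f (u^-1 y)) intertwines       *)
(* rho_psi (w, t) and rho_psi (u w, u^2 t); by Schur's lemma it commutes with each *)
(* omega(g) up to a scalar, which is 1 on N(X), hence on the conjugates of N(X),   *)
(* i.e. on the lifts of transvections, hence everywhere. So the Hecke traces on    *)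
(* the even part lie in K^A, and the even functions fixed by all T_a are a form of *)
(* it over K^A. Conversely, a rational combination of the operators of N(X), taken *)
(* after averaging over a small compact open subgroup, multiplies by a function    *)
(* that is equivariant under all sigma_a; for lam in K^A, Fourier inversion gives  *)
(* such a function equal to lam on a nonempty set and to 0 elsewhere, and the      *)
(* trace obtained is a nonzero rational multiple of lam. *)

(** * Free families and base change *)

(** The units of Z_2 act on [calK] through [sigma], and everything reduces to one claim: the
    character field and a field of realisation are both the fixed field of A
    ([character_field_even_part], [realisable_over_fixed_field]). Naming that field is cyclotomy.
    Averaging over a coset of the squares kills every root of unity except the 8-th ones
    ([fixed_field_average]), so only Q[zeta_8] and the residues of A modulo 8 matter.

    Squares enter because sigma_a psi(x) = psi(a x) ([char_sigma]), while rescaling Y by u replaces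
    psi(x) by psi(u^2 x). For a = u^2 the two changes compensate, and [twist_weil] shows that the
    resulting semilinear operator commutes exactly with the Weil representation. Hecke traces are
    then fixed by sigma_a ([character_field_sub]).

    The root u is defined up to sign, and even functions do not see the sign, so A itself acts
    semilinearly on them. An even function depends on a in A only modulo some 2^m
    ([even_has_level]), which makes Galois descent finite: the invariants span ([descended_span])
    and stay free over [calK] ([descended_free]).

    For the reverse inclusion, N(X) acts by the multipliers psi(a q(b^2)) with b = B y x. If b makes
    such a character the m-th power of the one attached to t0, then b^2 is close to m t0^2, and a
    large t0 forces m to be 2-adically close to A ([squares_in_Z2_gap], [char_choose_scale]).
    Fourier inversion over the rationals ([fourier_coefficients]) thus produces multipliers with
    values lam and 0, for lam fixed by A, and [fixed_field_trace] turns them into traces.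

    The arithmetic of F used on the way rests on two facts: compactness of [OF], read off from the
    Haar measure on the cover ([cover_OF_compact]), and non-integrality of 1/2, read off from the
    non-triviality of psi ([char_OF_half]). *)

Lemma compact_finite_cover (T : topologicalType) (A : set T) (U : T -> set T) :
    compact A -> (forall x, A x -> nbhs x (U x)) ->
  exists s : seq T, (forall x, x \in s -> A x) /\
    (forall z, A z -> exists2 x, x \in s & U x z).
Proof.
move=> cA hU; apply: contrapT => nex.
(* The filter of the complements in A of finite unions of the [U x]. It is proper if there is no
   finite cover, and a cluster point x is contradicted by [U x] itself. *)
pose F : set_system T := [set P | exists2 s : seq T, (forall x, x \in s -> A x) &
   forall z, A z -> ~ (exists2 x, x \in s & U x z) -> P z].
have PF : ProperFilter F.
  apply: Build_ProperFilter_ex => [P [s sA hs]|].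
    apply: contrapT => nP; apply: nex; exists s; split=> // z Az.
    by apply: contrapT => nz; apply: nP; exists z; exact: hs.
  split=> [|P Q [s sA hs] [t tA ht]|P Q PQ [s sA hs]].
  - by exists [::].
  - exists (s ++ t) => [x|z Az nz]; first by rewrite mem_cat => /orP[/sA|/tA].
    split; [apply: hs => // | apply: ht => //] => -[x xs Ux]; apply: nz;
      by exists x; rewrite // mem_cat xs ?orbT.
  - by exists s => // z Az nz; apply: PQ; exact: hs.
have FA : F A by exists [::].
have [x [Ax clx]] := cA F PF FA.
have [||z [[_ nUz] Uz]] := clx (A `\` U x) (U x).
- exists [:: x] => [y|z Az nz]; first by rewrite inE => /eqP->.
  by split=> // Uz; apply: nz; exists x; rewrite ?mem_head.
- exact: hU.
- exact: nUz.
Qed.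

Section FreeFamilies.
Variables (R : fieldType) (V : lmodType R).

Definition free_family n (e : 'I_n -> V) :=
  forall c : 'I_n -> R, \sum_i c i *: e i = 0 -> forall i, c i = 0.

Definition in_span n (e : 'I_n -> V) (v : V) :=
  exists c : 'I_n -> R, v = \sum_i c i *: e i.

Definition cons_family n (v : V) (e : 'I_n -> V) (i : 'I_n.+1) : V :=
  oapp e v (unlift ord0 i).

Lemma cons_family0 n v (e : 'I_n -> V) : cons_family v e ord0 = v.
Proof. by rewrite /cons_family unlift_none. Qed.

Lemma cons_familyS n v (e : 'I_n -> V) i : cons_family v e (lift ord0 i) = e i.
Proof. by rewrite /cons_family liftK. Qed.

Lemma sum_cons_family n v (e : 'I_n -> V) (c : 'I_n.+1 -> R) :
  \sum_i c i *: cons_family v e i =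
  c ord0 *: v + \sum_i c (lift ord0 i) *: e i.
Proof.
rewrite big_ord_recl cons_family0; congr (_ + _).
by apply: eq_bigr => i _; rewrite cons_familyS.
Qed.

Lemma in_span_mem n (e : 'I_n -> V) i : in_span e (e i).
Proof.
exists (fun j => (j == i)%:R); rewrite (bigD1 i) //= eqxx scale1r big1 ?addr0 //.
by move=> j /negPf->; rewrite scale0r.
Qed.

Lemma in_span0 n (e : 'I_n -> V) : in_span e 0.
Proof. by exists (fun _ => 0); rewrite big1 // => i _; rewrite scale0r. Qed.

Lemma in_span_comb n (e : 'I_n -> V) a u v :
  in_span e u -> in_span e v -> in_span e (a *: u + v).
Proof.
move=> [c ->] [d ->]; exists (fun i => a * c i + d i).
rewrite scaler_sumr -big_split /=; apply: eq_bigr => i _.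
by rewrite scalerA -scalerDl.
Qed.

Lemma in_span_sum n (e : 'I_n -> V) m (a : 'I_m -> R) (u : 'I_m -> V) :
  (forall j, in_span e (u j)) -> in_span e (\sum_j a j *: u j).
Proof.
move=> hu; apply: (big_ind (in_span e)) => [|x y hx hy|j _]; first exact: in_span0.
  by rewrite -[x]scale1r; exact: in_span_comb.
by rewrite -[_ *: _]addr0; apply: in_span_comb => //; exact: in_span0.
Qed.

Lemma in_span_cons n v (e : 'I_n -> V) u :
  in_span e u -> in_span (cons_family v e) u.
Proof.
move=> [c ->]; apply: in_span_sum => j; rewrite -(cons_familyS v e).
exact: in_span_mem.
Qed.

Lemma free_cons n v (e : 'I_n -> V) :
  free_family e -> ~ in_span e v -> free_family (cons_family v e).
Proof.
move=> fe nv c; rewrite sum_cons_family => c0.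
have c00 : c ord0 = 0.
  apply: contrapT => /eqP h; apply: nv; exists (fun i => - (c ord0)^-1 * c (lift ord0 i)).
  move/eqP: c0; rewrite addr_eq0 => /eqP/(congr1 (fun z => (c ord0)^-1 *: z)).
  rewrite scalerA mulVf // scale1r => ->; rewrite scalerN -scaleNr scaler_sumr.
  by apply: eq_bigr => i _; rewrite scalerA.
move: c0; rewrite c00 scale0r add0r => /fe h i.
by case: (unliftP ord0 i) => [j ->|->].
Qed.

Lemma exists_free_span n (v : 'I_n -> V) :
  exists m (e : 'I_m -> V), free_family e /\ (forall i, in_span e (v i)).
Proof.
elim: n v => [|n IHn] v; first by exists 0%N, v; split=> [c _|] [].
have [m [e [fe he]]] := IHn (fun i => v (lift ord0 i)).
have [v0|v0] := pselect (in_span e (v ord0)).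
  by exists m, e; split=> // i; case: (unliftP ord0 i) => [j ->|->].
exists m.+1, (cons_family (v ord0) e); split; first exact: free_cons.
move=> i; case: (unliftP ord0 i) => [j ->|->]; first exact: in_span_cons.
by rewrite -[X in in_span _ X](cons_family0 (v ord0) e); exact: in_span_mem.
Qed.

Lemma free_span_inj n (e : 'I_n -> V) (c d : 'I_n -> R) : free_family e ->
  \sum_i c i *: e i = \sum_i d i *: e i -> c =1 d.
Proof.
move=> fe /eqP; rewrite -subr_eq0 -sumrB => /eqP h i; apply/eqP.
rewrite -subr_eq0; apply/eqP; apply: (fe (fun i => c i - d i)).
by rewrite -[RHS]h; apply: eq_bigr => j _; rewrite scalerBl.
Qed.

Lemma free_family_bound (W : set V) (N : nat) (ev : V -> 'rV[R]_N) n
    (e : 'I_n -> V) :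
  (forall (m : nat) (c : 'I_m -> R) (f : 'I_m -> V), (forall i, W (f i)) ->
     \sum_i c i *: ev (f i) = 0 -> \sum_i c i *: f i = 0) ->
  (forall i, W (e i)) -> free_family e -> (n <= N)%N.
Proof.
move=> evW eW fe; pose A := \matrix_(i < n) ev (e i).
suff /eqP <- : row_free A by exact: rank_leq_col.
rewrite -kermx_eq0; apply/rowV0P => w /sub_kermxP wA.
apply/rowP => i; rewrite mxE; apply: (fe (w 0)); apply: (evW) => //.
by rewrite -[RHS]wA mulmx_sum_row; apply: eq_bigr => j _; rewrite rowK.
Qed.

(** A free family in W has free images under [ev], hence at most N members, so enlarging it must
    stop. This yields a basis of the vectors fixed by an open subgroup, with [ev] the evaluation at
    finitely many points. *)
Lemma exists_basis (W : set V) (N : nat) (ev : V -> 'rV[R]_N) :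
  (forall (m : nat) (c : 'I_m -> R) (f : 'I_m -> V), (forall i, W (f i)) ->
     \sum_i c i *: ev (f i) = 0 -> \sum_i c i *: f i = 0) ->
  exists n (e : 'I_n -> V),
    [/\ free_family e, forall i, W (e i) & forall v, W v -> in_span e v].
Proof.
move=> evW; apply: contrapT => nex.
have grow n : exists e : 'I_n -> V, free_family e /\ (forall i, W (e i)).
  elim: n => [|n [e [fe eW]]]; first by exists (fun=> 0); split=> [c _|] [].
  have [v [Wv nv]] : exists v, W v /\ ~ in_span e v.
    apply: contrapT => nv; apply: nex; exists n, e; split=> // v Wv.
    by apply: contrapT => nsp; apply: nv; exists v.
  exists (cons_family v e); split=> [|i]; first exact: free_cons.
  by case: (unliftP ord0 i) => [j ->|->]; rewrite ?cons_familyS ?cons_family0.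
have [e [fe eW]] := grow N.+1.
by have := free_family_bound evW eW fe; rewrite ltnn.
Qed.

(** Let P express e in terms of f, and C express T f in terms of e. Then Q = P C and M = C P, and
    these have the same trace. *)
Lemma trace_free_span (T : V -> V) n (e : 'I_n -> V) (M : 'M[R]_n) m
    (f : 'I_m -> V) (Q : 'M[R]_m) :
  linear T -> free_family e -> free_family f -> (forall v, in_span e (T v)) ->
  (forall i, in_span f (e i)) -> (forall j, T (e j) = \sum_i M i j *: e i) ->
  (forall k, T (f k) = \sum_l Q l k *: f l) -> \tr M = \tr Q.
Proof.
move=> lT fe ff eT /choice[p eP] eM hQ.
have Tsum k (c : 'I_k -> R) (u : 'I_k -> V) :
    T (\sum_i c i *: u i) = \sum_i c i *: T (u i).
  elim: k c u => [|k IHk] c u; last by rewrite !big_ord_recl lT IHk.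
  by rewrite !big_ord0; have := lT (-1) 0 0; rewrite scaler0 addr0 scaleN1r addNr.
have /choice[c hC] k : exists c : 'I_n -> R, T (f k) = \sum_i c i *: e i.
  exact: eT.
pose P := \matrix_(k, i) p i k; pose C := \matrix_(i, k) c k i.
have QE : Q = P *m C.
  apply/matrixP => l k; move: l; apply: (free_span_inj ff); rewrite -hQ hC.
  under eq_bigr do rewrite eP scaler_sumr.
  rewrite exchange_big; apply: eq_bigr => l _ /=.
  rewrite mxE scaler_suml; apply: eq_bigr => i _.
  by rewrite scalerA !mxE mulrC.
have ME : M = C *m P.
  apply/matrixP => i j; move: i; apply: (free_span_inj fe); rewrite -eM eP Tsum.
  under eq_bigr do rewrite hC scaler_sumr.
  rewrite exchange_big; apply: eq_bigr => l _ /=.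
  rewrite mxE scaler_suml; apply: eq_bigr => k _.
  by rewrite scalerA !mxE mulrC.
by rewrite ME QE mxtrace_mulC.
Qed.

(** Two families computing the trace both lie in the span of one free family, to which
    [trace_free_span] applies twice. *)
Lemma is_trace_unique (T : V -> V) (t t' : R) :
  linear T -> is_trace T t -> is_trace T t' -> t = t'.
Proof.
move=> lT [n [e [M [fe eT eM ->]]]] [n' [e' [M' [fe' eT' eM' ->]]]].
have [m [f [ff hf]]] := exists_free_span
  (fun i : 'I_(n + n') => match fintype.split i with inl j => e j | inr j => e' j end).
have fe1 i : in_span f (e i) by have := hf (unsplit (inl i)); rewrite unsplitK.
have fe2 i : in_span f (e' i) by have := hf (unsplit (inr i)); rewrite unsplitK.
have /choice[q hq] k : exists q : 'I_m -> R, T (f k) = \sum_l q l *: f l.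
  by have [c ->] := eT (f k); exact: in_span_sum.
pose Q := \matrix_(l, k) q k l.
have hQ k : T (f k) = \sum_l Q l k *: f l.
  by rewrite hq; apply: eq_bigr => l _; rewrite mxE.
rewrite (trace_free_span lT fe ff eT fe1 eM hQ).
by rewrite (trace_free_span lT fe' ff eT' fe2 eM' hQ).
Qed.

End FreeFamilies.

Section BaseChange.
Variables (R S : fieldType) (f : {rmorphism R -> S}).
Variables (V : lmodType R) (T : lmodType S) (i : {linear V -> T | f \; *:%R}).

Lemma semilinear_sum (U : lmodType S) (h : {linear V -> U | f \; *:%R}) n
    (c : 'I_n -> R) (e : 'I_n -> V) :
  h (\sum_k c k *: e k) = \sum_k f (c k) *: h (e k).
Proof. by rewrite linear_sum; apply: eq_bigr => k _; rewrite linearZ. Qed.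

Hypothesis i_free : forall n (e : 'I_n -> V),
  free_family e -> free_family (fun k => i (e k)).

(** Expressing the v k in a free family e, whose image under i stays free, shows that the relation
    holds coefficientwise on e; it therefore holds for any h. *)
Lemma base_change_relation (U : lmodType S) (h : {linear V -> U | f \; *:%R}) n
    (a : 'I_n -> S) (v : 'I_n -> V) :
  \sum_k a k *: i (v k) = 0 -> \sum_k a k *: h (v k) = 0.
Proof.
have [m [e [fe /choice[c hc]]]] := exists_free_span v.
have comb (U' : lmodType S) (h' : {linear V -> U' | f \; *:%R}) :
    \sum_k a k *: h' (v k) = \sum_l (\sum_k a k * f (c k l)) *: h' (e l).
  under eq_bigr do rewrite hc semilinear_sum scaler_sumr.
  rewrite exchange_big; apply: eq_bigr => l _ /=.
  by rewrite scaler_suml; apply: eq_bigr => k _; rewrite scalerA.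
rewrite !comb => /(i_free fe) h0; rewrite big1 // => l _.
by rewrite h0 scale0r.
Qed.

Hypothesis i_span : forall t,
  exists n (a : 'I_n -> S) (v : 'I_n -> V), t = \sum_k a k *: i (v k).

Lemma base_change_exists (U : lmodType S) (h : {linear V -> U | f \; *:%R}) :
  exists g : {linear T -> U}, forall v, g (i v) = h v.
Proof.
(* The graph of the extension to be built: total by [i_span], single-valued by
   [base_change_relation]. *)
pose P t u := exists n (a : 'I_n -> S) (v : 'I_n -> V),
  t = \sum_k a k *: i (v k) /\ u = \sum_k a k *: h (v k).
have comb a t u t' u' : P t u -> P t' u' -> P (a *: t + t') (a *: u + u').
  move=> [n [b [v [-> ->]]]] [n' [b' [v' [-> ->]]]].
  exists (n + n')%N, (fun k => match fintype.split k with inl j => a * b j | inr j => b' j end).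
  exists (fun k => match fintype.split k with inl j => v j | inr j => v' j end).
  rewrite !big_split_ord /=; split; congr (_ + _);
    do ?rewrite scaler_sumr; apply: eq_bigr => k _;
    by rewrite ?(unsplitK (inl k)) ?(unsplitK (inr k)) ?scalerA.
have uniq0 u : P 0 u -> u = 0.
  by move=> [n [b [v [/esym hb ->]]]]; exact: base_change_relation.
have ex t : exists u, P t u.
  by have [n [b [v ->]]] := i_span t; exists (\sum_k b k *: h (v k)), n, b, v.
have uniqP t u u' : P t u -> P t u' -> u = u'.
  move=> hu hu'; have := comb (-1) _ _ _ _ hu hu'.
  by rewrite !scaleN1r addNr => /uniq0/eqP; rewrite addrC subr_eq0 => /eqP.
have [g hg] := choice ex.
have lg : linear g by move=> a t t'; apply: (uniqP (a *: t + t')) => //; exact: comb.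
pose gM := GRing.isLinear.Build S T U *:%R g lg.
pose gL : {linear T -> U} := HB.pack g gM.
exists gL => v; apply: (uniqP (i v)) => //.
by exists 1%N, (fun=> 1), (fun=> v); rewrite !big_ord1 !scale1r.
Qed.

Lemma free_span_base_change : is_base_change i.
Proof.
move=> U h; have [g hg] := base_change_exists h; exists g => // g' hg' t.
have [n [a [v ->]]] := i_span t; rewrite !linear_sum.
by apply: eq_bigr => k _; rewrite !linearZ hg hg'.
Qed.

End BaseChange.

(* A free family of functions is dual to a family of finite combinations of       *)
(* evaluations, and such a duality is preserved by field extensions. *)
Lemma free_functions_dual (K : fieldType) (V : lmodType K) (Y : Type)
    (ev : V -> Y -> K) n (e : 'I_n -> V) :
  (forall a u v y, ev (a *: u + v) y = a * ev u y + ev v y) ->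
  (forall v, (forall y, ev v y = 0) -> v = 0) -> free_family e ->
  exists m (y : 'I_m -> Y) (d : 'M[K]_(n, m)),
    forall k l, \sum_j d k j * ev (e l) (y j) = (k == l)%:R.
Proof.
move=> evD ev0 fe.
have ev00 y : ev 0 y = 0.
  by have := evD (-1) 0 0 y; rewrite scaler0 addr0 mulN1r addNr.
have evsum m (c : 'I_m -> K) (u : 'I_m -> V) y :
    ev (\sum_i c i *: u i) y = \sum_i c i * ev (u i) y.
  elim: m c u => [|m IHm] c u; first by rewrite !big_ord0.
  by rewrite !big_ord_recl evD IHm.
(* While the rank is below n, some nonzero w is orthogonal to all rows. By freeness the combination
   of e with coefficients w is nonzero at some point, and adding the row of that point raises the
   rank. *)
have full r : (r <= n)%N ->
    exists m (y : 'I_m -> Y), (r <= \rank (\matrix_(j, l) ev (e l) (y j)))%N.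
  elim: r => [_|r IHr lt_rn].
    by exists 0%N, (fun j : 'I_0 => match notF (valP j) with end).
  have [m [y hy]] := IHr (ltnW lt_rn); set A := \matrix_(_, _) _ in hy.
  have [le_r|rA'] := ltnP r (\rank A); first by exists m, y.
  have rA : \rank A = r by apply/eqP; rewrite eqn_leq rA'.
  have : kermx A^T != 0.
    by rewrite kermx_eq0 /row_free mxrank_tr rA neq_ltn lt_rn.
  move=> /rowV0Pn[w /sub_kermxP wA w0].
  have [y0 hy0] : exists y0, \sum_l w 0 l * ev (e l) y0 != 0.
    apply: contrapT => h; case/eqP: w0; apply/rowP => l; rewrite mxE.
    apply: (fe (w 0)); apply: ev0 => z; rewrite evsum.
    by apply/eqP; apply: contrapT => /negP hz; apply: h; exists z.
  exists (m + 1)%N, (fun j => match fintype.split j with inl j => y j | inr _ => y0 end).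
  set A' := \matrix_(_, _) _; pose b := \row_l ev (e l) y0.
  have -> : A' = col_mx A b.
    apply/matrixP => j l; rewrite -[j]splitK.
    by case: (fintype.split j) => k; rewrite [LHS]mxE unsplitK /= ?(col_mxEu, col_mxEd) !mxE.
  have wb : b *m w^T != 0.
    apply: contraNneq hy0 => /matrixP/(_ 0 0); rewrite !mxE => h; apply/eqP.
    by rewrite -[RHS]h; apply: eq_bigr => l _; rewrite !mxE mulrC.
  have Aw : A *m w^T = 0 by apply: trmx_inj; rewrite trmx_mul trmxK wA trmx0.
  have : (A < col_mx A b)%MS.
    rewrite ltmxE col_mx_sub submx_refl /= -addsmxE addsmxSl /=.
    by apply/negP => /submxP[D bD]; case/eqP: wb; rewrite bD -mulmxA Aw mulmx0.
  by rewrite ltmxErank rA => /andP[].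
have [m [y hy]] := full n (leqnn n); exists m, y.
set A := \matrix_(_, _) _ in hy.
have /row_fullP[D hD] : row_full A by rewrite /row_full eqn_leq rank_leq_col.
exists D => k l; have /matrixP/(_ k l) := hD; rewrite !mxE => <-.
by apply: eq_bigr => j _; rewrite mxE.
Qed.

(** * The 2-power cyclotomic field *)

Section Z2Residues.
Implicit Types (a b x y : Z2) (n k : nat).

Lemma Z2D x y n : (x + y) n = ((x n + y n) %% 2 ^ n)%N.
Proof. by []. Qed.

Lemma Z2M x y n : (x * y) n = ((x n * y n) %% 2 ^ n)%N.
Proof. by []. Qed.

Lemma Z2_natr k n : (k%:R : Z2) n = (k %% 2 ^ n)%N.
Proof.
elim: k => [|k IHk]; first by [].
by rewrite -[in LHS]addn1 natrD Z2D IHk modnDml -[(1 : Z2) n]/(1 %% _)%N modnDmr addn1.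
Qed.

Lemma Z2X x m n : (x ^+ m) n = (x n ^ m %% 2 ^ n)%N.
Proof.
elim: m => [|m IHm]; first by rewrite expr0.
by rewrite exprS Z2M IHm modnMmr expnS.
Qed.

Lemma Z2_odd x n : (0 < n)%N -> odd (x n) = odd (x 1%N).
Proof. by move=> n0; rewrite -(Z2_le x n0) expn1 modn2 oddb. Qed.

(** If x is odd, x ^ (2 ^ n) is 1 modulo 2 ^ n by Euler's theorem, so the powers x ^ (2 ^ n - 1) are
    the residues of an inverse. *)
Lemma Z2_unitE x : (x \is a GRing.unit) = odd (x 1%N).
Proof.
apply/idP/idP => [|x1].
  move=> /unitrP[y [yx _]]; have := congr1 (fun z : Z2 => z 1%N) yx.
  rewrite Z2M /=; case: (x 1%N) (Z2_small x 1) => [|[|//]] //; by rewrite muln0.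
have co n : coprime (x n) (2 ^ n).
  case: n => [|n]; first by rewrite expn0 coprimen1.
  by rewrite coprimeXr // coprimen2 Z2_odd.
have per n : (x n ^ 2 ^ n = 1 %[mod 2 ^ n])%N.
  case: n => [|n]; first by rewrite expn0 !modn1.
  have := cyclic.Euler_exp_totient (co n.+1); rewrite totient_pfactor //= mul1n => e.
  have -> : (x n.+1 ^ 2 ^ n.+1 = (x n.+1 ^ 2 ^ n) ^ 2)%N by rewrite -expnM -expnSr.
  by rewrite -modnXm e modnXm exp1n.
have h n : (x n ^ (2 ^ n).-1 = x n.+1 ^ (2 ^ n.+1).-1 %[mod 2 ^ n])%N.
  rewrite -[RHS]modnXm Z2_le //.
  have -> : ((2 ^ n.+1).-1 = (2 ^ n).-1 + 2 ^ n)%N.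
    by rewrite expnS mul2n -addnn; case: (2 ^ n)%N (expn_gt0 2 n).
  by rewrite expnD -modnMmr per modnMmr muln1.
apply/unitrPr; exists (Z2_of h); apply: Z2_eq => n; rewrite Z2M /= modnMmr.
by rewrite -expnS prednK ?expn_gt0 // per.
Qed.

Lemma Z2_unit_odd x n : x \is a GRing.unit -> (0 < n)%N -> odd (x n).
Proof. by rewrite Z2_unitE => h /Z2_odd->. Qed.

Lemma Z2_nat_unit m : odd m -> (m%:R : Z2) \is a GRing.unit.
Proof. by rewrite Z2_unitE Z2_natr expn1 modn2 oddb. Qed.

Lemma Z2_shift x k : exists y, x = (x k)%:R + 2 ^+ k * y.
Proof.
have h n : (x (n + k) %/ 2 ^ k = x (n.+1 + k) %/ 2 ^ k %[mod 2 ^ n])%N.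
  by rewrite !modn_divl -expnD Z2_mod Z2_le // leq_add2r.
exists (Z2_of h); apply: Z2_eq => n; rewrite -natrX Z2D Z2M !Z2_natr /=.
rewrite modnMm modnDm.
have -> : (x k = x (n + k) %% 2 ^ k)%N by rewrite Z2_le ?leq_addl.
by rewrite addnC mulnC -divn_eq Z2_le ?leq_addr.
Qed.

Lemma Z2_char0 m : (0 < m)%N -> (m%:R : Z2) != 0.
Proof.
move=> m0; apply/eqP => e; have em : (m%:R : Z2) m = (0%:R : Z2) m by rewrite e.
clear e; rewrite !Z2_natr mod0n modn_small in em; last exact: ltn_expl.
by move: m0; rewrite em ltnn.
Qed.

(** Hensel's lemma at 2: replacing g by g + e 2^(n-1) adds e g 2^n to the square modulo 2^(n+1), and
    the parity of e is chosen accordingly. The term e^2 2^(2n-2) is harmless only from n = 3 on,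
    hence the starting point modulo 8. *)
Lemma nat_sqrt_2adic t n : (t = 1 %[mod 8])%N -> exists2 g, odd g & (g ^ 2 = t %[mod 2 ^ n])%N.
Proof.
move=> b8; elim: n => [|n [g og hg]]; first by exists 1%N; rewrite // !modn1.
have [n3|n3] := ltnP n 3.
  exists 1%N => //; have d8 : (2 ^ n.+1 %| 2 ^ 3)%N by rewrite dvdn_exp2l.
  by rewrite -(modn_dvdm t d8) b8 modn_dvdm.
have n1 : (0 < n)%N by exact: leq_trans n3.
pose q1 := (g ^ 2 %/ 2 ^ n)%N; pose q2 := (t %/ 2 ^ n)%N; pose c := (t %% 2 ^ n)%N.
have gE : (g ^ 2 = q1 * 2 ^ n + c)%N by rewrite /c -hg -divn_eq.
have bE : t = (q2 * 2 ^ n + c)%N by rewrite -divn_eq.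
have par p q : odd p = odd q -> (p * 2 ^ n + c = q * 2 ^ n + c %[mod 2 ^ n.+1])%N.
  by move=> pq; apply/eqP; rewrite eqn_modDr expnS -!muln_modl !modn2 pq.
pose e : nat := odd q1 (+) odd q2.
have n2 : (2 ^ n.-1 * 2 = 2 ^ n)%N by rewrite -expnSr prednK.
have o2 : odd (2 ^ n.-2) = false.
  by rewrite oddX /= orbF; case: n n3 {n1 hg gE bE par q1 q2 e c n2} => [|[|[|n]]].
have n4 : (2 ^ n.-1 = 2 ^ n.-2 * 2)%N.
  by rewrite -expnSr; case: n n3 {n1 hg gE bE par q1 q2 e c n2 o2} => [|[|n]].
exists (g + e * 2 ^ n.-1)%N.
  by rewrite oddD og n4 !oddM /= !andbF.
have -> : ((g + e * 2 ^ n.-1) ^ 2 = (q1 + e * g + e ^ 2 * 2 ^ n.-2) * 2 ^ n + c)%N.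
  have : (g ^ 2 + e * g * 2 ^ n + e ^ 2 * (2 ^ n.-1 * 2 ^ n.-1) = (q1 + e * g + e ^ 2 * 2 ^ n.-2) * 2 ^ n + c)%N.
    by rewrite gE -n2 n4; ring.
  by move=> <-; rewrite -n2; ring.
rewrite [in RHS]bE; apply: (par); rewrite !oddD !oddM og.
by rewrite o2 andbF addbF andbT /e; case: (odd q1); case: (odd q2).
Qed.

End Z2Residues.

Section CyclotomicField.

Notation pQ R p := (map_poly (ratr : rat -> R) p).

Definition K2C : {rmorphism calK -> algC} := \val.
Arguments K2C : simpl never.

Lemma K2C_inj : injective K2C.
Proof. exact: val_inj. Qed.

(** The image in [algC] of a number field generated by z is a subfield containing all primitive
    2^k-th roots, and its elements are polynomials in z. *)
Lemma cyclo2_poly k (z x : algC) : (2 ^ k).-primitive_root z -> cyclo2 k x ->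
  exists p : {poly rat}, x = (pQ algC p).[z].
Proof.
move=> zP xk; have [Qs [QsC [[|z1 [|? ?]] //= [z1E] gen]]] := num_field_exists [:: z].
have sub : is_subfield (range QsC).
  split=> [|x' y'|x' y']; rewrite !inE; first by exists 1; rewrite ?rmorph1.
    by move=> [u _ <-] [v _ <-]; exists (u - v); rewrite ?rmorphB.
  by move=> [u _ <-] [v _ <-]; exists (u / v); rewrite ?fmorph_div.
have : range QsC x.
  apply: (xk (range QsC)); split=> // w /= wP.
  have [i ->] := prim_rootP zP (prim_expr_order wP).
  by exists (z1 ^+ i); rewrite // rmorphXn /= z1E.
move=> [y _ <-]; have : y \in <<1; z1>>%VS by rewrite -adjoin_seq1 gen memvf.
move=> /Fadjoin1_polyP[p ->]; exists p.
rewrite -z1E -horner_map -map_poly_comp; congr (_.[_]).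
by apply: eq_map_poly => r; exact: (fmorph_eq_rat (QsC \o in_alg Qs)).
Qed.

Lemma calK_prim_root k : exists z : calK, (2 ^ k).-primitive_root z.
Proof.
have [z zP] := C_prim_root_exists (expn_gt0 2 k).
have zK : z \in calK_pred by rewrite inE; exists k => //; exact: sub_gen_smallest.
by exists (MkCalK zK); rewrite -(fmorph_primitive_root K2C).
Qed.

Lemma calK_poly (x : calK) : exists k0, forall k (z : calK), (k0 <= k)%N ->
  (2 ^ k).-primitive_root z -> exists p : {poly rat}, x = (pQ calK p).[z].
Proof.
have := calKP x; rewrite inE => -[k0 _ xk]; exists k0 => k z le_k zP.
have [|p hp] := @cyclo2_poly k (K2C z) (K2C x) _ (cyclo2_le le_k xk).
  by rewrite fmorph_primitive_root.
exists p; apply: K2C_inj; rewrite hp -horner_map -map_poly_comp; congr (_.[_]).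
by apply: eq_map_poly => r; exact/esym/(fmorph_rat K2C).
Qed.

Lemma horner_rat_morph (R S : fieldType) (s : {rmorphism R -> S}) (p : {poly rat}) z :
  s (pQ R p).[z] = (pQ S p).[s z].
Proof.
rewrite -horner_map -map_poly_comp; congr (_.[_]).
by apply: eq_map_poly => r /=; rewrite fmorph_rat.
Qed.

Definition cyc_aut (a : Z2) (s : calK -> calK) :=
  forall k (z : calK), z ^+ (2 ^ k) = 1 -> s z = z ^+ a k.

(** [Qn_aut_exists] gives, for each k, an automorphism [u k] of [algC] with the right effect on
    2^k-th roots of unity. On a given x the [u k] agree once k is large ([uxE]), which glues them
    into one map of [calK]; additivity and multiplicativity are checked at a common level. *)
Lemma cyc_aut_exists (a : Z2) : a \is a GRing.unit ->
  exists s : {rmorphism calK -> calK}, cyc_aut a s.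
Proof.
move=> au; have co k : coprime (a k) (2 ^ k).
  case: k => [|k]; first by rewrite expn0 coprimen1.
  by rewrite coprimeXr // coprimen2 Z2_unit_odd.
pose u k : {rmorphism algC -> algC} := sval (Qn_aut_exists (co k)).
have uE k z : z ^+ (2 ^ k) = 1 -> u k z = z ^+ a k.
  by rewrite /u; case: (Qn_aut_exists _) => /= ? ; apply.
have [k0 hk0] := choice calK_poly.
have uxE k k' (x : calK) : (k0 x <= k)%N -> (k <= k')%N -> u k' (K2C x) = u k (K2C x).
  move=> le_k le_k'; have [z zP] := calK_prim_root k.
  have [p ->] := hk0 x k z le_k zP; rewrite !horner_rat_morph; congr (_.[_]).
  have z1 : (K2C z : algC) ^+ (2 ^ k) = 1 by rewrite -rmorphXn prim_expr_order ?rmorph1.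
  rewrite (uE k) // (uE k'); last by rewrite -(subnKC le_k') expnD exprM z1 expr1n.
  by rewrite -(expr_mod (a k') z1) Z2_le.
have uK k (x : calK) : (k0 x <= k)%N -> u k (K2C x) \in calK_pred.
  move=> le_k; have [z zP] := calK_prim_root k.
  have [p ->] := hk0 x k z le_k zP; rewrite !horner_rat_morph.
  have z1 : (K2C z : algC) ^+ (2 ^ k) = 1 by rewrite -rmorphXn prim_expr_order ?rmorph1.
  rewrite uE //; have -> : (pQ algC p).[K2C z ^+ a k] = K2C (pQ calK p).[z ^+ a k].
    by rewrite horner_rat_morph rmorphXn.
  exact: valP.
pose s x : calK := MkCalK (@uK (k0 x) x (leqnn _)).
have sE k x : (k0 x <= k)%N -> K2C (s x) = u k (K2C x) by move=> h; rewrite (@uxE (k0 x) k).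
have sD : zmod_morphism s.
  move=> x y; apply: K2C_inj; pose k := maxn (k0 (x - y)) (maxn (k0 x) (k0 y)).
  by rewrite [RHS]rmorphB !(@sE k) ?rmorphB // /k !leq_max leqnn ?orbT.
have sM : monoid_morphism s.
  split=> [|x y]; apply: K2C_inj; first by rewrite (@sE (k0 1)) // !rmorph1.
  pose k := maxn (k0 (x * y)) (maxn (k0 x) (k0 y)).
  by rewrite [RHS]rmorphM !(@sE k) ?rmorphM // /k !leq_max leqnn ?orbT.
pose sA := GRing.isZmodMorphism.Build calK calK s sD.
pose sMM := GRing.isMonoidMorphism.Build calK calK s sM.
pose S : {rmorphism calK -> calK} := HB.pack s sA sMM.
exists S => k z z1; apply: K2C_inj; rewrite rmorphXn.
pose m := maxn k (k0 z); rewrite (@sE m) ?leq_maxr //.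
have z1' : (K2C z : algC) ^+ (2 ^ k) = 1 by rewrite -rmorphXn z1 rmorph1.
rewrite uE -?(expr_mod (a m) z1') ?Z2_le ?leq_maxl //.
have -> : (2 ^ m = 2 ^ k * 2 ^ (m - k))%N by rewrite -expnD subnKC ?leq_maxl.
by rewrite exprM z1' expr1n.
Qed.

(** The Galois action of Z_2^x, made total by the identity outside the units. *)
Definition sigma (a : Z2) : {rmorphism calK -> calK} :=
  if pselect (a \is a GRing.unit) is left au then sval (cid (cyc_aut_exists au))
  else idfun.

Lemma sigmaE a k (z : calK) :
  a \is a GRing.unit -> z ^+ (2 ^ k) = 1 -> sigma a z = z ^+ a k.
Proof.
by rewrite /sigma; case: pselect => // au _; case: cid => s /=; apply.
Qed.

Lemma calK_level (xs : seq calK) : exists k0, forall k (z : calK), (k0 <= k)%N ->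
  (2 ^ k).-primitive_root z ->
  forall x, x \in xs -> exists p : {poly rat}, x = (pQ calK p).[z].
Proof.
elim: xs => [|x xs [k1 h1]]; first by exists 0%N.
have [k2 h2] := calK_poly x; exists (maxn k1 k2) => k z.
rewrite geq_max => /andP[le1 le2] zP y; rewrite inE => /predU1P[->|].
  exact: h2 zP.
exact: h1 zP y.
Qed.

Lemma sigma_poly a k (z : calK) (p : {poly rat}) : a \is a GRing.unit ->
  (2 ^ k).-primitive_root z -> sigma a (pQ calK p).[z] = (pQ calK p).[z ^+ a k].
Proof. by move=> au zP; rewrite horner_rat_morph (sigmaE au (prim_expr_order zP)). Qed.

Lemma sigmaM a b x : a \is a GRing.unit -> b \is a GRing.unit ->
  sigma (a * b) x = sigma a (sigma b x).
Proof.
move=> au bu; have [k hk] := calK_poly x; have [z zP] := calK_prim_root k.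
have [p ->] := hk k z (leqnn k) zP; have abu : a * b \is a GRing.unit by rewrite unitrM au.
rewrite (sigma_poly p abu zP) (sigma_poly p bu zP).
rewrite horner_rat_morph rmorphXn /= (sigmaE au (prim_expr_order zP)).
by rewrite -exprM (expr_mod _ (prim_expr_order zP)).
Qed.

Lemma sigma1 x : sigma 1 x = x.
Proof.
have [k hk] := calK_poly x; have [z zP] := calK_prim_root k.
have [p ->] := hk k z (leqnn k) zP; rewrite (sigma_poly p (unitr1 _) zP).
by rewrite -[(1 : Z2) k]/(1 %% _)%N (expr_mod _ (prim_expr_order zP)).
Qed.

Lemma sigma_level (xs : seq calK) : exists k0, forall k (a b : Z2), (k0 <= k)%N ->
  a \is a GRing.unit -> b \is a GRing.unit -> a k = b k ->
  forall x, x \in xs -> sigma a x = sigma b x.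
Proof.
have [k0 h0] := calK_level xs; exists k0 => k a b le_k au bu ab x xs_x.
have [z zP] := calK_prim_root k; have [p ->] := h0 k z le_k zP x xs_x.
by rewrite (sigma_poly p au zP) (sigma_poly p bu zP) ab.
Qed.

(** The orthogonality relation behind all averages and Fourier inversions below. *)
Lemma sum_root_powers (R : idomainType) (w : R) n c d : w ^+ (c * n) = 1 ->
  \sum_(i < n) w ^+ (d + c * i) = if w ^+ c == 1 then w ^+ d *+ n else 0.
Proof.
move=> wn; under eq_bigr do rewrite exprD exprM.
rewrite -mulr_sumr; case: eqP => [->|/eqP w1].
  by under eq_bigr do rewrite expr1n; rewrite sumr_const card_ord mulr_natr.
have : (w ^+ c - 1) * \sum_(i < n) (w ^+ c) ^+ i = 0.
  by rewrite -subrX1 -exprM wn subrr.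
by move/eqP; rewrite mulf_eq0 subr_eq0 (negPf w1) /= => /eqP->; rewrite mulr0.
Qed.

Definition fixed_field (A : set Z2) : set calK :=
  [set x | forall a, A a -> sigma a x = x].

End CyclotomicField.

Notation pQ R p := (map_poly (ratr : rat -> R) p).

(** * Fixed fields of groups of 2-adic units *)

Section FixedFields.

(** The quotient t / a0 is 1 modulo 8, hence a square to any given precision. Cosets of the squares
    are thus detected modulo 8. *)
Lemma Z2_coset (a0 : Z2) t k : a0 \is a GRing.unit -> (t %% 8)%N = a0 3%N ->
  exists2 g : Z2, g \is a GRing.unit & (a0 * g ^+ 2) k = (t %% 2 ^ k)%N.
Proof.
move=> au t8; pose b : Z2 := t%:R / a0.
have ba : b * a0 = t%:R by rewrite divrK.
have b8 : (b 3%N = 1 %[mod 8])%N.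
  have := congr1 (fun x : Z2 => x 3%N) ba; rewrite Z2M Z2_natr t8.
  have := Z2_unit_odd au (isT : 0 < 3)%N; have := Z2_small a0 3; have := Z2_small b 3.
  by move: (a0 3%N) (b 3%N) => [|[|[|[|[|[|[|[|?]]]]]]]] [|[|[|[|[|[|[|[|?]]]]]]]].
have bk8 : (b (k + 3)%N = 1 %[mod 8])%N.
  by rewrite -b8 -[8%N]/(2 ^ 3)%N Z2_le ?leq_addl // Z2_mod.
have [g og hg] := nat_sqrt_2adic k bk8.
exists g%:R; first exact: Z2_nat_unit.
have -> : (t %% 2 ^ k)%N = (b * a0) k by rewrite ba Z2_natr.
rewrite -natrX mulrC [LHS]Z2M [RHS]Z2M Z2_natr hg.
by rewrite Z2_le ?leq_addr.
Qed.

(** D is a set of residues modulo 8 all of whose lifts are met by A. Writing x as p(z), it is the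
    mean of the p(z^(d + 8 i)) over d in D and all i. Summing over i kills each power w of z with
    w^8 != 1, and for the others the sum over D lies in S by hypothesis. *)
Lemma fixed_field_average (A : set Z2) (D : seq nat) (S : set algC) (x : calK) :
  is_subfield S -> (0 < size D)%N -> all odd D -> A `<=` Z2units ->
  (forall d i k, d \in D -> exists2 a, A a & a k = ((d + 8 * i) %% 2 ^ k)%N) ->
  (forall w : algC, w ^+ 8 = 1 -> S (\sum_(d <- D) w ^+ d)) ->
  fixed_field A x -> S (K2C x).
Proof.
move=> [S1 SB SV] D0 oD AU hA hS fx.
have S0 : S 0 by have := SB 1 1 S1 S1; rewrite subrr inE.
have SD u v : S u -> S v -> S (u + v).
  move=> Su Sv; have := SB u (0 - v); rewrite !inE sub0r opprK; apply=> //.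
  by have := SB 0 v; rewrite !inE sub0r; apply.
have SM u v : S u -> S v -> S (u * v).
  move=> Su Sv; have := SV u (1 / v); rewrite !inE div1r invrK; apply=> //.
  by have := SV 1 v; rewrite !inE div1r; apply => //; have := S1; rewrite inE.
have Sn n : S n%:R.
  elim: n => [|n IHn] //; rewrite -addn1 natrD; apply: SD => //.
  by have := S1; rewrite inE.
have SVn n u : S u -> S (u / n%:R) by move=> Su; have := SV u n%:R; rewrite !inE; apply.
have Sq r : S (ratr r).
  have Sz z : S z%:~R.
    case: z => n; first exact: Sn.
    by rewrite NegzE mulrNz; have := SB 0 n.+1%:R; rewrite !inE sub0r; apply.
  by rewrite /ratr; have := SV (numq r)%:~R (denq r)%:~R; rewrite !inE; apply.
(* The shift by 3 makes 8 N = 2^k, so that d + 8 i for i < N runs once over the residues modulo 2^k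
   that are d modulo 8. *)
have [k0 hk] := calK_poly x; pose k := (k0 + 3)%N.
have [z zP] := calK_prim_root k; have [p xE] := hk k z (leq_addr _ _) zP.
have zc : (K2C z) ^+ (2 ^ k) = 1 by rewrite -rmorphXn prim_expr_order ?rmorph1.
pose N := (2 ^ k0)%N; have kN : (8 * N = 2 ^ k)%N by rewrite /N /k expnD mulnC.
have fixE d (i : 'I_N) : d \in D -> K2C x = (pQ algC p).[K2C z ^+ (d + 8 * i)].
  move=> dD; have [a Aa ak] := hA d i k dD.
  have au : a \is a GRing.unit by exact: AU.
  rewrite -{1}(fx a Aa) xE (sigma_poly p au zP) horner_rat_morph rmorphXn ak.
  by rewrite (expr_mod _ zc).
have N0 : (size D * N)%:R != 0 :> algC by rewrite pnatr_eq0 muln_eq0 negb_or -!lt0n D0 expn_gt0.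
have -> : K2C x = (\sum_(d <- D) \sum_(i < N) (pQ algC p).[K2C z ^+ (d + 8 * i)]) / (size D * N)%:R.
  apply: canRL (mulfK N0) _; rewrite mulr_natr mulnC mulrnA.
  rewrite -[RHS]big_filter (_ : [seq d <- D | true] = D) ?filter_predT //.
  transitivity (\sum_(d <- D) K2C x *+ N).
    by rewrite big_const_seq count_predT iter_addr_0.
  rewrite big_seq [RHS]big_seq; apply: eq_bigr => d dD.
  rewrite -{1}[N]card_ord -sumr_const; apply: eq_bigr => i _; exact: fixE.
apply: SVn.
under eq_bigr do under eq_bigr do rewrite horner_coef.
under eq_bigr do rewrite exchange_big /=.
rewrite exchange_big /=; apply: (big_ind S) => [||j _]; [exact: S0|exact: SD|].
under eq_bigr do rewrite -mulr_sumr.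
rewrite -mulr_sumr; apply: (SM); first by rewrite coef_map; exact: Sq.
under eq_bigr do under eq_bigr do rewrite -exprM mulnC exprM.
have w1 : (K2C z ^+ j) ^+ (8 * N) = 1 by rewrite kN exprAC zc expr1n.
under eq_bigr do rewrite (sum_root_powers _ w1).
case: eqP => [w8|_]; last by rewrite big1.
rewrite sumrMnl -mulr_natr; apply: (SM); last exact: Sn.
exact: hS.
Qed.

End FixedFields.

Section FixedFieldCases.

Lemma Z2bracket_ind (a : Z2) (P : set Z2) :
  P `<=` Z2units -> P 1 -> (forall x y, P x -> P y -> P (x / y)) ->
  P a -> Z2squares `<=` P -> Z2bracket a `<=` P.
Proof. by move=> PU P1 PV Pa Psq x; apply; split=> // y [->|/Psq]. Qed.

Lemma Z2bracket_sq (a g : Z2) : g \is a GRing.unit -> Z2bracket a (g ^+ 2).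
Proof. by move=> gu H [_ sub]; apply: sub; right; exists g. Qed.

Lemma Z2bracket_gen_sq (a g : Z2) : g \is a GRing.unit -> Z2bracket a (a * g ^+ 2).
Proof.
move=> gu H [[HU H1 HV] sub]; rewrite -[g ^+ 2]invrK; apply: (HV).
  by apply: sub; left.
by rewrite -div1r; apply: HV => //; apply: sub; right; exists g.
Qed.

Lemma Z2bracket_units (a : Z2) : a \is a GRing.unit -> Z2bracket a `<=` Z2units.
Proof.
move=> au; apply: Z2bracket_ind => //; first exact: unitr1.
  by move=> x y; rewrite /Z2units /= => xu yu; rewrite unitrM unitrV xu.
by move=> _ [u uu <-]; rewrite /Z2units /= unitrX.
Qed.

Lemma Z2squares_units : Z2squares `<=` Z2units.
Proof. by move=> _ [u uu <-]; rewrite /Z2units /= unitrX. Qed.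

Lemma sigma_fixed_div (s : calK) a b : a \is a GRing.unit -> b \is a GRing.unit ->
  sigma a s = s -> sigma b s = s -> sigma (a / b) s = s.
Proof.
move=> au bu sa sb; have bVu : b^-1 \is a GRing.unit by rewrite unitrV.
by have := sigmaM s bVu bu; rewrite mulVr // sigma1 sb sigmaM // => <-.
Qed.

Lemma sigma_sq_level3 (z : calK) (u : Z2) : z ^+ 8 = 1 -> u \is a GRing.unit ->
  sigma (u ^+ 2) z = z.
Proof.
move=> z8 uu; rewrite (@sigmaE _ 3) ?unitrX // Z2X.
have := Z2_unit_odd uu (isT : 0 < 3)%N; have := Z2_small u 3.
by case: (u 3%N) => [|[|[|[|[|[|[|[|?]]]]]]]].
Qed.

Lemma bracket_fixed (a : Z2) (s : calK) : a \is a GRing.unit ->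
  (forall u : Z2, u \is a GRing.unit -> sigma (u ^+ 2) s = s) ->
  sigma a s = s -> fixed_field (Z2bracket a) s.
Proof.
move=> au sq sa; pose P := [set b : Z2 | b \is a GRing.unit /\ sigma b s = s].
suff sub : Z2bracket a `<=` P by move=> b /sub[].
apply: Z2bracket_ind => [b []//||b c [bu sb] [cu sc]|//|_ [u uu <-]].
- by split; rewrite ?unitr1 ?sigma1.
- by split; [rewrite unitrM unitrV bu|exact: sigma_fixed_div].
- by split; [rewrite unitrX|exact: sq].
Qed.

Lemma subfield_genM1 (S : set algC) : S `<=` subfield_gen S.
Proof. exact: sub_gen_smallest. Qed.

Lemma subfield_gen_sub (S : set algC) (T : set calK) :
  is_subfield (K2C @` T) -> S `<=` K2C @` T -> subfield_gen S `<=` K2C @` T.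
Proof. by move=> hT ST x; apply; split. Qed.

Lemma fixed_field_subfield A : is_subfield (K2C @` fixed_field A).
Proof.
split=> [|x y|x y]; rewrite !inE.
- by exists 1; rewrite ?rmorph1 // => a _; rewrite rmorph1.
- move=> [u fu <-] [v fv <-]; exists (u - v); rewrite ?rmorphB // => a Aa.
  by rewrite rmorphB fu ?fv.
- move=> [u fu <-] [v fv <-]; exists (u / v); rewrite ?fmorph_div // => a Aa.
  by rewrite fmorph_div fu ?fv.
Qed.

Lemma subfield_gen_closed (S : set algC) : let T := subfield_gen S in
  [/\ T 1, forall x, T x -> T (- x), forall x y, T x -> T y -> T (x + y),
      forall x n, T x -> T (x *+ n) & T 0].
Proof.
move=> T; have [T1 TB _] := subfield_genP S; rewrite inE in T1.
have T0 : T 0 by have := TB 1 1; rewrite !inE subrr; apply.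
have TN x : T x -> T (- x) by move=> Tx; have := TB 0 x; rewrite !inE sub0r; apply.
have TD x y : T x -> T y -> T (x + y).
  by move=> Tx Ty; have := TB x (- y); rewrite !inE opprK; apply => //; exact: TN.
split=> // x n Tx; elim: n => [|n IHn]; first by rewrite mulr0n.
by rewrite mulrS; exact: TD.
Qed.

Lemma sqrtC_pm (x : algC) d : x ^+ 2 = d -> x = sqrtC d \/ x = - sqrtC d.
Proof.
move=> xd; have : x ^+ 2 == sqrtC d ^+ 2 by rewrite sqrtCK xd.
by rewrite eqf_sqr => /orP[/eqP->|/eqP->]; [left|right].
Qed.

Lemma subfield_gen_sqrtC (d x : algC) : x ^+ 2 = d -> subfield_gen [set sqrtC d] x.
Proof.
have [_ TN _ _ _] := subfield_gen_closed [set sqrtC d].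
have Ts : subfield_gen [set sqrtC d] (sqrtC d) by exact: subfield_genM1.
by move=> /sqrtC_pm[->|->] //; exact: TN.
Qed.

(* The 8-th roots of unity fall into w^2 = 1, w^2 = -1 and w^4 = -1. *)
Lemma root8_cases (w : algC) : w ^+ 8 = 1 ->
  [\/ w ^+ 2 = 1, w ^+ 2 = -1 | w ^+ 4 = -1].
Proof.
move=> w8; have : (w ^+ 4) ^+ 2 == 1 by rewrite -exprM w8.
rewrite -[X in _ == X](expr1n _ 2) eqf_sqr => /orP[/eqP w4|/eqP w4]; last by apply: Or33.
have : (w ^+ 2) ^+ 2 == 1 by rewrite -exprM w4.
rewrite -[X in _ == X](expr1n _ 2) eqf_sqr => /orP[/eqP w2|/eqP w2].
  by apply: Or31.
by apply: Or32.
Qed.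

Lemma residues_in_coset (D : seq nat) (A : set Z2) :
  (forall d, d \in D -> exists2 a : Z2, a \is a GRing.unit & (d < 8)%N /\ a 3%N = d /\
     forall g : Z2, g \is a GRing.unit -> A (a * g ^+ 2)) ->
  forall d i k, d \in D -> exists2 a, A a & a k = ((d + 8 * i) %% 2 ^ k)%N.
Proof.
move=> hD d i k /hD[a au [d8 [a3 Aa]]].
have [|g gu gk] := @Z2_coset a (d + 8 * i) k au; last by exists (a * g ^+ 2); [exact: Aa|].
by rewrite addnC mulnC modnMDl modn_small.
Qed.

(** For an 8-th root of unity w, the sum w + w^3 + w^5 + w^7 is 4 w if w^2 = 1 and 0 otherwise, so
    it is rational. *)
Lemma fixed_field_Z2units : K2C @` fixed_field Z2units = range (ratr : rat -> algC).
Proof.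
rewrite eqEsubset; split=> [_ [x fx <-]|_ [r _ <-]]; last first.
  by exists (ratr r) => [a _|]; rewrite fmorph_rat.
have sub : is_subfield (range (ratr : rat -> algC)).
  split=> [|x' y'|x' y']; rewrite !inE; first by exists 1; rewrite ?rmorph1.
    by move=> [u _ <-] [v _ <-]; exists (u - v); rewrite ?rmorphB.
  by move=> [u _ <-] [v _ <-]; exists (u / v); rewrite ?fmorph_div.
apply: (@fixed_field_average Z2units [:: 1; 3; 5; 7]%N) fx => //.
  apply: residues_in_coset => d dD; exists d%:R.
    by apply: Z2_nat_unit; move: dD; rewrite !inE => /or4P[]/eqP->.
  split; first by move: dD; rewrite !inE => /or4P[]/eqP->.
  split; first by rewrite Z2_natr; move: dD; rewrite !inE => /or4P[]/eqP->.
  move=> g gu; rewrite /Z2units /= unitrM unitrX // andbT.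
  by apply: Z2_nat_unit; move: dD; rewrite !inE => /or4P[]/eqP->.
move=> w w8; rewrite !big_cons big_nil addr0.
have [w2|w2|w4] := root8_cases w8.
- have -> : w ^+ 1 + (w ^+ 3 + (w ^+ 5 + w ^+ 7)) = w * 4%:R.
    have -> : w ^+ 1 + (w ^+ 3 + (w ^+ 5 + w ^+ 7)) =
      w * (1 + w ^+ 2 + (w ^+ 2) ^+ 2 + (w ^+ 2) ^+ 3) by ring.
    by rewrite w2; ring.
  have : w ^+ 2 == 1 ^+ 2 by rewrite w2 expr1n.
  rewrite eqf_sqr => /orP[/eqP->|/eqP->].
    by exists 4%:R; rewrite // rmorph_nat mul1r.
  by exists (- 4%:R); rewrite // rmorphN rmorph_nat mulN1r.
- exists 0; rewrite // rmorph0.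
  have -> : w ^+ 1 + (w ^+ 3 + (w ^+ 5 + w ^+ 7)) =
    w * (1 + w ^+ 2 + (w ^+ 2) ^+ 2 + (w ^+ 2) ^+ 3) by ring.
  by rewrite w2; ring.
- exists 0; rewrite // rmorph0.
  have -> : w ^+ 1 + (w ^+ 3 + (w ^+ 5 + w ^+ 7)) = (w + w ^+ 3) * (1 + w ^+ 4) by ring.
  by rewrite w4; ring.
Qed.

Lemma calK_root8 : exists z : calK, z ^+ 8 = 1 /\ z ^+ 4 = -1.
Proof.
have [z zP] := calK_prim_root 3; exists z; split; first exact: prim_expr_order zP.
have : (z ^+ 4) ^+ 2 == 1 ^+ 2 by rewrite -exprM (prim_expr_order zP) expr1n.
rewrite eqf_sqr => /orP[|/eqP->//].
by rewrite -(prim_order_dvd zP).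
Qed.

(* d is the residue mod 8 of a; s = z + z^d for a primitive 8-th root of unity z. *)
Lemma fixed_field_bracket (a : Z2) (d : nat) (e : algC) (s : calK) :
  a \is a GRing.unit -> (d < 8)%N -> odd d -> a 3%N = d -> (K2C s) ^+ 2 = e ->
  (forall u : Z2, u \is a GRing.unit -> sigma (u ^+ 2) s = s) -> sigma a s = s ->
  (forall w : algC, w ^+ 8 = 1 -> subfield_gen [set sqrtC e] (w + w ^+ d)) ->
  K2C @` fixed_field (Z2bracket a) = subfield_gen [set sqrtC e].
Proof.
move=> au d8 od a3 s2 sq sa hw; rewrite eqEsubset; split=> [_ [x fx <-]|].
  apply: (@fixed_field_average (Z2bracket a) [:: 1; d]%N) fx => //.
  - exact: subfield_genP.
  - by rewrite /= od.
  - exact: Z2bracket_units.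
  - apply: residues_in_coset => d'; rewrite !inE => /orP[]/eqP->.
      exists 1; first exact: unitr1.
      by do 2!split=> //; move=> g gu; rewrite mul1r; exact: Z2bracket_sq.
    by exists a => //; do 2!split=> //; move=> g gu; exact: Z2bracket_gen_sq.
  - by move=> w w8; rewrite !big_cons big_nil addr0; exact: hw.
apply: subfield_gen_sub; first exact: fixed_field_subfield.
move=> _ ->; have [e1|e1] := sqrtC_pm s2.
  by exists s; [exact: bracket_fixed|exact: e1].
exists (- s); last by rewrite rmorphN e1 opprK.
apply: bracket_fixed => // [u uu|]; first by rewrite rmorphN sq.
by rewrite rmorphN sa.
Qed.

(** For z primitive of order 8, z + z^3 squares to -2 and is fixed by z -> z^3, since z^9 = z. *)
Lemma fixed_field_bracket3 :
  K2C @` fixed_field (Z2bracket 3) = subfield_gen [set sqrtC (- 2)].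
Proof.
have [z [z8 z4]] := calK_root8.
have u3 : (3 : Z2) \is a GRing.unit by exact: Z2_nat_unit.
apply: (@fixed_field_bracket 3 3 _ (z + z ^+ 3)) => //.
- rewrite -rmorphXn (_ : (z + z ^+ 3) ^+ 2 = -2) ?rmorphN ?rmorph_nat //.
  have -> : (z + z ^+ 3) ^+ 2 = z ^+ 2 + 2%:R * z ^+ 4 + z ^+ 2 * z ^+ 4 by ring.
  by rewrite z4; ring.
- by move=> u uu; rewrite rmorphD rmorphXn /= sigma_sq_level3.
- rewrite rmorphD rmorphXn /= (@sigmaE _ 3) // Z2_natr -exprM.
  by rewrite -[LHS]/(z ^+ 3 + z ^+ (8 + 1)) exprD z8 mul1r addrC.
move=> w w8; have [T1 TN TD Tn T0] := subfield_gen_closed [set sqrtC (- 2)].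
have [w2|w2|w4] := root8_cases w8.
- have -> : w + w ^+ 3 = w *+ 2 by rewrite exprS w2; ring.
  apply: Tn; have : w ^+ 2 == 1 ^+ 2 by rewrite w2 expr1n.
  by rewrite eqf_sqr => /orP[/eqP->|/eqP->] //; exact: TN.
- by have -> : w + w ^+ 3 = 0 by rewrite exprS w2; ring.
apply: subfield_gen_sqrtC.
have -> : (w + w ^+ 3) ^+ 2 = w ^+ 2 + 2%:R * w ^+ 4 + w ^+ 2 * w ^+ 4 by ring.
by rewrite w4; ring.
Qed.

(** Since z + z^5 = 0 for z of order 8, the generator is taken to be z^2, a square root of -1 fixed
    by z -> z^5. *)
Lemma fixed_field_bracket5 :
  K2C @` fixed_field (Z2bracket 5) = subfield_gen [set sqrtC (- 1)].
Proof.
have [z [z8 z4]] := calK_root8.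
have u5 : (5 : Z2) \is a GRing.unit by exact: Z2_nat_unit.
apply: (@fixed_field_bracket 5 5 _ (z ^+ 2)) => //.
- by rewrite -rmorphXn -exprM z4 rmorphN rmorph1.
- by move=> u uu; rewrite rmorphXn /= sigma_sq_level3.
- rewrite rmorphXn /= (@sigmaE _ 3) // Z2_natr -exprM.
  by rewrite -[LHS]/(z ^+ (8 + 2)) exprD z8 mul1r.
move=> w w8; have [T1 TN TD Tn T0] := subfield_gen_closed [set sqrtC (- 1)].
have -> : w + w ^+ 5 = w * (1 + w ^+ 4) by ring.
have [w2|w2|w4] := root8_cases w8.
- have -> : w * (1 + w ^+ 4) = w *+ 2.
    by rewrite (_ : 4 = 2 * 2)%N // exprM w2; ring.
  apply: Tn; have : w ^+ 2 == 1 ^+ 2 by rewrite w2 expr1n.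
  by rewrite eqf_sqr => /orP[/eqP->|/eqP->] //; exact: TN.
- have -> : w * (1 + w ^+ 4) = w *+ 2.
    by rewrite (_ : 4 = 2 * 2)%N // exprM w2; ring.
  by apply: Tn; exact: subfield_gen_sqrtC.
- by rewrite w4 subrr mulr0.
Qed.

(** The generator z + z^7 = z + z^-1 squares to 2; the residue of -1 modulo 8 is 7. *)
Lemma fixed_field_bracketN1 :
  K2C @` fixed_field (Z2bracket (- 1)) = subfield_gen [set sqrtC 2].
Proof.
have [z [z8 z4]] := calK_root8.
have u1 : (-1 : Z2) \is a GRing.unit by rewrite unitrN unitr1.
apply: (@fixed_field_bracket (-1) 7 _ (z + z ^+ 7)) => //.
- rewrite -rmorphXn (_ : (z + z ^+ 7) ^+ 2 = 2) ?rmorph_nat //.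
  have -> : (z + z ^+ 7) ^+ 2 = z ^+ 2 + 2%:R * z ^+ 8 + z ^+ 2 * (z ^+ 4) ^+ 3 by ring.
  by rewrite z8 z4; ring.
- by move=> u uu; rewrite rmorphD rmorphXn /= sigma_sq_level3.
- rewrite rmorphD rmorphXn /= (@sigmaE _ 3) // -exprM.
  by rewrite -[LHS]/(z ^+ 7 + z ^+ (8 * 6 + 1)) exprD exprM z8 expr1n mul1r addrC.
move=> w w8; have [T1 TN TD Tn T0] := subfield_gen_closed [set sqrtC 2].
have -> : w + w ^+ 7 = w * (1 + (w ^+ 2) ^+ 3) by ring.
have [w2|w2|w4] := root8_cases w8.
- have -> : w * (1 + (w ^+ 2) ^+ 3) = w *+ 2 by rewrite w2; ring.
  apply: Tn; have : w ^+ 2 == 1 ^+ 2 by rewrite w2 expr1n.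
  by rewrite eqf_sqr => /orP[/eqP->|/eqP->] //; exact: TN.
- by have -> : w * (1 + (w ^+ 2) ^+ 3) = 0 by rewrite w2; ring.
apply: subfield_gen_sqrtC.
have -> : (w * (1 + (w ^+ 2) ^+ 3)) ^+ 2 =
  w ^+ 2 + 2%:R * w ^+ 4 * w ^+ 4 + w ^+ 2 * (w ^+ 4) ^+ 3 by ring.
by rewrite w4; ring.
Qed.

(** Odd squares are 1 modulo 8, so all 8-th roots of unity are fixed; averaging over the residue 1
    alone leaves only them. *)
Lemma fixed_field_squares :
  K2C @` fixed_field Z2squares = subfield_gen [set z | 8.-primitive_root z].
Proof.
rewrite eqEsubset; split=> [_ [x fx <-]|].
  apply: (@fixed_field_average Z2squares [:: 1]%N) fx => //.
  - exact: subfield_genP.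
  - exact: Z2squares_units.
  - apply: residues_in_coset => d; rewrite !inE => /eqP->.
    exists 1; first exact: unitr1.
    by do 2!split=> //; move=> g gu; rewrite mul1r; exists g.
  move=> w w8; rewrite !big_cons big_nil addr0 expr1.
  have [z zP] := C_prim_root_exists (isT : 0 < 8)%N.
  have [T1 _ TV] := subfield_genP [set z | 8.-primitive_root z].
  have [i ->] := prim_rootP zP w8.
  have Tz : subfield_gen [set z | 8.-primitive_root z] z by exact: subfield_genM1.
  elim: (nat_of_ord i) => [|n IHn]; first by move: T1; rewrite inE.
  rewrite exprS -[X in _ * X]invrK.
  have := TV z (1 / z ^+ n); rewrite !inE div1r; apply=> //.
  by have := TV 1 (z ^+ n); rewrite !inE div1r; apply=> //; move: T1; rewrite inE.
apply: subfield_gen_sub; first exact: fixed_field_subfield.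
move=> w /= wP; have [z zP] := calK_prim_root 3.
have [i ->] : exists i : 'I_(2 ^ 3), w = K2C (z ^+ i).
  have zP' : (2 ^ 3).-primitive_root (K2C z) by rewrite fmorph_primitive_root.
  have [i ->] := prim_rootP zP' (prim_expr_order wP).
  by exists i; rewrite rmorphXn.
exists (z ^+ i) => // _ [u uu <-].
by rewrite rmorphXn /= sigma_sq_level3 //; exact: prim_expr_order zP.
Qed.

End FixedFieldCases.

(** * The ring of integers *)

Section IntegerRing.
Variable F : fieldExtType Q2.

Lemma Z2emb_nat n : Z2emb F n%:R = n%:R.
Proof. by rewrite rmorph_nat. Qed.

Lemma F_char0 n : (0 < n)%N -> (n%:R : F) != 0.
Proof. by move=> n0; rewrite -Z2emb_nat fmorph_eq0 tofrac_eq0 Z2_char0. Qed.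

Lemma F2_neq0 : (2 : F) != 0. Proof. exact: F_char0. Qed.

Lemma F2X_neq0 n : (2 ^+ n : F) != 0. Proof. by rewrite expf_neq0 ?F2_neq0. Qed.

Lemma OF_nat n : OF (n%:R : F).
Proof. by rewrite -Z2emb_nat; exact: OF_Z2. Qed.

Lemma OFX (x : F) n : OF x -> OF (x ^+ n).
Proof. by move=> ox; elim: n => [|n IHn]; rewrite ?exprS; [exact: OF1|exact: OFM]. Qed.

Lemma OFB (x y : F) : OF x -> OF y -> OF (x - y).
Proof. by move=> ox oy; apply: OFD => //; exact: OFN. Qed.

Lemma OF_unitV (a : Z2) : a \is a GRing.unit -> OF (Z2emb F a)^-1.
Proof. by move=> au; rewrite -rmorphV //; exact: OF_Z2. Qed.

Lemma OF_odd_inv n : odd n -> OF (n%:R : F)^-1.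
Proof. by move=> on; rewrite -Z2emb_nat; apply/OF_unitV/Z2_nat_unit. Qed.

Lemma OF_sqrt (z : F) : OF (z ^+ 2) -> OF z.
Proof.
move=> oz; apply: (@integral_root_monic _ _ _ _ ('X^2 - (z ^+ 2)%:P)).
- exact: monicXnsubC.
- by rewrite rootE !hornerE subrr.
- apply/integral_poly => i; rewrite coefB coefXn coefC.
  by apply: OFB; [exact: OF_nat|case: ifP => _; [|exact: OF0]].
Qed.

Lemma OF_common_multiple (s : seq F) : (forall b, b \in s -> b != 0 /\ OF b) ->
  exists2 M, M != 0 /\ OF M & forall b, b \in s -> OF (M / b).
Proof.
elim: s => [|b s IHs] hs; first by exists 1; first by split; [exact: oner_neq0|exact: OF1].
have [b0 ob] := hs b (mem_head _ _).
have [M [M0 oM] hM] := IHs (fun x xs => hs x (mem_behead (s := b :: s) xs)).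
exists (b * M); first by split; [exact: mulf_neq0|exact: OFM].
move=> x; rewrite inE => /predU1P[->|/hM xs]; first by rewrite mulrAC mulfV ?mul1r.
by rewrite -mulrA; exact: OFM.
Qed.

(** Compactness of [OF] for balls x + c(x) [OF] whose radius may depend on the centre;
    [cover_OF_compact] supplies it. *)
Definition OF_compact := forall c : F -> F,
  (forall z, OF z -> c z != 0 /\ OF (c z)) ->
  exists s : seq F, (forall x, x \in s -> OF x) /\
    forall z, OF z -> exists2 x, x \in s & OF ((z - x) / c x).

Hypothesis compactOF : OF_compact.

(** [OF] is covered by finitely many classes modulo b, so two distinct integers are congruent modulo
    b by the pigeonhole principle. Then b divides a positive integer, whose odd part is
    invertible. *)
Lemma OF_dvd_2X (b : F) : b != 0 -> OF b -> exists v, OF (2 ^+ v / b).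
Proof.
move=> b0 ob; have [s [os hs]] := compactOF (fun _ _ => conj b0 ob).
have /choice[f hf] n : exists x, x \in s /\ OF ((n%:R - x) / b).
  by have [x xs ox] := hs n%:R (OF_nat n); exists x.
have [i [j [lt_ij fij]]] : exists i j, (i < j)%N /\ f i = f j.
  pose g (i : 'I_(size s).+1) := f i.
  have /injectivePn[i [j ij gij]] : ~~ injectiveb g.
    apply/negP => /injectiveP gi.
    have := @uniq_leq_size _ [seq g i | i : 'I_(size s).+1] s.
    rewrite map_inj_uniq // enum_uniq size_map size_enum_ord ltnn => h.
    suff : false by []; apply: h => // _ /mapP[i _ ->]; exact: (hf i).1.
  have [lt|lt|e] := ltngtP i j; first by exists i, j.
    by exists j, i.
  by case/eqP: ij; exact: val_inj.
have od : OF ((j - i)%:R / b).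
  have -> : (j - i)%:R / b = (j%:R - f j) / b - (i%:R - f i) / b.
    by rewrite natrB ?(ltnW lt_ij) // fij -mulrBl; congr (_ * _); ring.
  by apply: OFB; have [] := hf j; have [] := hf i.
have n0 : (0 < j - i)%N by rewrite subn_gt0.
have [m om e] := pfactor_coprime (isT : prime 2) n0.
rewrite coprime2n in om; exists (logn 2 (j - i)).
have -> : 2 ^+ logn 2 (j - i) / b = (m%:R)^-1 * ((j - i)%:R / b).
  rewrite [in RHS]e natrM natrX -mulrA mulKf // F_char0 //.
  by case: m om {e}.
by apply: OFM => //; exact: OF_odd_inv.
Qed.

Lemma OF_2X_mul (x : F) : exists n, OF (2 ^+ n * x).
Proof.
have [b [b0 ob] obx] := OF_denom x; have [v ov] := OF_dvd_2X b0 ob.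
by exists v; rewrite -[x](mulKf b0) mulrA; exact: OFM.
Qed.

Lemma OF_2X_le (x : F) m n : (m <= n)%N -> OF (2 ^+ m * x) -> OF (2 ^+ n * x).
Proof.
move=> le_mn ox; rewrite -(subnK le_mn) exprD -mulrA; apply: OFM => //.
by apply: OFX; exact: OF_nat.
Qed.

Hypothesis OF_half : ~ OF (2^-1 : F).

Lemma OF_not_dvd (x : F) : x != 0 -> exists v, ~ OF (x / 2 ^+ v).
Proof.
move=> x0; have [v ov] := OF_2X_mul x^-1; exists v.+1 => ox; apply: OF_half.
have -> : 2^-1 = (2 ^+ v * x^-1) * (x / 2 ^+ v.+1) :> F.
  by rewrite exprS; field; rewrite x0 F2X_neq0 F2_neq0.
exact: OFM.
Qed.

(** The geometric series for the inverse, cut at an order v such that 2^v clears the denominator of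
    the inverse; the remainder is then integral. *)
Lemma OF_unit_1p2 (z : F) : OF z -> 1 + 2 * z != 0 /\ OF (1 + 2 * z)^-1.
Proof.
move=> oz; have u0 : 1 + 2 * z != 0.
  apply/eqP => u0; apply: OF_half.
  have -> : 2^-1 = - z; last exact: OFN.
  apply: (mulfI F2_neq0); rewrite mulfV ?F2_neq0 // mulrN.
  by apply/eqP; rewrite -subr_eq0 opprK u0.
split=> //; have [v ov] := OF_2X_mul (1 + 2 * z)^-1.
have -> : (1 + 2 * z)^-1 = \sum_(i < v) (- (2 * z)) ^+ i
    + (- z) ^+ v * (2 ^+ v * (1 + 2 * z)^-1).
  apply: (mulfI u0); rewrite mulfV // mulrDr.
  have -> : (1 + 2 * z) * \sum_(i < v) (- (2 * z)) ^+ i = 1 - (- (2 * z)) ^+ v.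
    by rewrite -[RHS]opprB subrX1 -[RHS]mulNr; congr (_ * _); ring.
  have -> : (1 + 2 * z) * ((- z) ^+ v * (2 ^+ v * (1 + 2 * z)^-1)) = (- z) ^+ v * 2 ^+ v.
    by field.
  by rewrite -exprMn mulNr [z * 2]mulrC subrK.
have o2z : OF (- (2 * z)) by apply/OFN/OFM => //; exact: OF_nat.
apply: OFD; last by apply: OFM => //; apply: OFX; exact: OFN.
by apply: big_ind; [exact: OF0|exact: OFD|move=> i _; exact: OFX].
Qed.

(* OF is a valuation ring; this weaker form, with a uniform defect M, is all that *)
(* is needed and follows from compactness alone. *)
Lemma OF_weak_valuation : exists2 M : F, M != 0 /\ OF M &
  forall x, x != 0 -> OF x \/ OF (M / x).
Proof.
have /choice[b hb] z : exists b : F, z != 0 -> OF z -> [/\ b != 0, OF b & OF (b / z)].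
  have [v ov] := OF_2X_mul z^-1; exists (2 ^+ v) => _ _; split=> //.
    exact: F2X_neq0.
  by apply: OFX; exact: OF_nat.
pose c z := if z == 0 then 2 else 2 * b z.
have hc z : OF z -> c z != 0 /\ OF (c z).
  move=> oz; rewrite /c; case: (eqVneq z 0) => [_|z0].
    by split; [exact: F2_neq0|exact: OF_nat].
  have [b0 ob _] := hb z z0 oz; split; first by rewrite mulf_neq0 ?F2_neq0.
  by apply: OFM => //; exact: OF_nat.
have [s [os hs]] := compactOF hc.
have [|M M0 hM] := @OF_common_multiple [seq b z | z <- s & z != 0].
  move=> _ /mapP[z + ->]; rewrite mem_filter => /andP[z0 zs].
  by have [] := hb z z0 (os z zs).
(* The element a lies near a centre x, which is nonzero as 2 does not divide a. The radius 2 b(x) is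
   a multiple of 2 x, so a is x times a unit 1 + 2 t, and x divides M. *)
have key a : OF a -> ~ OF (a / 2) -> OF (M / a).
  move=> oa na; have [x xs] := hs a oa; rewrite /c.
  case: (eqVneq x 0) => [->|x0]; first by rewrite subr0.
  have [bx0 obx obxx] := hb x x0 (os x xs) => ow.
  pose w := (a - x) / (2 * b x); pose t := b x / x * w.
  have [u0 ou] := OF_unit_1p2 (OFM obxx ow : OF t).
  have aE : a = x * (1 + 2 * t).
    by rewrite /t /w; field; rewrite x0 bx0 F2_neq0.
  have -> : M / a = M / b x * (b x / x * (1 + 2 * t)^-1).
    by rewrite aE; field; rewrite x0 bx0 u0.
  apply: OFM; last by apply: OFM => //.
  by apply/hM/map_f; rewrite mem_filter x0.
exists M => // x x0; have [ox|nx] := pselect (OF x); [by left|right].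
have ex : exists n, `[< OF (2 ^+ n * x) >].
  by have [n on] := OF_2X_mul x; exists n; apply/asboolP.
case: (ex_minnP ex) => -[|n] /asboolP on min; first by case: nx; rewrite -[x]mul1r.
have -> : M / x = 2 ^+ n.+1 * (M / (2 ^+ n.+1 * x)) by field; rewrite x0 F2X_neq0.
apply: OFM; first by apply: OFX; exact: OF_nat.
apply: key => // o2; have := min n; rewrite ltnn => h; suff : false by []; apply: h.
apply/asboolP; have -> : 2 ^+ n * x = 2 ^+ n.+1 * x / 2; last by [].
by rewrite exprS; field; rewrite F2_neq0.
Qed.

(** At each z the nonzero z^2 - b is not divisible by some power of 2. The same power serves on a
    ball around z, and finitely many balls suffice. *)
Lemma OF_square_gap (b : F) : (forall u, u ^+ 2 != b) ->
  exists2 d : F, d != 0 /\ OF d & forall z, OF z -> ~ OF ((z ^+ 2 - b) / d).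
Proof.
move=> nb; have /choice[v hv] z : exists v, ~ OF ((z ^+ 2 - b) / 2 ^+ v).
  by apply: OF_not_dvd; rewrite subr_eq0.
have hc z : OF z -> (2 ^+ v z : F) != 0 /\ OF (2 ^+ v z : F).
  by move=> _; split; [exact: F2X_neq0|apply: OFX; exact: OF_nat].
have [s [os hs]] := compactOF hc.
have [|d d0 hd] := @OF_common_multiple [seq 2 ^+ v z | z <- s].
  by move=> _ /mapP[z zs ->]; exact: hc (os z zs).
exists d => // z oz od; have [x xs ow] := hs z oz; apply: (hv x).
pose w := (z - x) / 2 ^+ v x.
have -> : (x ^+ 2 - b) / 2 ^+ v x =
    (z ^+ 2 - b) / d * (d / 2 ^+ v x) - (2 * x * w + 2 ^+ v x * w ^+ 2).
  by rewrite /w; field; rewrite F2X_neq0 d0.1.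
have ox := os x xs; apply: OFB; first by apply: OFM => //; apply/hd/map_f.
apply: OFD; first by do 2!apply: OFM => //; exact: OF_nat.
by apply: OFM; [apply: OFX; exact: OF_nat|exact: OFX].
Qed.

(** The product (v - 1)(v + 1) is small. By the weak valuation property either v - 1 is divisible by
    d, or it is large enough for v + 1 to be. *)
Lemma OF_near_pm1 (d : F) : d != 0 -> exists m, forall v : F,
  OF ((v ^+ 2 - 1) / 2 ^+ m) -> OF ((v - 1) / d) \/ OF ((v + 1) / d).
Proof.
move=> d0; have [M [M0 oM] hM] := OF_weak_valuation.
have [m om] := OF_2X_mul (M * d ^+ 2)^-1; exists m => v ov.
have [->|v1] := eqVneq v 1; first by left; rewrite subrr mul0r; exact: OF0.
have v10 : v - 1 != 0 by rewrite subr_eq0.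
have [|ox|ox] := hM ((v - 1) / d); [by rewrite mulf_neq0 ?invr_neq0|by left|right].
have -> : (v + 1) / d = 2 ^+ m * (M * d ^+ 2)^-1 * ((v ^+ 2 - 1) / 2 ^+ m) * (M / ((v - 1) / d)).
  by field; rewrite d0 v10 M0 F2X_neq0.
by do 2!apply: OFM => //.
Qed.

Lemma squares_in_Z2_unit (a : Z2) : squares_in_Z2 F a -> a \is a GRing.unit.
Proof. by case. Qed.

Lemma squares_in_Z2P (a : Z2) (u : F) : a \is a GRing.unit -> u ^+ 2 = Z2emb F a ->
  squares_in_Z2 F a /\ u != 0.
Proof.
move=> au u2; have a0 : Z2emb F a != 0.
  by rewrite fmorph_eq0 tofrac_eq0; apply: contraTneq au => ->; rewrite unitr0.
have u0 : u != 0 by apply: contraNneq a0 => e; rewrite -u2 e expr0n.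
split=> //; split=> //; exists u => //; split=> //.
  by apply: OF_sqrt; rewrite u2; exact: OF_Z2.
by apply: OF_sqrt; rewrite exprVn u2; exact: OF_unitV.
Qed.

(** Let n be the residue of t modulo 8, so that t is close to n g^2 with g a 2-adic unit. If n is a
    square in F, then n g^2 is the required element of A. Otherwise (z / g)^2 would come closer to n
    than [OF_square_gap] allows. There are only eight values of n, hence a uniform d. *)
Lemma squares_in_Z2_gap k : exists2 d : F, d != 0 /\ OF d &
  forall (z : F) (t : nat), odd t -> OF ((z ^+ 2 - t%:R) / d) ->
    exists2 a : Z2, squares_in_Z2 F a & a k = (t %% 2 ^ k)%N.
Proof.
have /choice[d hd] n : exists d : F, [/\ d != 0, OF d &
    (exists u : F, u ^+ 2 = n%:R) \/ forall z, OF z -> ~ OF ((z ^+ 2 - n%:R) / d)].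
  have [h|nu] := pselect (exists u : F, u ^+ 2 = n%:R).
    by exists 1; split; [exact: oner_neq0|exact: OF1|left].
  have [|d [d0 od] hd] := @OF_square_gap n%:R; last by exists d; split=> //; right.
  by move=> u; apply/eqP => u2; apply: nu; exists u.
have [|D [D0 oD] hD] := @OF_common_multiple [seq d n | n <- iota 0 8].
  by move=> _ /mapP[n _ ->]; have [] := hd n.
have [m om] := OF_2X_mul D^-1; exists D => // z t ot oz.
pose n := (t %% 8)%N; have on : odd n by rewrite /n odd_mod.
have nu : (n%:R : Z2) \is a GRing.unit by exact: Z2_nat_unit.
(* Precision k for the conclusion, precision m so that 2^k' is divisible by D. *)
pose k' := maxn k m.
have [|g gu gE] := @Z2_coset n%:R t k' nu; first by rewrite Z2_natr modn_mod.
have oz' : OF z.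
  apply: OF_sqrt; have -> : z ^+ 2 = (z ^+ 2 - t%:R) / D * D + t%:R by field; rewrite D0.
  by apply: OFD; [exact: OFM|exact: OF_nat].
pose G := Z2emb F g; have G0 : G != 0.
  by rewrite fmorph_eq0 tofrac_eq0; apply: contraTneq gu => ->; rewrite unitr0.
have [d0 od [[u u2]|nz]] := hd n.
  exists (n%:R * g ^+ 2).
    have ngu : n%:R * g ^+ 2 \is a GRing.unit by rewrite unitrM nu unitrX.
    apply: (@squares_in_Z2P _ (u * G) ngu _).1.
    by rewrite exprMn u2 rmorphM rmorphXn rmorph_nat.
  by rewrite -(@Z2_le _ k k') ?leq_maxl // gE modn_dvdm // dvdn_exp2l // leq_maxl.
case: (nz (z / G)); first by apply: OFM => //; exact: OF_unitV.
have [y yE] : exists y, t%:R = n%:R * g ^+ 2 + 2 ^+ k' * y :> Z2.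
  have [y1 e1] := Z2_shift t%:R k'; have [y2 e2] := Z2_shift (n%:R * g ^+ 2) k'.
  exists (y1 - y2); rewrite {1}e1 {1}e2 gE Z2_natr; ring.
have tE : t%:R = n%:R * G ^+ 2 + 2 ^+ k' * Z2emb F y.
  by have := congr1 (Z2emb F) yE; rewrite rmorphD !rmorphM !rmorphXn !rmorph_nat.
have -> : ((z / G) ^+ 2 - n%:R) / d n =
    (G^-1) ^+ 2 * ((z ^+ 2 - t%:R) / D + 2 ^+ k' * D^-1 * Z2emb F y) * (D / d n).
  by rewrite tE; field; rewrite G0 D0 d0.
apply: OFM; last first.
  by apply/hD/map_f; rewrite mem_iota /n ltn_mod.
apply: OFM; first by apply: OFX; exact: OF_unitV.
apply: OFD => //; apply: OFM; last exact: OF_Z2.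
by apply: (OF_2X_le _ om); rewrite leq_maxr.
Qed.

End IntegerRing.

(** * Continuity in the adic topology *)

Section AdicContinuity.
Variable F : fieldExtType Q2.

Lemma linear_lattice_denom (V V' : vectType F) (l : {linear V -> V'}) :
  exists2 d, d != 0 /\ OF d & forall v, lattice v -> lattice (d *: l v).
Proof.
have /choice[d hd] i : exists d : F, (d != 0 /\ OF d) /\
    forall v : V, lattice v -> OF (d * coord (vbasis {:V'}) i (l v)).
  have [||d hd h] := @lattice_denom F V (fun v => coord (vbasis {:V'}) i (l v)).
  - by move=> u v; rewrite !linearD.
  - by move=> a u; rewrite !linearZ.
  by exists d.
have [|M hM hMd] := @OF_common_multiple _ [seq d i | i <- enum 'I_(\dim {:V'})].
  by move=> _ /mapP[i _ ->]; exact: (hd i).1.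
exists M => // v hv i; rewrite linearZ /=.
have -> : M * coord (vbasis {:V'}) i (l v) = M / d i * (d i * coord (vbasis {:V'}) i (l v)).
  by rewrite mulrA divfK //; exact: (hd i).1.1.
apply: OFM; last exact: (hd i).2.
by apply/hMd/map_f; rewrite mem_enum.
Qed.

Lemma linear_adic_continuous (V V' : vectType F) (l : {linear V -> V'}) :
  continuous (l : adic V -> adic V').
Proof.
move=> x U [c [c0 oc] hc]; have [d [d0 od] hd] := linear_lattice_denom l.
exists (c * d); first by split; [exact: mulf_neq0|exact: OFM].
by move=> v hv; rewrite /= linearD linearZ /= -scalerA; apply: hc; exact: hd.
Qed.

Lemma adic_nbhsF (x : F) (U : set (adic F^o)) : nbhs (x : adic F^o) U <->
  exists2 c : F, c != 0 /\ OF c & forall z, OF z -> U (x + c * z).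
Proof.
split=> [[c [c0 oc] hc]|[c [c0 oc] hc]].
  have [d [d0 od] hd] := OF_denoms
    [seq coord (vbasis {:F^o}) i (1 : F^o) | i : 'I_(\dim {:F^o})].
  exists (c * d); first by split; [exact: mulf_neq0|exact: OFM].
  move=> z oz; rewrite -mulrA; apply: hc => i.
  rewrite -[d * z]mulr1 (linearZ _ (1 : F^o)) /= mulrAC.
  by apply: OFM => //; apply/hd/map_f; rewrite mem_enum.
have [||d [d0 od] hd] := @lattice_denom F F^o (fun v => v) => //.
exists (c * d); first by split; [exact: mulf_neq0|exact: OFM].
by move=> v hv; rewrite -scalerA; apply: hc; exact: hd.
Qed.

Lemma linear_form_nbhs (V : vectType F) (l : {linear V -> F^o}) (x : adic V) (c : F) :
  c != 0 -> OF c -> nbhs x [set y : adic V | OF ((l y - l x) / c)].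
Proof.
move=> c0 oc; apply: (@linear_adic_continuous _ _ l x [set z | OF ((z - l x) / c)]).
by apply/adic_nbhsF; exists c => // z oz; rewrite /= addrC addKr mulrC mulKf.
Qed.

End AdicContinuity.

(** * Smooth characters of F *)

Section SmoothCharacter.
Variables (F : fieldExtType Q2) (psi : smooth_character F calK).

Lemma char0 : psi 0 = 1.
Proof.
have := charD psi 0 0; rewrite addr0 -{1}[psi 0]mulr1 => /(mulfI (char_neq0 psi 0)).
by move<-.
Qed.

Lemma charN x : psi (- x) = (psi x)^-1.
Proof.
apply: (mulfI (char_neq0 psi x)); rewrite -charD subrr char0 mulfV //.
exact: char_neq0.
Qed.

Lemma charMn n x : psi (n%:R * x) = psi x ^+ n.
Proof.
elim: n => [|n IHn]; first by rewrite mul0r char0.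
by rewrite -addn1 natrD mulrDl charD IHn mul1r addn1 exprSr.
Qed.

Hypotheses (compactOF : OF_compact F) (psi_nontrivial : exists x, psi x != 1).

Lemma char_OF_half : ~ OF (2^-1 : F).
Proof.
move=> o2; have [x /eqP] := psi_nontrivial; apply.
have [k [k0 ok] hk] := char_ball psi.
have [n on] := OF_2X_mul compactOF (x / k).
have -> : x = k * ((2^-1) ^+ n * (2 ^+ n * (x / k))).
  by rewrite exprVn mulKf ?F2X_neq0 // mulrCA mulfV ?mulr1.
by apply: hk; apply: OFM => //; exact: OFX.
Qed.

(** If z were too large, a0 / z would be integral for an a0 with psi(a0) != 1, and psi would not be
    trivial on the multiples of z. *)
Lemma char_annihilator_bounded : exists2 r, r != 0 &
  forall z, (forall a, OF a -> psi (a * z) = 1) -> OF (r * z).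
Proof.
have [a0 pa0] := psi_nontrivial.
have [M [M0 oM] hM] := OF_weak_valuation compactOF char_OF_half.
have a00 : a0 != 0 by apply: contraNneq pa0 => ->; rewrite char0.
exists (M / a0) => [|z hz]; first by rewrite mulf_neq0 ?invr_neq0.
have [->|z0] := eqVneq z 0; first by rewrite mulr0; exact: OF0.
have [|oz|oz] := hM (a0 / z); first by rewrite mulf_neq0 ?invr_neq0.
  by case/eqP: pa0; rewrite -(hz _ oz) divfK.
by rewrite (_ : M / a0 * z = M / (a0 / z)) //; field; rewrite a00 z0.
Qed.

Lemma char_order_bounded (r : F) : r != 0 ->
  exists n, forall x, OF (r * x) -> psi x ^+ (2 ^ n) = 1.
Proof.
move=> r0; have [k [k0 ok] hk] := char_ball psi.
have [n on] := OF_2X_mul compactOF (r * k)^-1.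
exists n => x ox; rewrite -charMn natrX.
have -> : 2 ^+ n * x = k * (2 ^+ n * (r * k)^-1 * (r * x)) by field; rewrite r0 k0.
by apply: hk; exact: OFM.
Qed.

(** The value psi(x) is a 2^n-th root of unity, and modulo 2^n the unit a acts as a natural number;
    the remaining multiple of 2^n x lies in the kernel of psi. *)
Lemma char_sigma (a : Z2) x : a \is a GRing.unit ->
  psi (Z2emb F a * x) = sigma a (psi x).
Proof.
move=> au; have [k [k0 ok] hk] := char_ball psi.
have [n on] := OF_2X_mul compactOF (x / k).
have pn : psi x ^+ (2 ^ n) = 1.
  rewrite -charMn natrX; have -> : 2 ^+ n * x = k * (2 ^+ n * (x / k)) by field.
  exact: hk.
rewrite (sigmaE au pn); have [y aE] := Z2_shift a n; rewrite {1}aE.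
rewrite rmorphD rmorphM rmorphXn !rmorph_nat mulrDl charD charMn.
have -> : 2 ^+ n * Z2emb F y * x = k * (Z2emb F y * (2 ^+ n * (x / k))) by field.
by rewrite hk ?mulr1 //; apply: OFM => //; exact: OF_Z2.
Qed.

End SmoothCharacter.

(** * The symplectic group *)

Section SymplecticGroup.
Variables (F : fieldExtType Q2) (W : vectType F) (B : {skew_symmetric W}).
Hypothesis B_symplectic : is_psymplectic B.

Lemma skewC u v : B u v = - B v u.
Proof. by rewrite hermC /= expr1 mulN1r. Qed.

Lemma skew_diag u : B u u = 0.
Proof.
have /eqP := skewC u u; rewrite -addr_eq0 -mulr2n -mulr_natl mulf_eq0.
by rewrite (negPf (F2_neq0 F)) => /eqP.
Qed.

Lemma symplectic_nondeg u : (forall v, B u v = 0) -> u = 0.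
Proof.
move=> hu; have [/eqP rad0 _ _] := B_symplectic; apply/eqP; rewrite -memv0 -rad0.
by apply/mem_orthovP => v _; exact: hu.
Qed.

Lemma symplectic_neq0 u : u != 0 -> exists v, B v u != 0.
Proof.
move=> u0; apply: contrapT => h; case/eqP: u0; apply: symplectic_nondeg => v.
rewrite skewC; apply/eqP; rewrite oppr_eq0; apply/negPn/negP => hv.
by apply: h; exists v.
Qed.

Lemma isometry_Sp_subproof (f : 'End(W)) : (forall u v, B (f u) (f v) = B u v) ->
  `[< (forall u v, B (f u) (f v) = B u v) /\ lker f = 0%VS >].
Proof.
move=> hf; apply/asboolP; split=> //; apply/eqP; rewrite -subv0; apply/subvP => u.
rewrite memv_ker => /eqP fu; rewrite memv0; apply/eqP/symplectic_nondeg => v.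
by rewrite -hf fu linear0l.
Qed.

Definition isometry_Sp f hf : Sp B := MkSp (@isometry_Sp_subproof f hf).

Definition transvection_fun (a : F) (w v : W) : W := v + (a * B v w) *: w.

Lemma transvection_linear a w : linear (transvection_fun a w).
Proof.
move=> c u v; rewrite /transvection_fun linearDl linearZl_LR /= scalerDr addrACA.
by congr (_ + _); rewrite scalerA -scalerDl; congr (_ *: _); ring.
Qed.

Definition transvection_lin a w : {linear W -> W} :=
  HB.pack (transvection_fun a w)
    (GRing.isLinear.Build F W W *:%R (transvection_fun a w) (transvection_linear a w)).

Lemma transvection_isometry a w u v :
  B (linfun (transvection_lin a w) u) (linfun (transvection_lin a w) v) = B u v.
Proof.
rewrite !lfunE /= /transvection_fun.
rewrite !(linearDl, linearDr, linearZl_LR, linearZr_LR) /= skew_diag (skewC w v).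
by ring.
Qed.

Definition transvection a w : Sp B := isometry_Sp (transvection_isometry a w).

Lemma transvectionE a w v : transvection a w v = v + (a * B v w) *: w.
Proof. by rewrite -[LHS]/(linfun (transvection_lin a w) v) lfunE. Qed.

Lemma Sp_mulE (g h : Sp B) v : (g * h)%g v = g (h v).
Proof. by rewrite /= comp_lfunE. Qed.

Lemma Sp_1E v : (1%g : Sp B) v = v.
Proof. by rewrite /= id_lfunE. Qed.

Lemma transvectionD a b w : (transvection a w * transvection b w)%g = transvection (a + b) w.
Proof.
apply: Sp_eq => v; rewrite Sp_mulE !transvectionE linearDl linearZl_LR /= skew_diag.
by rewrite mulr0 addr0 -addrA -scalerDl; congr (_ + _ *: _); ring.
Qed.

Lemma transvection0 w : transvection 0 w = 1%g.
Proof. by apply: Sp_eq => v; rewrite transvectionE Sp_1E mul0r scale0r addr0. Qed.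

Lemma transvectionK a w : (transvection (- a) w * transvection a w)%g = 1%g.
Proof. by rewrite transvectionD addNr transvection0. Qed.

Lemma transvection_conj (g : Sp B) a w :
  (g * transvection a w * g^-1)%g = transvection a (g w).
Proof.
apply: Sp_eq => v; have gK : g ((g^-1)%g v) = v by rewrite -Sp_mulE mulgV Sp_1E.
have -> : (transvection a (g w)) v = v + (a * B ((g^-1)%g v) w) *: g w.
  by rewrite transvectionE -{2}gK Sp_isom.
by rewrite !Sp_mulE !transvectionE linearD linearZ /= gK.
Qed.

Lemma transvection_move u v : B u v != 0 -> transvection (B u v)^-1 (v - u) u = v.
Proof.
move=> uv; rewrite transvectionE (linearBr B u) /= skew_diag subr0 mulVf // scale1r.
by rewrite addrC subrK.
Qed.

Definition fixed_space (g : Sp B) : {vspace W} := lker (val g - \1)%VF.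

Lemma mem_fixed_space g v : (v \in fixed_space g) = (g v == v).
Proof. by rewrite memv_ker add_lfunE opp_lfunE id_lfunE subr_eq0. Qed.

Lemma transvection_fixed (g : Sp B) a u :
  (fixed_space g <= fixed_space (transvection a (g u - u) * g)%g)%VS.
Proof.
apply/subvP => x; rewrite !mem_fixed_space => /eqP gx.
have e : B x (g u) = B x u by rewrite -{1}gx Sp_isom.
by rewrite Sp_mulE transvectionE gx (linearBr B x) /= e subrr mulr0 scale0r addr0.
Qed.

(* If B v (g v) != 0, the transvection along g v - v taking g v back to v enlarges *)
(* the fixed space; if B v (g v) vanishes identically, a preliminary transvection  *)
(* along some g v0 - v0 != 0 breaks this without shrinking the fixed space. *)
Lemma Sp_transvection_ind (P : Sp B -> Prop) :
  (forall g h, P g -> P h -> P (g * h)%g) -> (forall a w, P (transvection a w)) ->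
  forall g, P g.
Proof.
move=> PM PT g.
have tK a w h : P (transvection a w * h)%g -> P h.
  by move=> /(PM _ _ (PT (- a) w)); rewrite mulgA transvectionK mul1g.
have [n] := ubnP (\dim {:W} - \dim (fixed_space g)); elim: n g => // n IHn g le_n.
have step h : (fixed_space g <= fixed_space h)%VS -> (exists v, B v (h v) != 0) -> P h.
  move=> sub [v hv]; pose a := (B (h v) v)^-1.
  apply: (tK a (h v - v)); apply: IHn.
  pose h' := (transvection a (h v - v) * h)%g.
  have sub' : (fixed_space h <= fixed_space h')%VS by exact: transvection_fixed.
  have v_in : v \in fixed_space h'.
    rewrite mem_fixed_space Sp_mulE transvectionE (linearBr B (h v)) /= skew_diag sub0r mulrN.
    rewrite mulVf; last by rewrite skewC oppr_eq0.
    by rewrite scaleN1r opprB addrC subrK.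
  have v_nin : v \notin fixed_space h.
    by rewrite mem_fixed_space; apply: contraNneq hv => ->; rewrite skew_diag.
  have lt : (\dim (fixed_space g) < \dim (fixed_space h'))%N.
    apply: leq_ltn_trans (dimvS sub) _; rewrite ltnNge; apply/negP => le.
    case/negP: v_nin; suff /eqP -> : fixed_space h == fixed_space h' by [].
    by rewrite eqEdim sub' le.
  rewrite -ltnS; apply: leq_trans le_n; rewrite ltnS ltn_sub2l //.
  exact: leq_trans lt (dimvS (subvf _)).
have [ex|nex] := pselect (exists v, B v (g v) != 0); first exact: step (subvv _) ex.
have [ex|nex1] := pselect (exists v0, g v0 - v0 != 0); last first.
  suff -> : g = 1%g by rewrite -(transvection0 0).
  apply: Sp_eq => v; rewrite Sp_1E; apply/eqP; rewrite -subr_eq0; apply/negPn/negP => h.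
  by apply: nex1; exists v.
have [v0 w0] := ex; set w := _ - _ in w0; apply: (tK 1 w); apply: step.
  exact: transvection_fixed.
have [x1 hx1] := symplectic_neq0 w0.
have [x2 hx2] : exists x, B (g x) w != 0.
  have [y hy] := symplectic_neq0 w0; exists ((g^-1)%g y).
  by rewrite -Sp_mulE mulgV Sp_1E.
have [x [h1 h2]] : exists x, B x w != 0 /\ B (g x) w != 0.
  have [e1|?] := eqVneq (B (g x1) w) 0; last by exists x1.
  have [e2|?] := eqVneq (B x2 w) 0; last by exists x2.
  by exists (x1 + x2); rewrite (linearD g) 2!(linearDl B w) /= e1 e2 addr0 add0r.
exists x; rewrite Sp_mulE transvectionE linearDr linearZr_LR /=.
have -> : B x (g x) = 0.
  by apply/eqP/negPn/negP => h; apply: nex; exists x.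
by rewrite add0r mul1r mulf_neq0.
Qed.

Lemma lagrangian_isotropic (X : {vspace W}) x y :
  orthov B X = X -> x \in X -> y \in X -> B x y = 0.
Proof. by move=> XX; rewrite -{1}XX => /mem_orthovP; apply. Qed.

Lemma lagrangian_maximal (X : {vspace W}) w :
  orthov B X = X -> (forall x, x \in X -> B w x = 0) -> w \in X.
Proof. by move=> XX hw; rewrite -XX; apply/mem_orthovP. Qed.

Lemma transvection_unipotent (X : {vspace W}) a x :
  orthov B X = X -> x \in X -> unipotent_radical X (transvection a x).
Proof.
move=> XX xX; split=> [y yX|w]; rewrite transvectionE.
  by rewrite (lagrangian_isotropic XX yX xX) mulr0 scale0r addr0.
by rewrite addrC addKr memvZ.
Qed.

(** If w is not in X, some x in X has B w x != 0 and a transvection carries w to x. By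
    [transvection_conj] every transvection is therefore conjugate to one in N(X). *)
Lemma Sp_move_lagrangian (X : {vspace W}) w : orthov B X = X ->
  exists g : Sp B, g w \in X.
Proof.
move=> XX; have [wX|wX] := boolP (w \in X); first by exists 1%g; rewrite Sp_1E.
have [x xX wx] : exists2 x, x \in X & B w x != 0.
  by apply/mem_orthovPn; rewrite XX.
by exists (transvection (B w x)^-1 (x - w)); rewrite transvection_move.
Qed.

(* For v and u in Y, an element of N(Y), affine in v, taking w1 to w1 + v as soon *)
(* as B w1 u = 1. *)
Definition shear_fun (u w1 v w : W) : W :=
  w + (B w u *: v + (B w v - B w1 v * B w u) *: u).

Lemma shear_linear u w1 v : linear (shear_fun u w1 v).
Proof.
move=> c x y; rewrite /shear_fun !(linearDl, linearZl_LR) /= [in RHS]scalerDr.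
rewrite [RHS]addrACA; congr (_ + _).
rewrite scalerDr addrACA !scalerA -!scalerDl.
by congr (_ *: _ + _ *: _); ring.
Qed.

Definition shear_lin u w1 v : {linear W -> W} :=
  HB.pack (shear_fun u w1 v)
    (GRing.isLinear.Build F W W *:%R (shear_fun u w1 v) (shear_linear u w1 v)).

Lemma shear_isometry (Y : {vspace W}) u w1 v x y : orthov B Y = Y ->
  u \in Y -> v \in Y ->
  B (linfun (shear_lin u w1 v) x) (linfun (shear_lin u w1 v) y) = B x y.
Proof.
move=> YY uY vY; rewrite !lfunE /= /shear_fun.
rewrite !(linearDl, linearDr, linearZl_LR, linearZr_LR) /= !skew_diag.
rewrite (lagrangian_isotropic YY uY vY) (lagrangian_isotropic YY vY uY).
rewrite (skewC u y) (skewC v y); ring.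
Qed.

Lemma Sp_nbhs1 (U : set (Sp B)) : nbhs (1%g : Sp B) U ->
  exists2 c : F, c != 0 /\ OF c & forall (g : Sp B) (f : 'End(W)),
    lattice f -> val g = (\1 + c *: f)%VF -> U g.
Proof.
rewrite nbhsE => -[O [[O' oO' OE] O1] OU].
have : nbhs (val (1%g : Sp B) : adic 'End(W)) O'.
  by apply: open_nbhs_nbhs; split=> //; move: O1; rewrite -OE.
move=> [c hc hO']; exists c => // g f lf gE; apply: OU; rewrite -OE /=.
by rewrite [Sp_val g]gE; exact: hO'.
Qed.

(** The shear by v minus the identity is linear in v, so small v give elements near 1: any
    neighbourhood of 1 moves w1 through a whole lattice of Y. *)
Lemma shear_small (Y : {vspace W}) (u w1 : W) (U : set (Sp B)) :
  orthov B Y = Y -> u \in Y -> B w1 u = 1 -> nbhs (1%g : Sp B) U ->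
  exists2 c : F, c != 0 /\ OF c & forall v : subvs_of Y, lattice v ->
    exists2 g : Sp B, U g & g w1 = w1 + c *: vsval v.
Proof.
move=> YY uY w1u /Sp_nbhs1[c [c0 oc] hU].
pose phi (v : subvs_of Y) : 'End(W) := (linfun (shear_lin u w1 (vsval v)) - \1)%VF.
have phiE v w : phi v w = B w u *: vsval v + (B w (vsval v) - B w1 (vsval v) * B w u) *: u.
  by rewrite /phi add_lfunE opp_lfunE id_lfunE lfunE /= /shear_fun addrC addKr.
have lphi : linear phi.
  move=> a x y; apply/lfunP => w; rewrite [RHS]add_lfunE scale_lfunE !phiE linearP /=.
  rewrite !(linearDr, linearZr_LR) /= !scalerDr !scalerA.
  rewrite [RHS]addrACA -!scalerDl; congr (_ + _ + _ *: _); last by ring.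
pose Phi : {linear subvs_of Y -> 'End(W)} :=
  HB.pack phi (GRing.isLinear.Build F _ _ *:%R phi lphi).
have [d [d0 od] hd] := linear_lattice_denom Phi.
exists (c * d); first by split; [exact: mulf_neq0|exact: OFM].
move=> v lv; pose v' : subvs_of Y := (c * d) *: v.
have hiso := @shear_isometry Y u w1 (vsval v') _ _ YY uY (subvsP v').
exists (isometry_Sp hiso).
  apply: (hU _ (d *: Phi v)); first exact: hd.
  rewrite scalerA -linearZ /= -/v' /Phi /= /phi; by rewrite addrC subrK.
rewrite -[LHS]/(linfun (shear_lin u w1 (vsval v')) w1) lfunE /= /shear_fun w1u mulr1 subrr scale0r addr0 scale1r.
by congr (_ + _).
Qed.

End SymplecticGroup.

(** * Haar measures and Hecke operators *)

Section TopologicalGroups.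
Variable G : topologicalGroupType.
Implicit Types (g h x : G) (H A : set G).

Lemma mulg_nbhs x y (A : set G) : nbhs (x * y)%g A ->
  exists U V : set G, [/\ nbhs x U, nbhs y V & forall u v, U u -> V v -> A (u * v)%g].
Proof.
move=> /(@mulg_continuous G (x, y)) [[U V] [/= hU hV] UV].
by exists U, V; split=> // u v Uu Vv; exact: (UV (u, v)).
Qed.

Lemma mulgl_continuous g : continuous (fun x : G => (g * x)%g).
Proof.
move=> x A /mulg_nbhs[U [V [hU hV UV]]]; apply: filterS hV => v Vv.
by apply: UV => //; exact: nbhs_singleton.
Qed.

Lemma mulgr_continuous g : continuous (fun x : G => (x * g)%g).
Proof.
move=> x A /mulg_nbhs[U [V [hU hV UV]]]; apply: filterS hU => u Uu.
by apply: UV => //; exact: nbhs_singleton.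
Qed.

Definition subgroup H := [/\ H 1%g, forall x y, H x -> H y -> H (x * y)%g &
                             forall x, H x -> H (x^-1)%g].

Lemma nbhs_translate g (A : set G) : nbhs 1%g A -> nbhs g [set x | A (g^-1 * x)%g].
Proof. by rewrite -(mulVg g) => hA; exact: (@mulgl_continuous g^-1%g g). Qed.

Lemma subgroup_open H : subgroup H -> nbhs 1%g H -> open H.
Proof.
move=> [H1 HM HV] nH; rewrite openE => x Hx; apply: filterS (nbhs_translate x nH).
by move=> y /= /(HM _ _ Hx); rewrite mulVKg.
Qed.

Lemma open_subgroup_closed H : subgroup H -> nbhs 1%g H -> closed H.
Proof.
move=> [H1 HM HV] nH; rewrite -[H]setCK; apply: open_closedC.
rewrite openE => x nHx; apply: filterS (nbhs_translate x nH) => y /= Hxy Hy; apply: nHx.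
by have := HM _ _ Hy (HV _ Hxy); rewrite invgM invgK mulVKg.
Qed.

Lemma stabiliser_subgroup (R : fieldType) (V : lmodType R) (pi : smooth_rep G V) v :
  subgroup [set g | pi g v = v].
Proof.
split=> /= [|x y hx hy|x hx]; first exact: rep_one.
  by rewrite rep_mul hy.
by rewrite -{1}hx -rep_mul mulVg rep_one.
Qed.

Lemma subgroup1 H : subgroup H -> H 1%g. Proof. by case. Qed.
Lemma subgroupM H x y : subgroup H -> H x -> H y -> H (x * y)%g.
Proof. by case=> _ h _; exact: h. Qed.
Lemma subgroupV H x : subgroup H -> H x -> H (x^-1)%g.
Proof. by case=> _ _ h; exact: h. Qed.

Lemma subgroupI H K : subgroup H -> subgroup K -> subgroup (H `&` K).
Proof.
move=> [H1 HM HV] [K1 KM KV]; split=> [|x y [Hx Kx] [Hy Ky]|x [Hx Kx]] //.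
  by split; [exact: HM|exact: KM].
by split; [exact: HV|exact: KV].
Qed.

Lemma stabiliser_nbhs (R : fieldType) (V : lmodType R) (pi : smooth_rep G V) v :
  nbhs 1%g [set g | pi g v = v].
Proof. by apply: open_nbhs_nbhs; split; [exact: rep_smooth|exact: rep_one]. Qed.

(** The right stabiliser of A. It is a neighbourhood of 1 by compactness and openness of A, and it
    is a closed subset of the translate a^-1 A. *)
Lemma compact_open_subgroup A a : Defs.compact_open A -> A a ->
  let C := [set g | forall x, A (x * g)%g <-> A x] in
  [/\ subgroup C, nbhs 1%g C & compact C].
Proof.
move=> [cA oA] Aa C.
have sC : subgroup C.
  split=> [x|x y Cx Cy z|x Cx z]; first by rewrite mulg1.
    by rewrite mulgA; apply: (iff_trans (Cy _)).
  by rewrite -(Cx (z * x^-1)%g) mulgVK.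
have nC : nbhs 1%g C.
  have /choice[UV hUV] x : exists UV : set G * set G, A x ->
      [/\ nbhs x UV.1, nbhs 1%g UV.2 & forall u v, UV.1 u -> UV.2 v -> A (u * v)%g].
    have [Ax|nAx] := pselect (A x); last by exists (set0, set0).
    have /mulg_nbhs[U [V [hU hV UV]]] : nbhs (x * 1)%g A.
      by rewrite mulg1; apply: open_nbhs_nbhs.
    by exists (U, V).
  have [s [sA hs]] := @compact_finite_cover _ A (fun x => (UV x).1) cA (fun x Ax => let: And3 h _ _ := hUV x Ax in h).
  have nV : nbhs 1%g [set g | forall x, x \in s -> (UV x).2 g].
    elim: s sA {hs} => [|x s IHs] sA; first by apply: filterS filterT.
    have := IHs (fun y ys => sA y (mem_behead (s := x :: s) ys)).
    have [_ nx _] := hUV x (sA x (mem_head _ _)).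
    move=> ns; apply: filterS (filterI nx ns) => g [gx gs] y.
    by rewrite inE => /predU1P[->|/gs].
  have AV g x : (forall x, x \in s -> (UV x).2 g) -> A x -> A (x * g)%g.
    move=> hg Ax; have [y ys Uyx] := hs x Ax.
    by have [_ _ h] := hUV y (sA y ys); apply: h => //; exact: hg.
  have := @invg_continuous G 1%g _; rewrite invg1 => /(_ _ nV) nV'.
  apply: filterS (filterI nV nV') => g [/= gV gV'] x; split=> [Axg|Ax].
    by rewrite -(mulgK g x); exact: AV.
  exact: AV.
split=> //; apply: (@subclosed_compact _ C ((fun x => (a^-1 * x)%g) @` A)).
- exact: open_subgroup_closed.
- by apply: continuous_compact => //; apply: continuous_subspaceT; exact: mulgl_continuous.
- by move=> g Cg; exists (a * g)%g; [exact/Cg|rewrite mulKg].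
Qed.

Definition coset_reps H (C : set G) n (r : 'I_n -> G) :=
  [/\ forall i, C (r i),
      forall g, C g -> exists i, H ((r i)^-1 * g)%g &
      forall i j, H ((r i)^-1 * r j)%g -> i = j].

Lemma coset_reps_exist H C : subgroup H -> nbhs 1%g H -> compact C ->
  exists n (r : 'I_n -> G), coset_reps H C r.
Proof.
move=> sH nH cC; have [H1 HM HV] := sH.
have [s [sC hs]] := @compact_finite_cover _ C (fun x => [set y | H (x^-1 * y)%g]) cC
  (fun x _ => nbhs_translate x nH).
suff [n [r [rC rs rH]]] : exists n (r : 'I_n -> G), [/\ forall i, C (r i),
    forall x, x \in s -> exists i, H ((r i)^-1 * x)%g &
    forall i j, H ((r i)^-1 * r j)%g -> i = j].
  exists n, r; split=> // g /hs[x /rs[i Hi] Hx]; exists i.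
  by have := HM _ _ Hi Hx; rewrite mulgA mulgK.
elim: s sC {hs} => [|x s IHs] sC; first by exists 0%N, (fun=> 1%g); split=> [[]|//|[]].
have [n [r [rC rs rH]]] := IHs (fun y ys => sC y (mem_behead (s := x :: s) ys)).
have [[i Hi]|nex] := pselect (exists i, H ((r i)^-1 * x)%g).
  by exists n, r; split=> // y; rewrite inE => /predU1P[->|/rs]; first by exists i.
exists n.+1, (fun i => oapp r x (unlift ord0 i)); split=> [i|y|i j].
- by case: (unliftP ord0 i) => [k _|_] /=; [exact: rC|exact/sC/mem_head].
- rewrite inE => /predU1P[->|/rs[i Hi]].
    by exists ord0; rewrite unlift_none /= mulVg.
  by exists (lift ord0 i); rewrite liftK.
case: (unliftP ord0 i) => [k ->|->]; case: (unliftP ord0 j) => [l ->|->] //=.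
- by move=> /rH->.
- by move=> h; case: nex; exists k.
- by move=> /HV; rewrite invgM invgK => h; case: nex; exists l.
Qed.

Lemma coset_reps_inj H C n (r : 'I_n -> G) g i j : subgroup H -> coset_reps H C r ->
  H ((r i)^-1 * g)%g -> H ((r j)^-1 * g)%g -> i = j.
Proof.
move=> [H1 HM HV] [_ _ rH] hi /HV; rewrite invgM invgK => hj; apply: rH.
by have := HM _ _ hi hj; rewrite mulgA mulgK.
Qed.

Section Haar.
Variables (mu : set G -> rat) (mu_haar : left_haar mu).

Lemma compact_open0 : Defs.compact_open (set0 : set G).
Proof. by split; [exact: compact0|exact: open0]. Qed.

Lemma compact_openU A A' : Defs.compact_open A -> Defs.compact_open A' -> Defs.compact_open (A `|` A').
Proof. by move=> [cA oA] [cB oB]; split; [exact: compactU|exact: openU]. Qed.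

Lemma haar0 : mu set0 = 0.
Proof.
have [_ _ muU _] := mu_haar; have := muU _ _ compact_open0 compact_open0.
by rewrite set0I setU0 => /(_ erefl)/eqP; rewrite -subr_eq0 opprD addrA subrr sub0r oppr_eq0 => /eqP.
Qed.

Lemma haar_bigU n (P : pred 'I_n) (S : 'I_n -> set G) : (forall i, Defs.compact_open (S i)) ->
  (forall i j x, S i x -> S j x -> i = j) ->
  mu [set x | exists2 i, P i & S i x] = \sum_(i | P i) mu (S i).
Proof.
move=> coS dS; have [_ _ muU _] := mu_haar.
have key (s : seq 'I_n) : uniq s ->
    Defs.compact_open [set x | exists2 i, i \in s & S i x] /\
    mu [set x | exists2 i, i \in s & S i x] = \sum_(i <- s) mu (S i).
  elim: s => [_|i s IHs /= /andP[nis us]].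
    rewrite big_nil (_ : [set x | _] = set0) ?haar0; last by rewrite -subset0 => x [].
    by split; first exact: compact_open0.
  have [co mus] := IHs us.
  have -> : [set x | exists2 j, j \in i :: s & S j x] = S i `|` [set x | exists2 i, i \in s & S i x].
    rewrite predeqE => x; split=> [[j]|[Si|[j js Sj]]].
    - by rewrite inE => /predU1P[->|js Sj]; [left|right; exists j].
    - by exists i; rewrite ?mem_head.
    - by exists j; rewrite // inE js orbT.
  split; first exact: compact_openU.
  rewrite muU ?big_cons ?mus // -subset0 => x [Six [j js Sjx]].
  by case/negP: nis; rewrite (dS _ _ _ Six Sjx).
have [_] := key _ (filter_uniq P (enum_uniq 'I_n)).
rewrite big_filter big_enum_cond /= => <-; congr (mu _); rewrite predeqE => x.
by split=> -[i Pi Si]; exists i => //; move: Pi; rewrite mem_filter mem_enum andbT.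
Qed.

Lemma haar_translate g A : Defs.compact_open A -> mu [set x | A (g^-1 * x)%g] = mu A.
Proof.
move=> coA; have [_ _ _ muT] := mu_haar; rewrite -(muT g A coA); congr (mu _).
rewrite predeqE => x; split=> [Ax|[y Ay <-]]; last by rewrite /= mulKg.
by exists (g^-1 * x)%g; rewrite ?mulVKg.
Qed.

Lemma compact_open_translate g A : Defs.compact_open A -> Defs.compact_open [set x | A (g^-1 * x)%g].
Proof.
move=> [cA oA]; split; last first.
  exact: (proj1 (continuousP _) (@mulgl_continuous g^-1%g)).
have -> : [set x | A (g^-1 * x)%g] = (fun x => (g * x)%g) @` A.
  rewrite predeqE => x; split=> [Ax|[y Ay <-]]; last by rewrite /= mulKg.
  by exists (g^-1 * x)%g; rewrite ?mulVKg.
by apply: continuous_compact => //; apply: continuous_subspaceT; exact: mulgl_continuous.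
Qed.

Lemma haar_cosets H C n (r : 'I_n -> G) : subgroup H -> Defs.compact_open H ->
  coset_reps H C r -> (forall x h, C x -> H h -> C (x * h)%g) -> mu C = mu H *+ n.
Proof.
move=> sH coH rr CH; have [rC rs rH] := rr.
have -> : C = [set x | exists2 i : 'I_n, xpredT i & [set x | H ((r i)^-1 * x)%g] x].
  rewrite predeqE => x; split=> [/rs[i Hi]|[i _ Hi]]; first by exists i.
  by have := CH _ _ (rC i) Hi; rewrite mulVKg.
rewrite haar_bigU; [|by move=> i; exact: compact_open_translate|].
  by under eq_bigr do rewrite haar_translate //; rewrite sumr_const card_ord.
by move=> i j x /= hi hj; exact: (coset_reps_inj sH rr hi hj).
Qed.

(** Both H and a set A of nonzero measure are finite disjoint unions of cosets of a common open
    subgroup, which thus has nonzero measure. *)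
Lemma haar_open_subgroup_neq0 H : subgroup H -> Defs.compact_open H -> mu H != 0.
Proof.
move=> sH coH; have [[A coA muA] _ _ _] := mu_haar.
have [a Aa] : exists a, A a.
  apply: contrapT => h; case/eqP: muA; rewrite (_ : A = set0) ?haar0 //.
  by rewrite -subset0 => x Ax; apply: h; exists x.
have [sC nC cC] := compact_open_subgroup coA Aa; set C := [set g | _] in sC nC cC.
have nH : nbhs 1%g H by apply: open_nbhs_nbhs; split; [exact: coH.2|exact: subgroup1].
have sK := subgroupI sH sC; have nK : nbhs 1%g (H `&` C) by exact: filterI.
have coK : Defs.compact_open (H `&` C).
  split; last exact: subgroup_open.
  apply: (subclosed_compact _ cC); first exact: open_subgroup_closed.
  by move=> x [].
have [n [r rr]] := coset_reps_exist sK nK coA.1.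
have [m [q qq]] := coset_reps_exist sK nK coH.1.
have muA' : mu A = mu (H `&` C) *+ n.
  by apply: (haar_cosets sK coK rr) => x h Ax [_ /(_ x)[_]]; apply.
have muH : mu H = mu (H `&` C) *+ m.
  by apply: (haar_cosets sK coK qq) => x h Hx [Hh _]; exact: subgroupM.
rewrite muH mulrn_eq0 negb_or; apply/andP; split.
  by have [_ qs _] := qq; have [[i im] _] := qs 1%g (subgroup1 sH); case: m im {q qq muH qs}.
by apply: contraNneq muA => K0; rewrite muA' K0 mul0rn.
Qed.

End Haar.
End TopologicalGroups.

Fact ratrK_zmod_morphism : zmod_morphism (ratr : rat -> calK).
Proof. by move=> x y; apply: K2C_inj; rewrite rmorphB !fmorph_rat rmorphB. Qed.
Fact ratrK_monoid_morphism : monoid_morphism (ratr : rat -> calK).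
Proof.
split=> [|x y]; apply: K2C_inj; first by rewrite (fmorph_rat K2C) !rmorph1.
by rewrite [RHS]rmorphM !(fmorph_rat K2C) rmorphM.
Qed.
Definition ratK : {rmorphism rat -> calK} := HB.pack (ratr : rat -> calK)
  (GRing.isZmodMorphism.Build rat calK (ratr : rat -> calK) ratrK_zmod_morphism)
  (GRing.isMonoidMorphism.Build rat calK (ratr : rat -> calK) ratrK_monoid_morphism).
Arguments ratK : simpl never.

(* The library makes ratr a morphism only into ordered fields, which calK is not. *)
Lemma ratKE q : ratr q = ratK q. Proof. by []. Qed.

Lemma locally_constant_steps (T : topologicalType) (U : choiceType) (u0 : U) (h : T -> U)
    (K : set T) :
  compact K -> locally_constant h -> (forall x, h x != u0 -> K x) ->
  exists n (S : 'I_n -> set T) (u : 'I_n -> U),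
    [/\ forall i, compact (S i) /\ open (S i), forall i j x, S i x -> S j x -> i = j,
        forall i x, S i x -> h x = u i & forall x, h x != u0 -> exists i, S i x].
Proof.
move=> cK lh hK.
have lvl u : open [set x | h x = u].
  by rewrite openE => x /= hx; apply: filterS (lh x) => z /= ->.
have [s [sK hs]] := @compact_finite_cover _ K (fun x => [set z | h z = h x]) cK (fun x _ => lh x).
pose vals := [seq u <- undup (map h s) | u != u0].
have uv : uniq vals by rewrite filter_uniq ?undup_uniq.
have nz (i : 'I_(size vals)) : nth u0 vals i != u0.
  by have := mem_nth u0 (ltn_ord i); rewrite mem_filter => /andP[].
exists (size vals), (fun i => [set x | h x = nth u0 vals i]), (fun i => nth u0 vals i).
split=> //.
- move=> i; split; last exact: lvl.
  apply: (@subclosed_compact _ _ K) => //; last by move=> x /= hx; apply: hK; rewrite hx nz.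
  rewrite -[X in closed X]setCK; apply: open_closedC.
  rewrite openE => x nx; apply: filterS (lh x) => z /= hz e; apply: nx.
  by rewrite /= -hz.
- by move=> i j x /= -> /eqP; rewrite nth_uniq // => /eqP; exact: val_inj.
move=> x hx; have [y ys hxy] := hs x (hK x hx).
have hv : h x \in vals by rewrite mem_filter hx mem_undup hxy map_f.
by exists (Ordinal (etrans (index_mem _ _) hv)); rewrite /= nth_index.
Qed.

(** * Hecke operators and their traces *)

Section HeckeOperators.
Variables (G : topologicalGroupType) (mu : set G -> rat) (mu_haar : left_haar mu).
Variables (V : lmodType calK) (pi : smooth_rep G V).

(** [haar_int] sums over the values of h, whereas several steps may share a value; the measures of
    such steps are added up by [haar_bigU]. *)
Lemma haar_int_steps (h : G -> V) n (S : 'I_n -> set G) (w : 'I_n -> V) :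
  (forall i, Defs.compact_open (S i)) -> (forall i j x, S i x -> S j x -> i = j) ->
  (forall i x, S i x -> h x = w i) -> (forall x, h x != 0 -> exists i, S i x) ->
  haar_int mu h = \sum_i ratr (mu (S i)) *: w i.
Proof.
move=> coS dS hS h0; rewrite /haar_int.
pose r := undup [seq w i | i <- enum 'I_n & w i != 0].
rewrite (fsbigE r) ?undup_uniq //; first last.
- move=> v v0 vr; rewrite (_ : h @^-1` _ = set0) ?(haar0 mu_haar) ?ratKE ?rmorph0 ?scale0r //.
  rewrite -subset0 => x /= hx; have [|i Si] := h0 x; first by rewrite hx; apply/eqP.
  case/negP: vr; rewrite -hx (hS i x Si) mem_undup; apply: map_f.
  by rewrite mem_filter mem_enum andbT -(hS i x Si) hx; apply/eqP.
- move=> v; rewrite /= mem_undup => /mapP[i + ->]; rewrite mem_filter => /andP[wi _].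
  exact/eqP.
transitivity (\sum_(v <- r) \sum_(i | w i == v) ratr (mu (S i)) *: w i).
  rewrite [RHS]big_seq [LHS]big_seq_cond; apply: eq_big => v.
    rewrite andb_idr // => vr; rewrite inE /=.
    by move: vr; rewrite mem_undup => /mapP[i + ->]; rewrite mem_filter => /andP[/eqP].
  case/andP=> vr _; have v0 : v != 0.
    by move: vr; rewrite mem_undup => /mapP[i + ->]; rewrite mem_filter => /andP[].
  have -> : h @^-1` [set v] = [set x | exists2 i, w i == v & S i x].
    rewrite predeqE => x; split=> /= [hx|[i /eqP wi Si]]; last by rewrite (hS i x Si).
    by have [|i Si] := h0 x; [rewrite hx|exists i; rewrite // -(hS i x Si) hx].
  rewrite (haar_bigU mu_haar) // ratKE rmorph_sum scaler_suml.
  by apply: eq_bigr => i /eqP->.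
rewrite (exchange_big_dep predT) //=; apply: eq_bigr => i _; rewrite big_mkcond /=.
have [wir|wir] := boolP (w i \in r).
  rewrite (bigD1_seq (w i)) ?undup_uniq //= eqxx big1 ?addr0 // => v.
  by rewrite eq_sym => /negPf->.
rewrite big_seq big1 => [|v vr]; last first.
  by case: eqP => // wv; case/negP: wir; rewrite wv.
suff /eqP -> : w i == 0 by rewrite scaler0.
apply: contraNT wir => wi; rewrite mem_undup; apply: map_f.
by rewrite mem_filter wi mem_enum.
Qed.

Lemma hecke_integrand_locally_constant (phi : Cc G rat) v :
  locally_constant (fun g => (ratr (phi g) : calK) *: pi g v).
Proof.
move=> g; have /asboolP[lphi _] := CcP phi.
apply: filterS (filterI (lphi g) (nbhs_translate g (stabiliser_nbhs pi v))).
move=> x [/= -> hx]; congr (_ *: _).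
by rewrite -[in LHS](mulVKg g x) rep_mul hx.
Qed.

Lemma hecke_integrand_support (phi : Cc G rat) v g :
  (ratr (phi g) : calK) *: pi g v != 0 -> closure [set x | phi x != 0] g.
Proof.
move=> h; apply: subset_closure => /=; apply: contraNneq h => ->.
by rewrite ratKE rmorph0 scale0r.
Qed.

Lemma Cc_support_compact (T : topologicalType) (R : fieldType) (phi : Cc T R) :
  compact (closure [set x | phi x != 0]).
Proof. by have /asboolP[] := CcP phi. Qed.

Lemma hecke_op_linear (phi : Cc G rat) : linear (hecke_op mu pi phi).
Proof.
move=> a v w; pose h u g := (ratr (phi g) : calK) *: pi g u.
(* Pairing the two integrands gives a decomposition into steps common to both. *)
have lhh : locally_constant (fun g => (h v g, h w g)).
  move=> g; apply: filterS (filterI (hecke_integrand_locally_constant phi v g)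
    (hecke_integrand_locally_constant phi w g)) => x [].
  by rewrite /h => -> ->.
have [|n [S [u [coS dS hS h0]]]] :=
  locally_constant_steps (u0 := (0, 0)) (@Cc_support_compact _ _ phi) lhh.
  move=> x; rewrite xpair_eqE negb_and => /orP[]; exact: hecke_integrand_support.
have hE u' : u' = a *: v + w -> h u' =1 (fun g => a *: h v g + h w g).
  move=> -> g; rewrite /h linearP scalerDr !scalerA.
  by rewrite mulrC.
have nz x : h v x != 0 \/ h w x != 0 -> exists i, S i x.
  by move=> hx; apply: h0; rewrite xpair_eqE negb_and; apply/orP.
rewrite /hecke_op (@haar_int_steps (h v) n S (fun i => (u i).1)) //; first last.
- by move=> x hx; apply: nz; left.
- by move=> i x Si; have := hS i x Si; case: (u i) => ? ? [].
rewrite (@haar_int_steps (h w) n S (fun i => (u i).2)) //; first last.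
- by move=> x hx; apply: nz; right.
- by move=> i x Si; have := hS i x Si; case: (u i) => ? ? [].
rewrite (@haar_int_steps (h (a *: v + w)) n S (fun i => a *: (u i).1 + (u i).2)) //; first last.
- move=> x; rewrite hE // => hx; apply: nz; have [hv|] := eqVneq (h v x) 0; last by left.
  by right; apply: contraNneq hx => hw; rewrite hv hw scaler0 addr0.
- by move=> i x Si; rewrite hE //; have := hS i x Si; case: (u i) => ? ? [-> ->].
rewrite scaler_sumr -big_split; apply: eq_bigr => i _ /=.
by rewrite scalerDr !scalerA mulrC.
Qed.

Lemma hecke_op_commute (phi : Cc G rat) (T : V -> V) :
  (forall v w, T (v + w) = T v + T w) ->
  (forall q v, T ((ratr q : calK) *: v) = ratr q *: T v) ->
  (forall g v, T (pi g v) = pi g (T v)) ->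
  forall v, T (hecke_op mu pi phi v) = hecke_op mu pi phi (T v).
Proof.
move=> TD TZ Tpi v; pose h u g := (ratr (phi g) : calK) *: pi g u.
have T0 : T 0 = 0 by have /eqP := TD 0 0; rewrite addr0 -subr_eq subrr eq_sym => /eqP.
have hT g : h (T v) g = T (h v g) by rewrite /h TZ Tpi.
have [|n [S [u [coS dS hS h0]]]] := locally_constant_steps (u0 := 0)
  (@Cc_support_compact _ _ phi) (hecke_integrand_locally_constant phi v).
  exact: hecke_integrand_support.
rewrite /hecke_op (@haar_int_steps (h v) n S u) //.
rewrite (@haar_int_steps (h (T v)) n S (fun i => T (u i))) //.
- by rewrite (big_morph T TD T0); apply: eq_bigr => i _; rewrite TZ.
- by move=> i x Si; rewrite hT (_ : h v x = u i) //; exact: hS.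
- by move=> x; rewrite hT => hx; apply: h0; apply: contraNneq hx => e; rewrite [h v x]e T0.
Qed.

(** A bijective semilinear T commuting with H carries a family computing the trace to another one,
    and the matrix M to its image under s. *)
Lemma is_trace_semilinear (H T T' : V -> V) (s s' : {rmorphism calK -> calK}) t :
  (forall v w, T (v + w) = T v + T w) -> (forall a v, T (a *: v) = s a *: T v) ->
  cancel T' T -> injective T -> cancel s' s ->
  (forall v, T (H v) = H (T v)) -> is_trace H t -> is_trace H (s t).
Proof.
move=> TD TZ T'K Tinj s'K TH [n [e [M [fe eH eM tM]]]].
have T0 : T 0 = 0 by have /eqP := TD 0 0; rewrite addr0 -subr_eq subrr eq_sym => /eqP.
have Tsum (c : 'I_n -> calK) : T (\sum_i c i *: e i) = \sum_i s (c i) *: T (e i).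
  by rewrite (big_morph T TD T0); apply: eq_bigr => i _; rewrite TZ.
exists n, (fun i => T (e i)), (map_mx s M); split.
- move=> c c0 i; rewrite -(s'K (c i)) (fe (fun i => s' (c i))) ?rmorph0 //.
  by apply: Tinj; rewrite Tsum T0 -[RHS]c0; apply: eq_bigr => j _; rewrite s'K.
- move=> v; have [c hc] := eH (T' v); exists (fun i => s (c i)).
  by rewrite -Tsum -hc TH T'K.
- by move=> j; rewrite -TH eM Tsum; apply: eq_bigr => i _; rewrite mxE.
- by rewrite tM /mxtrace rmorph_sum; apply: eq_bigr => i _; rewrite mxE.
Qed.

End HeckeOperators.

(** * Compactness of the integers of F from the Haar measure *)

Section CoverCompactness.
Variables (F : fieldExtType Q2) (W : vectType F) (B : {skew_symmetric W}).
Hypotheses (W_neq0 : (0 < \dim {:W})%N) (B_symplectic : is_psymplectic B).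
Variables (Y : {vspace W}) (Y_lagrangian : orthov B Y = Y).
Variables (Mp : topologicalGroupType) (p : Mp -> Sp B) (p_cover : double_cover p).
Variables (mu : set Mp -> rat) (mu_haar : left_haar mu).

Lemma cover_mul g h : p (g * h)%g = (p g * p h)%g.
Proof. by have [pM _ _ _ _] := p_cover; exact: pM. Qed.

Lemma cover1 : p 1%g = 1%g.
Proof.
have := cover_mul 1 1; rewrite mulg1 => /(congr1 (fun x => ((p 1)^-1 * x)%g)).
by rewrite mulVg mulKg.
Qed.

Lemma coverV g : p (g^-1)%g = (p g)^-1%g.
Proof. by rewrite -[LHS](mulKg (p g)) -cover_mul mulgV cover1 mulg1. Qed.

Lemma cover_surj h : exists g, p g = h.
Proof. by have [_ _ ps _ _] := p_cover; have [g _ <-] := ps h I; exists g. Qed.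

Lemma cover_continuous : continuous p.
Proof. by have [_ [pc _] _ _ _] := p_cover. Qed.

Lemma cover_nbhs1 (U : set Mp) : nbhs 1%g U -> nbhs (1%g : Sp B) (p @` U).
Proof.
rewrite nbhsE => -[O [oO O1] OU]; have [_ [_ po] _ _ _] := p_cover.
apply: filterS (image_subset p OU) _; apply: open_nbhs_nbhs; split; first exact: po.
by exists 1%g => //; exact: cover1.
Qed.

Lemma haar_compact_subgroup : exists C : set Mp, [/\ subgroup C, nbhs 1%g C & compact C].
Proof.
have [[A coA muA] _ _ _] := mu_haar.
have [a Aa] : exists a, A a.
  apply: contrapT => h; case/eqP: muA; rewrite (_ : A = set0) ?(haar0 mu_haar) //.
  by rewrite -subset0 => x Ax; apply: h; exists x.
exact: ex_intro (compact_open_subgroup coA Aa).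
Qed.

Lemma lagrangian_neq0 : exists2 u, u \in Y & u != 0.
Proof.
apply: contrapT => h; suff Y0 : Y = 0%VS.
  have := Y_lagrangian; rewrite Y0 orthov0 => /(congr1 (fun V => \dim V)).
  by rewrite dimv0 => W0; move: W_neq0; rewrite W0 ltnn.
apply/eqP; rewrite -subv0; apply/subvP => u uY; rewrite memv0.
by apply: contrapT => /negP u0; apply: h; exists u.
Qed.

Lemma dim_subvs_lagrangian : (0 < \dim {:subvs_of Y})%N.
Proof.
have [u uY u0] := lagrangian_neq0; rewrite lt0n dimv_eq0.
apply: contraNneq u0 => h; have : Subvs uY \in {:subvs_of Y}%VS by exact: memvf.
by rewrite h memv0 => /eqP/(congr1 vsval)/= ->.
Qed.

(* The orbit map g |-> proj_Y (p g w1 - w1) carries a compact subset of Mp onto a *)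
(* set containing a lattice: this is how local compactness of F is extracted from *)
(* the existence of a Haar measure. *)
Lemma lattice_in_compact_image : exists (C : set Mp) (c : F) (m : Mp -> adic (subvs_of Y)),
  [/\ compact C, c != 0 /\ OF c, continuous m &
      forall v, lattice v -> exists2 g, C g & m g = c *: v].
Proof.
have [C [sC nC cC]] := haar_compact_subgroup; exists C.
have [u uY u0] := lagrangian_neq0.
have [w wu] := symplectic_neq0 B_symplectic u0; pose w1 := (B w u)^-1 *: w.
have w1u : B w1 u = 1 by rewrite linearZl_LR /= mulVf.
have [c hc hv] := shear_small B_symplectic Y_lagrangian uY w1u (cover_nbhs1 nC).
pose l (f : 'End(W)) : subvs_of Y := vsproj Y (f w1).
have ll : linear l by move=> a f f'; rewrite /l add_lfunE scale_lfunE linearP.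
pose L : {linear 'End(W) -> subvs_of Y} :=
  HB.pack l (GRing.isLinear.Build F _ _ *:%R l ll).
exists c, (fun g => (L (val (p g)) + - L \1%VF : subvs_of Y)); split=> //.
  have cL : continuous (fun g => L (val (p g)) : adic (subvs_of Y)).
    move=> g U hU; apply: (@cover_continuous g ((fun x => L (Sp_val x)) @^-1` U)).
    have ic : continuous (@Sp_val _ _ B : Sp B -> adic 'End(W)).
      exact: (@initial_continuous (Sp B) (adic 'End(W)) (@Sp_val _ _ B)).
    exact: (ic (p g) _ (@linear_adic_continuous _ _ _ L (val (p g)) U hU)).
  move=> g U hU; exact: (cL g _ (@adic_translate _ _ (- L \1%VF) _ U hU)).
move=> v lv; have [_ [g Cg <-] gw1] := hv v lv; exists g => //.
rewrite /L /= /l gw1 id_lfunE -linearN -linearD /= addrC addKr.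
by apply: val_inj; rewrite /= vsprojK // memvZ // subvsP.
Qed.

(** A rescaled coordinate t of the orbit map is continuous and takes every value of [OF] on the
    compact set C, so balls of [OF] are pulled back to C. *)
Lemma cover_OF_compact : OF_compact F.
Proof.
have [C [c [m [cC [c0 oc] cm hm]]]] := lattice_in_compact_image.
pose i0 := Ordinal dim_subvs_lagrangian; pose y0 := (vbasis {:subvs_of Y})`_i0.
pose k : {linear subvs_of Y -> F^o} := coord (vbasis {:subvs_of Y}) i0.
have fb := basis_free (vbasisP {:subvs_of Y}).
have ky0 : k y0 = 1 by have := coord_free i0 i0 fb; rewrite eqxx.
have ly0 z : OF z -> lattice (z *: y0).
  move=> oz j; rewrite linearZ /= (coord_free i0 j fb).
  by apply: OFM => //; exact: OF_nat.
move=> d hd; pose t g := k (m g) / c.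
(* Centres with t g not integral get radius 1: their balls miss [OF] and can be discarded at the
   end. *)
pose e g := if `[< OF (t g) >] then d (t g) else 1.
have he g : e g != 0 /\ OF (e g).
  by rewrite /e; case: asboolP => [/hd//|_]; split; [exact: oner_neq0|exact: OF1].
have near g : nbhs g [set g' | OF ((t g' - t g) / e g)].
  have [e0 oe] := he g.
  have h := @linear_form_nbhs _ _ k (m g) (c * e g) (mulf_neq0 c0 e0) (OFM oc oe).
  have hm' : nbhs g [set g' | OF ((k (m g') - k (m g)) / (c * e g))] := cm g _ h.
  apply: filterS hm' => g' /=; congr OF.
  by rewrite /t; field; rewrite e0 c0.
have [s [sC hs]] := compact_finite_cover cC (fun g _ => near g).
exists [seq t g | g <- s & `[< OF (t g) >]]; split.
  by move=> _ /mapP[g + ->]; rewrite mem_filter => /andP[/asboolP].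
move=> z oz; have [g Cg mg] := hm _ (ly0 z oz); have tg : t g = z.
  by rewrite /t mg !linearZ /= ky0 [z *: _]mulr1 mulrC mulKf.
have [g' g's] := hs g Cg; rewrite /= tg /e; case: asboolP => [otg' oe|ntg'].
  by exists (t g') => //; apply: map_f; rewrite mem_filter g's andbT; apply/asboolP.
by rewrite divr1 => h; case: ntg'; rewrite -[t g'](subKr z); exact: OFB.
Qed.

Lemma lattice_closed (V : vectType F) : closed [set v : adic V | lattice (v : V)].
Proof.
rewrite -[X in closed X]setCK; apply: open_closedC; rewrite openE => v nv.
exists 1; first by split; [exact: oner_neq0|exact: OF1].
move=> w lw; rewrite scale1r => h; apply: nv => /=.
by rewrite -(addrK w v); apply: latticeD => //; exact: latticeN.
Qed.

Lemma subvs_lattice_compact (d : F) : d != 0 ->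
  compact [set y : adic (subvs_of Y) | lattice (d *: y : subvs_of Y)].
Proof.
move=> d0; have [C [c [m [cC [c0 oc] cm hm]]]] := lattice_in_compact_image.
have cmC : compact (m @` C) by apply: continuous_compact => //; exact: continuous_subspaceT.
pose sc (a : F) : adic (subvs_of Y) -> adic (subvs_of Y) := fun y => a *: (y : subvs_of Y).
have lc (a : F) : continuous (sc a).
  exact: (@linear_adic_continuous _ _ _ ( *:%R a : {linear subvs_of Y -> subvs_of Y})).
apply: (@subclosed_compact _ _ (sc (d * c)^-1 @` (m @` C))).
- apply: (proj1 (continuous_closedP _) (lc d)).
  exact: lattice_closed.
- by apply: continuous_compact => //; apply: continuous_subspaceT; exact: lc.
move=> y /= /hm[g Cg mg]; exists (c *: (d *: (y : subvs_of Y))); first by exists g.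
rewrite /sc !scalerA (_ : _ * d = 1) ?scale1r //.
by field; rewrite d0 c0.
Qed.

End CoverCompactness.

(** * The Weil representation *)

Lemma locally_constant_comp (T : topologicalType) (U U' : Type) (g : U -> U') (h : T -> U) :
  locally_constant h -> locally_constant (g \o h).
Proof. by move=> lh x; apply: filterS (lh x) => z /= ->. Qed.

Section CcFunctions.
Variables (T : topologicalType) (R : fieldType).
Implicit Types f g : Cc T R.

Lemma Cc_eq f g : (forall y, f y = g y) -> f = g.
Proof. by move=> fg; apply: val_inj; apply/funext. Qed.

Lemma CcD f g y : (f + g) y = f y + g y. Proof. by []. Qed.
Lemma CcN f y : (- f) y = - f y. Proof. by []. Qed.
Lemma CcZ a f y : (a *: f) y = a * f y. Proof. by []. Qed.
Lemma Cc0 y : (0 : Cc T R) y = 0. Proof. by []. Qed.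

Lemma Cc_locally_constant f : locally_constant f.
Proof. by have /asboolP[] := CcP f. Qed.

Lemma Cc_mul_exists (c : T -> R) f : locally_constant c ->
  exists g : Cc T R, forall y, g y = c y * f y.
Proof.
move=> lc; suff P : (fun y => c y * f y : R^o) \in @smooth_compact T R.
  by exists (MkCc P).
apply/asboolP; split=> [y|].
  by apply: filterS (filterI (lc y) (Cc_locally_constant f y)) => z [-> ->].
apply: (subclosed_compact (@closed_closure _ _) (@Cc_support_compact _ _ f)).
by apply: closureS => y /=; apply: contra_neq => ->; rewrite mulr0.
Qed.

End CcFunctions.

Section Heisenberg.
Variables (F : fieldExtType Q2) (W : vectType F) (B : {skew_symmetric W}).
Hypothesis B_symplectic : is_psymplectic B.
Variables (X Y : {vspace W}).
Hypothesis X_lagrangian : orthov B X = X.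
Hypothesis XY_cap : (X :&: Y)%VS = 0%VS.
Variable psi : smooth_character F calK.

Local Notation SY := (Cc (adic (subvs_of Y)) calK).

Lemma heisE (w : W) t (f : SY) (y : subvs_of Y) :
  heis B X psi (w, t) f y = psi t * psi (B (vsval y) (daddv_pi X Y w) +
    2^-1 * B (vsval (vsproj Y (daddv_pi Y X w))) (daddv_pi X Y w)) *
    f (y + vsproj Y (daddv_pi Y X w)).
Proof. by []. Qed.

Lemma daddv_pi_other (U V : {vspace W}) w : (U :&: V = 0)%VS -> w \in U ->
  daddv_pi V U w = 0.
Proof.
move=> UV wU; have := daddv_pi_add UV (subvP (addvSl U V) w wU).
by rewrite (daddv_pi_id UV wU) => /(congr1 (fun z => z - w)); rewrite addrAC subrr add0r.
Qed.

Lemma heisX x (f : SY) (y : subvs_of Y) : x \in X ->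
  heis B X psi (x, 0) f y = psi (B (vsval y) x) * f y.
Proof.
move=> xX; rewrite heisE (daddv_pi_id XY_cap xX) (daddv_pi_other XY_cap xX).
by rewrite linear0 addr0 linear0l mulr0 addr0 char0 mul1r.
Qed.

Lemma heisY (v : subvs_of Y) (f : SY) (y : subvs_of Y) :
  heis B X psi (vsval v, 0) f y = f (y + v).
Proof.
have vY := subvsP v; have YX : (Y :&: X = 0)%VS by rewrite capvC.
rewrite heisE (daddv_pi_id YX vY) (daddv_pi_other YX vY) vsvalK.
by rewrite !linear0r mulr0 addr0 char0 !mul1r.
Qed.

Lemma char_form_locally_constant (x : W) (y0 : subvs_of Y) :
  locally_constant (fun y : adic (subvs_of Y) => psi (B (vsval y - vsval y0) x)).
Proof.
move=> y; have [k [k0 ok] hk] := char_ball psi.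
pose l (v : subvs_of Y) : F^o := B (vsval v) x.
have ll : linear l by move=> a u v; rewrite /l linearP linearDl linearZl_LR.
pose L : {linear subvs_of Y -> F^o} :=
  HB.pack l (GRing.isLinear.Build F (subvs_of Y) F^o *:%R l ll).
apply: filterS (@linear_form_nbhs _ _ L y k k0 ok) => z /= oz.
have -> : B (vsval z - vsval y0) x = B (vsval y - vsval y0) x + k * ((L z - L y) / k).
  by rewrite mulrCA mulfV // mulr1 !linearBl /= /l; ring.
by rewrite charD hk // mulr1.
Qed.

Hypothesis psi_nontrivial : exists x, psi x != 1.

Lemma char_form_separates (v : subvs_of Y) : v != 0 ->
  exists2 x, x \in X & psi (B (vsval v) x) != 1.
Proof.
move=> v0; have [a pa] := psi_nontrivial.
have [x xX vx] : exists2 x, x \in X & B (vsval v) x != 0.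
  apply: contrapT => h; case/eqP: v0; apply: val_inj => /=; apply/eqP.
  rewrite -memv0 -XY_cap memv_cap subvsP andbT; apply: (lagrangian_maximal X_lagrangian).
  by move=> x xX; apply/eqP/negPn/negP => vx; apply: h; exists x.
exists (a / B (vsval v) x *: x); first by rewrite memvZ.
by rewrite linearZr_LR /= divfK.
Qed.

(** Each y != y0 is separated from y0 by a character psi(B _ x) with x in X, and so are its
    neighbours. Near y0 itself f vanishes, so compactness of the support leaves finitely many x. *)
Lemma Cc_vanish_cover (f : SY) (y0 : subvs_of Y) : f y0 = 0 ->
  exists s : seq W, (forall x, x \in s -> x \in X) /\
    forall y : subvs_of Y, f y != 0 -> exists2 x, x \in s & psi (B (vsval y - vsval y0) x) != 1.
Proof.
move=> f0; have /choice[x hx] (y : subvs_of Y) :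
    exists x, y != y0 -> x \in X /\ psi (B (vsval y - vsval y0) x) != 1.
  have [->|yy] := eqVneq y y0; first by exists 0.
  have [|x xX px] := @char_form_separates (y - y0); first by rewrite subr_eq0.
  by exists x => _; split; rewrite // -linearB.
pose U (y : adic (subvs_of Y)) : set (adic (subvs_of Y)) :=
  [set z | f z = f y /\ psi (B (vsval z - vsval y0) (x y)) = psi (B (vsval y - vsval y0) (x y))].
have nU y : nbhs y (U y).
  exact: filterI (Cc_locally_constant f y) (char_form_locally_constant (x y) y0 y).
have [s [_ hs]] := compact_finite_cover (@Cc_support_compact _ _ f) (fun y _ => nU y).
exists [seq x y | y <- s & y != y0]; split.
  by move=> _ /mapP[y + ->]; rewrite mem_filter => /andP[/hx[]].
move=> y fy; have [|y1 y1s [fE pE]] := hs y; first exact: subset_closure.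
have y10 : y1 != y0 by apply: contraNneq fy => e; rewrite fE e f0.
exists (x y1); first by apply: map_f; rewrite mem_filter y10.
by rewrite pE; have [] := hx y1 y10.
Qed.

(* An operator commuting with the multiplications by the characters psi (B _ x) is *)
(* local, since (psi (B (y - y0) x) - 1) g vanishes at y0. *)
Lemma heis_local (M : {linear SY -> SY}) :
  (forall x f, x \in X -> M (heis B X psi (x, 0) f) = heis B X psi (x, 0) (M f)) ->
  forall (f : SY) (y0 : subvs_of Y), f y0 = 0 -> M f y0 = 0.
Proof.
move=> hM f y0 /Cc_vanish_cover[s [sX hs]].
elim: s f sX hs => [|x s IHs] f sX hs.
  rewrite (_ : f = 0) ?linear0 //; apply: Cc_eq => y; rewrite Cc0.
  by apply/eqP/negPn/negP => /hs[].
have lc := char_form_locally_constant x y0.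
(* [f2] is f restricted to the locus where the character of x is 1, left to the induction. Off that
   locus f is divided by the character minus 1, which gives [g]. *)
have [f2 f2E] := Cc_mul_exists f (locally_constant_comp (fun a => (a == 1)%:R) lc).
have [g gE] := Cc_mul_exists f
  (locally_constant_comp (fun a => if a == 1 then 0 else (a - 1)^-1) lc).
have xX : x \in X by apply: sX; exact: mem_head.
have fE : f = f2 + (psi (- B (vsval y0) x) *: heis B X psi (x, 0) g - g).
  apply: Cc_eq => y; rewrite CcD f2E CcD CcN CcZ heisX // gE /= [psi (- _) * _]mulrA -charD.
  have -> : - B (vsval y0) x + B (vsval y) x = B (vsval y - vsval y0) x.
    by rewrite linearBl addrC.
  case: eqP => [->|/eqP h]; first by rewrite !mul1r !mul0r subrr addr0.
  have h' : psi (B (vsval y - vsval y0) x) - 1 != 0 by rewrite subr_eq0.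
  by rewrite mul0r add0r -[X in _ = _ - X]mul1r -mulrBl mulVKf.
rewrite fE linearD CcD IHs; first last.
- move=> y; rewrite f2E /= mulf_eq0 negb_or => /andP[+ fy].
  have [px _|_] := eqVneq (psi (B (vsval y - vsval y0) x)) 1; last by rewrite eqxx.
  have [x'] := hs y fy; rewrite inE => /predU1P[->|x's px']; first by rewrite px eqxx.
  by exists x'.
- by move=> x' x's; apply: sX; rewrite inE x's orbT.
rewrite add0r (linearB M) CcD CcN (linearZ_LR M) CcZ hM // heisX // mulrA -charD.
by rewrite addNr char0 mul1r subrr.
Qed.

(** Locality makes M f(y) a multiple of f(y) at each y, and translations by Y show that the factor
    does not depend on y. *)
Lemma heis_schur (M : {linear SY -> SY}) :
  (forall w f, M (heis B X psi (w, 0) f) = heis B X psi (w, 0) (M f)) ->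
  exists a, forall f, M f = a *: f.
Proof.
move=> hM; have loc := heis_local (fun x f _ => hM x f).
have [[f0 [y0 f0y]]|h0] := pselect (exists f0 : SY, exists y0 : subvs_of Y, f0 y0 != 0); last first.
  exists 0 => f; rewrite scale0r (_ : f = 0) ?linear0 //; apply: Cc_eq => y.
  by apply/eqP/negPn/negP => fy; apply: h0; exists f, y.
exists (M f0 y0 / f0 y0) => f; apply: Cc_eq => y; rewrite CcZ.
pose f' := heis B X psi (vsval (y - y0), 0) f.
have f'y : f' y0 = f y by rewrite /f' heisY addrC subrK.
have Mf'y : M f' y0 = M f y by rewrite /f' hM heisY addrC subrK.
have MZ : M ((f' y0 / f0 y0) *: f0) = (f' y0 / f0 y0) *: M f0 by exact: linearZ.
have := loc (f' - (f' y0 / f0 y0) *: f0) y0.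
rewrite (linearB M) MZ !CcD !CcN !CcZ divfK // subrr => /(_ erefl)/eqP.
by rewrite subr_eq0 Mf'y f'y => /eqP->; rewrite mulrAC [RHS]mulrAC [f y * _]mulrC.
Qed.

End Heisenberg.

(** * Semilinear twists commuting with the Weil representation *)

Section Twist.
Variables (F : fieldExtType Q2) (V : vectType F).
Local Notation SV := (Cc (adic V) calK).

Lemma scale_adic_continuous (u : F) :
  continuous ((fun y : V => u *: y) : adic V -> adic V).
Proof. exact: (@linear_adic_continuous _ _ _ ( *:%R u : {linear V -> V})). Qed.

Fact twist_subproof (u : F) (a : Z2) (f : SV) : u != 0 ->
  (fun y : adic V => sigma a (f (u^-1 *: (y : V))) : calK^o) \in @smooth_compact (adic V) calK.
Proof.
move=> u0; apply/asboolP; split=> [y|].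
  have h : nbhs y [set z : adic V | f (u^-1 *: (z : V)) = f (u^-1 *: (y : V))].
    exact: (@scale_adic_continuous u^-1 y _ (Cc_locally_constant f (u^-1 *: (y : V) : V))).
  by apply: filterS h => z /= ->.
have cK : compact ((fun y : adic V => u *: (y : V) : adic V) @` closure [set y | f y != 0]).
  apply: continuous_compact; last exact: (@Cc_support_compact _ _ f).
  by apply: continuous_subspaceT; exact: scale_adic_continuous.
apply: (subclosed_compact (@closed_closure _ _) cK).
have KE : (fun y : adic V => u *: (y : V) : adic V) @` closure [set y | f y != 0] =
    (fun y : adic V => u^-1 *: (y : V) : adic V) @^-1` closure [set y | f y != 0].
  rewrite predeqE => y; split=> [[z hz <-]|hy]; first by rewrite /= scalerA mulVf // scale1r.
  by exists (u^-1 *: (y : V)); rewrite // scalerA mulfV // scale1r.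
rewrite KE [X in _ `<=` X](proj1 (closure_id _) _); last first.
  by apply: (proj1 (continuous_closedP _) (@scale_adic_continuous u^-1)); exact: closed_closure.
apply: closureS => y /= fy; apply: subset_closure => /=.
by move: fy; apply: contraNN => /eqP->; rewrite rmorph0.
Qed.

Definition twist (u : F) (a : Z2) (u0 : u != 0) (f : SV) : SV :=
  MkCc (twist_subproof a f u0).

Lemma twistE u a (u0 : u != 0) f (y : V) : twist a u0 f y = sigma a (f (u^-1 *: y)).
Proof. by []. Qed.

Lemma twistD u a (u0 : u != 0) f g : twist a u0 (f + g) = twist a u0 f + twist a u0 g.
Proof. by apply: Cc_eq => y; rewrite CcD !twistE CcD rmorphD. Qed.

Lemma twistZ u a (u0 : u != 0) c f : twist a u0 (c *: f) = sigma a c *: twist a u0 f.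
Proof. by apply: Cc_eq => y; rewrite CcZ !twistE CcZ rmorphM. Qed.

Lemma sigmaK a : a \is a GRing.unit -> cancel (sigma a) (sigma a^-1).
Proof. by move=> au x; rewrite -sigmaM ?unitrV // mulVr // sigma1. Qed.

Lemma sigmaVK a : a \is a GRing.unit -> cancel (sigma a^-1) (sigma a).
Proof. by move=> au x; rewrite -sigmaM ?unitrV // mulrV // sigma1. Qed.

Lemma twistK u a (u0 : u != 0) (uV0 : u^-1 != 0) : a \is a GRing.unit ->
  cancel (twist a u0) (twist a^-1 uV0).
Proof.
move=> au f; apply: Cc_eq => y; rewrite !twistE sigmaK // invrK.
by rewrite scalerA mulVf // scale1r.
Qed.

Lemma twistVK u a (u0 : u != 0) (uV0 : u^-1 != 0) : a \is a GRing.unit ->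
  cancel (twist a^-1 uV0) (twist a u0).
Proof.
move=> au f; apply: Cc_eq => y; rewrite !twistE sigmaVK // invrK.
by rewrite scalerA mulfV // scale1r.
Qed.

End Twist.

Section TwistWeil.
Variables (F : fieldExtType Q2) (W : vectType F) (B : {skew_symmetric W}).
Hypothesis B_symplectic : is_psymplectic B.
Variables (X Y : {vspace W}).
Hypothesis X_lagrangian : orthov B X = X.
Hypothesis XY_cap : (X :&: Y)%VS = 0%VS.
Variable psi : smooth_character F calK.
Hypothesis psi_nontrivial : exists x, psi x != 1.
Hypothesis compactOF : OF_compact F.
Variables (Mp : topologicalGroupType) (p : Mp -> Sp B) (p_cover : double_cover p).
Local Notation SY := (Cc (adic (subvs_of Y)) calK).
Variable omega : smooth_rep Mp SY.
Hypothesis omega_weil : is_weil_rep X psi p omega.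

Lemma weil_kernel z f : p z = 1%g -> omega z f = f \/ omega z f = - f.
Proof.
move=> pz; have [h _ _] := omega_weil; have [->|z1] := eqVneq z 1%g.
  by left; exact: rep_one.
by right; exact: h.
Qed.

Lemma weil_heis g h f : omega g (heis B X psi h f) = heis B X psi (p g h.1, h.2) (omega g f).
Proof.
by have [_ hh _] := omega_weil; rewrite -hh -rep_mul mulVg rep_one.
Qed.

Lemma shear_form_scale (n : Sp B) c (v : subvs_of Y) :
  B (n (vsval (c *: v)) - vsval (c *: v)) (vsval (c *: v)) =
  c ^+ 2 * B (n (vsval v) - vsval v) (vsval v).
Proof.
by rewrite linearZ /= linearZ /= -scalerBr !(linearZl_LR, linearZr_LR) /= mulrA.
Qed.

Section OneTwist.
Variables (u : F) (u0 : u != 0) (a : Z2) (au : a \is a GRing.unit).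
Hypothesis u2 : u ^+ 2 = Z2emb F a.
Local Notation T := (twist a u0 : SY -> SY).
Let uV0 : u^-1 != 0. Proof. by rewrite invr_eq0. Qed.
Local Notation T' := (twist a^-1 uV0 : SY -> SY).

Lemma char_sigma_sq x : sigma a (psi x) = psi (u ^+ 2 * x).
Proof. by rewrite -char_sigma // u2. Qed.

Lemma twist_heis w t f : T (heis B X psi (w, t) f) = heis B X psi (u *: w, u ^+ 2 * t) (T f).
Proof.
apply: Cc_eq => y; rewrite twistE !heisE twistE !rmorphM /= !char_sigma_sq.
congr (_ * psi _ * sigma a (f _)).
  rewrite linearZ /= !linearZ /= !(linearZr_LR, linearZl_LR) /=.
  by field; rewrite u0 F2_neq0.
by rewrite linearZ /= linearZ /= scalerDr scalerA mulVf // scale1r.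
Qed.

(** In omega(g)^-1 T omega(g) T^-1 the semilinearities cancel, as do the scalings of the Heisenberg
    group by u and u^-1, so Schur's lemma applies. *)
Lemma twist_weil_scalar g : exists c, forall f, T (omega g f) = c *: omega g (T f).
Proof.
pose m f := omega g^-1%g (T (omega g (T' f))).
have lm : linear m.
  move=> c f f'; rewrite /m twistD twistZ linearP twistD twistZ sigmaVK //.
  by rewrite linearP.
pose M : {linear SY -> SY} := HB.pack m (GRing.isLinear.Build calK SY SY *:%R m lm).
have T'heis w f : T' (heis B X psi (w, 0) f) = heis B X psi (u^-1 *: w, 0) (T' f).
  have := twist_heis (u^-1 *: w) 0 (T' f).
  rewrite scalerA mulfV // scale1r mulr0 twistVK // => <-.
  by rewrite twistK.
have [|c hc] := @heis_schur _ _ _ X Y X_lagrangian XY_cap psi psi_nontrivial M.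
  move=> w f; rewrite /M /= /m T'heis weil_heis twist_heis /= linearZ /=.
  by rewrite scalerA mulfV // scale1r mulr0 weil_heis /= -Sp_mulE coverV // mulVg Sp_1E.
exists c => f; have := hc (T f); rewrite /M /= /m twistK // => h.
by rewrite -linearZ /= -h -rep_mul mulgV rep_one.
Qed.

Definition twist_commutes := [set g : Mp | forall f, T (omega g f) = omega g (T f)].

Lemma twist_commutesM g h : twist_commutes g -> twist_commutes h -> twist_commutes (g * h)%g.
Proof. by move=> hg hh f; rewrite !rep_mul hg hh. Qed.

(** The scalar attached to g is used once in each direction and cancels, so it need not be
    computed. *)
Lemma twist_commutes_conj g h : twist_commutes h -> twist_commutes (g * h * g^-1)%g.
Proof.
move=> hh f; have [c hc] := twist_weil_scalar g.
have hV : c *: omega g (T (omega g^-1%g f)) = T f by rewrite -hc -rep_mul mulgV rep_one.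
have e : omega g^-1%g (T f) = c *: T (omega g^-1%g f).
  by rewrite -hV linearZ /= -rep_mul mulVg rep_one.
by rewrite !rep_mul hc hh e !linearZ.
Qed.

Lemma twist_commutes_kernel z : p z = 1%g -> twist_commutes z.
Proof.
move=> pz f; have h2 f' : omega z f' = f' \/ omega z f' = - f' by exact: weil_kernel.
have [h _ _] := omega_weil; have [->|z1] := eqVneq z 1%g; first by rewrite !rep_one.
by rewrite !h // -!scaleN1r twistZ rmorphN rmorph1.
Qed.

Lemma twist_commutes_lift g h : p g = p h -> twist_commutes h -> twist_commutes g.
Proof.
move=> gh hh; rewrite -[g](mulVKg h); apply: twist_commutesM => //.
by apply: twist_commutes_kernel; rewrite cover_mul // coverV // gh mulVg.
Qed.

(** Transvections generate Sp(W) and are conjugate into N(X), where omega multiplies by psi of a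
    quadratic form in y: sigma_a outside multiplies the form by u^2, and the scaling of y by u^-1
    undoes it. Two lifts of the same element differ by the kernel of p, which acts by signs. *)
Lemma twist_weil g f : T (omega g f) = omega g (T f).
Proof.
suff : forall h g, p g = h -> twist_commutes g by move=> /(_ (p g) g erefl); apply.
move=> {f g}; apply: (@Sp_transvection_ind _ _ _ B_symplectic
  (fun h => forall g, p g = h -> twist_commutes g)) => [h1 h2 hh1 hh2 g pg|b w g pg].
  have [g1 pg1] := cover_surj p_cover h1.
  rewrite -[g](mulVKg g1); apply: twist_commutesM; first exact: hh1.
  by apply: hh2; rewrite cover_mul // coverV // pg pg1 mulKg.
have [k kX] := Sp_move_lagrangian B_symplectic w X_lagrangian; have [k' pk] := cover_surj p_cover k.
have [_ _ [s [ps _] hs]] := omega_weil.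
pose n := transvection B_symplectic b (k w).
have nX : unipotent_radical X n by exact: transvection_unipotent.
apply: (@twist_commutes_lift _ (k'^-1 * s n * k'^-1^-1)%g).
  rewrite !(cover_mul p_cover) !(coverV p_cover) pk pg ps //.
  by rewrite /n transvection_conj -Sp_mulE mulVg Sp_1E.
apply: twist_commutes_conj => f; apply: Cc_eq => y.
rewrite twistE !hs // rmorphM char_sigma_sq; congr (psi _ * _).
by rewrite shear_form_scale; field; rewrite u0 F2_neq0.
Qed.

End OneTwist.
End TwistWeil.

(** * Vectors fixed by an open subgroup *)

Section FixedVectors.
Variables (F : fieldExtType Q2) (W : vectType F) (B : {skew_symmetric W}).
Hypothesis B_symplectic : is_psymplectic B.
Variables (X Y : {vspace W}).
Hypothesis X_lagrangian : orthov B X = X.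
Hypothesis XY_cap : (X :&: Y)%VS = 0%VS.
Variable psi : smooth_character F calK.
Hypothesis psi_nontrivial : exists x, psi x != 1.
Hypothesis compactOF : OF_compact F.
Variables (Mp : topologicalGroupType) (p : Mp -> Sp B) (p_cover : double_cover p).
Local Notation SY := (Cc (adic (subvs_of Y)) calK).
Variable omega : smooth_rep Mp SY.

Lemma transvection_small (w : W) (U : set (Sp B)) : nbhs (1%g : Sp B) U ->
  exists2 c : F, c != 0 /\ OF c & forall a, OF a -> U (transvection B_symplectic (c * a) w).
Proof.
move=> /Sp_nbhs1[c [c0 oc] hU].
pose phi (a : F^o) : 'End(W) := (linfun (transvection_lin B a w) - \1)%VF.
have phiE a v : phi a v = (a * B v w) *: w.
  by rewrite /phi add_lfunE opp_lfunE id_lfunE lfunE /= /transvection_fun addrC addKr.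
have lphi : linear phi.
  move=> b x y; apply/lfunP => v; rewrite [RHS]add_lfunE scale_lfunE !phiE.
  by rewrite scalerA -scalerDl mulrDl mulrA.
pose Phi : {linear F^o -> 'End(W)} :=
  HB.pack phi (GRing.isLinear.Build F F^o _ *:%R phi lphi).
have [d [d0 od] hd] := linear_lattice_denom Phi.
have [e e0 he] : exists2 e : F, e != 0 /\ OF e & forall z, OF z -> @lattice F F^o (e * z).
  have [|e he h] := (adic_nbhsF (0 : F) [set z : adic F^o | @lattice F F^o z]).1.
    exists 1; first by split; [exact: oner_neq0|exact: OF1].
    by move=> v; rewrite scale1r add0r.
  by exists e => // z /h; rewrite add0r.
exists (c * d * e); first by split; [rewrite !mulf_neq0 ?e0.1|do !apply: OFM => //; exact: e0.2].
move=> a oa; apply: (hU _ (d *: Phi (e * a))); first by apply: hd; exact: he.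
have -> : c *: (d *: Phi (e * a)) = phi (c * d * e * a).
  by rewrite scalerA -linearZ /=; congr (phi _); rewrite -[LHS]/(c * d * (e * a)) !mulrA.
by rewrite /phi addrC subrK.
Qed.

Lemma cover_kernel_sq z : p z = 1%g -> (z * z)%g = 1%g /\ forall g, (z * g)%g = (g * z)%g.
Proof.
move=> pz; have [_ _ _ [z0 z01 kerE] _] := p_cover.
have [->|zz0] := (kerE z).1 pz; first by split=> [|g]; rewrite ?mulg1 ?mul1g.
have zn1 : z <> 1%g by rewrite zz0; apply/eqP.
split=> [|g].
  have : p (z * z)%g = 1%g by rewrite (cover_mul p_cover) pz mulg1.
  by move=> /kerE[//|e]; case: zn1; rewrite -[z](mulKg z) e zz0 mulVg.
have : p (g * z * g^-1)%g = 1%g.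
  by rewrite !(cover_mul p_cover) pz mulg1 (coverV p_cover) mulgV.
move=> /kerE[h|h]; last by rewrite -{1}zz0 in h; rewrite -[in LHS](_ : (g * z * g^-1)%g = z) ?mulgVK // h.
by case: zn1; rewrite -[z](mulKg g) -[(g * z)%g](mulgVK g) h mul1g mulVg.
Qed.

Hypothesis omega_weil : is_weil_rep X psi p omega.

(* A lift of a small transvection is the square of a lift of its half, and the    *)
(* ambiguity of sign of the latter disappears in the square. *)
Lemma unipotent_lift_small (s : Sp B -> Mp) (x : W) (K : set Mp) :
  unipotent_lift X p s -> x \in X -> nbhs 1%g K ->
  exists2 c : F, c != 0 /\ OF c & forall a, OF a -> K (s (transvection B_symplectic (c * a) x)).
Proof.
move=> [ps sM] xX nK; have : nbhs (1 * 1)%g K by rewrite mulg1.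
move=> /mulg_nbhs[U [V [nU nV UV]]].
have [c [c0 oc] hc] := transvection_small x (cover_nbhs1 p_cover (filterI nU nV)).
exists (2 * c); first by split; [rewrite mulf_neq0 ?F2_neq0|apply: OFM => //; exact: OF_nat].
move=> a oa; have [g [Ug Vg] pg] := hc a oa.
set h := transvection B_symplectic (c * a) x in pg.
have hX : unipotent_radical X h by exact: transvection_unipotent.
have -> : transvection B_symplectic (2 * c * a) x = (h * h)%g.
  by rewrite /h transvectionD; congr (transvection _ _ _); ring.
rewrite sM //; pose z := (g^-1 * s h)%g.
have pz : p z = 1%g by rewrite (cover_mul p_cover) (coverV p_cover) pg ps // mulVg.
have [zz zC] := cover_kernel_sq pz.
have -> : s h = (g * z)%g by rewrite mulVKg.
rewrite -mulgA (mulgA z g) zC -(mulgA g z z) zz mulg1.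
exact: UV.
Qed.

Lemma weil_unipotent : exists2 s, unipotent_lift X p s &
  forall t x f (y : subvs_of Y), x \in X ->
    omega (s (transvection B_symplectic t x)) f y = psi (- (2^-1 * t * B (vsval y) x ^+ 2)) * f y.
Proof.
have [_ _ [s sL hs]] := omega_weil; exists s => // t x f y xX.
rewrite hs; last exact: transvection_unipotent.
congr (psi _ * _); rewrite transvectionE addrC addKr linearZl_LR /= (skewC B x).
by ring.
Qed.

Definition fixed_by (K : set Mp) (f : SY) := forall g, K g -> omega g f = f.

(** Lifts of small transvections along x lie in K and multiply f by psi of a multiple of B(y, x)^2.
    This factor must be 1 where f is nonzero, so [char_annihilator_bounded] bounds B(y, x)^2. *)
Lemma fixed_support_bounded (K : set Mp) (x : W) : nbhs 1%g K -> x \in X ->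
  exists2 r : F, r != 0 & forall f, fixed_by K f ->
    forall y : subvs_of Y, f y != 0 -> OF (r * B (vsval y) x).
Proof.
move=> nK xX; have [s sL hs] := weil_unipotent.
have [c [c0 oc] hc] := unipotent_lift_small sL xX nK.
have [r0 r00 hr] := char_annihilator_bounded compactOF psi_nontrivial.
pose e := - (r0 * 2^-1 * c); have e0 : e != 0.
  by rewrite /e oppr_eq0 !mulf_neq0 ?invr_eq0 ?F2_neq0.
have [n on] := OF_2X_mul compactOF e^-1; exists (2 ^+ n); first exact: F2X_neq0.
move=> f ff y fy; set b := B (vsval y) x.
have ob : OF (e * b ^+ 2).
  have -> : e * b ^+ 2 = r0 * - (2^-1 * c * b ^+ 2) by rewrite /e; ring.
  apply: hr => a oa; have := congr1 (fun g : SY => g y) (ff _ (hc a oa)).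
  rewrite hs // -/b -[X in _ = X]mul1r => /(mulIf fy) <-.
  by congr (psi _); ring.
apply: OF_sqrt; have -> : (2 ^+ n * b) ^+ 2 = 2 ^+ n * ((2 ^+ n * e^-1) * (e * b ^+ 2)).
  by field.
by apply: OFM; [apply: OFX; exact: OF_nat|exact: OFM].
Qed.

(** Moving v into X by some g in Sp(W) turns translation along v into multiplication by a character
    of Y, which is trivial on the bounded support of the transformed vector when the translation is
    small. *)
Lemma fixed_smooth (K : set Mp) (v : subvs_of Y) : nbhs 1%g K ->
  exists2 e : F, e != 0 & forall f, fixed_by K f ->
    forall b (z : subvs_of Y), OF b -> f (z + (e * b) *: v) = f z.
Proof.
move=> nK; have [k kX] := Sp_move_lagrangian B_symplectic (vsval v) X_lagrangian.
have [g pg] := cover_surj p_cover k.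
have nK' : nbhs 1%g [set h | K (g^-1 * h * g)%g].
  have : nbhs (g^-1 * 1 * g)%g K by rewrite mulg1 mulVg.
  move=> /(@mulgr_continuous Mp g _ _) h1; exact: (@mulgl_continuous Mp g^-1%g 1%g _ h1).
have [r r0 hr] := fixed_support_bounded nK' kX.
have [c [c0 oc] hc] := char_ball psi.
exists (c * r); first by rewrite mulf_neq0.
move=> f ff b z ob; pose f' := omega g f.
have ff' : fixed_by [set h | K (g^-1 * h * g)%g] f'.
  move=> h /= /ff; rewrite !rep_mul => e.
  by rewrite /f' -{2}e -[RHS]rep_mul mulgV rep_one.
have hf' : heis B X psi ((c * r * b) *: k (vsval v), 0) f' = f'.
  apply: Cc_eq => y; rewrite heisX ?memvZ //.
  have [->|f'y] := eqVneq (f' y) 0; first by rewrite mulr0.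
  rewrite linearZr_LR /=.
  have -> : c * r * b * B (vsval y) (k (vsval v)) = c * (b * (r * B (vsval y) (k (vsval v)))) by ring.
  by rewrite hc ?mul1r //; apply: OFM => //; exact: hr ff' _ f'y.
have hf : heis B X psi (vsval ((c * r * b) *: v), 0) f = f.
  rewrite -[RHS](rep_one omega) -[LHS](rep_one omega) -(mulVg g) !rep_mul -/f' -[in RHS]hf'.
  by rewrite (weil_heis omega_weil) /= pg -/f' !linearZ.
by have := heisY B XY_cap psi ((c * r * b) *: v) f z; rewrite hf => <-.
Qed.

(** Extended by zero on X, the form l is B _ w for some w by nondegeneracy. This w is orthogonal to
    X, hence in X. *)
Lemma dual_vector (l : {linear subvs_of Y -> F^o}) :
  exists2 x, x \in X & forall y : subvs_of Y, l y = B (vsval y) x.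
Proof.
pose A w : 'Hom(W, F^o) := linfun (applyr B w : W -> F^o).
have AE w v : A w v = B v w by rewrite /A lfunE.
have lA : linear A.
  by move=> a u v; apply/lfunP => w; rewrite add_lfunE scale_lfunE !AE linearDr linearZr_LR.
pose AL := linfun (HB.pack A (GRing.isLinear.Build F W 'Hom(W, F^o) *:%R A lA) : {linear W -> 'Hom(W, F^o)}).
have ALE w : AL w = A w by rewrite lfunE.
have kA : lker AL == 0%VS.
  rewrite -subv0; apply/subvP => w; rewrite memv_ker => /eqP Aw; rewrite memv0.
  apply/eqP/(symplectic_nondeg B_symplectic) => v.
  by rewrite (skewC B) -AE -ALE Aw zero_lfunE oppr0.
have fA : (AL @: {:W} = {:'Hom(W, F^o)})%VS.
  apply/eqP; rewrite eqEdim subvf limg_dim_eq; last by rewrite (eqP kA) capv0.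
  by rewrite !dimvf /dim /= muln1.
pose l' : 'Hom(W, F^o) := linfun (l \o vsproj Y \o daddv_pi Y X).
have : l' \in (AL @: {:W})%VS by rewrite fA memvf.
case/memv_imgP => w _ lw; have wl v : l' v = B v w by rewrite lw ALE AE.
exists w; last first.
  move=> y; rewrite -wl lfunE /= daddv_pi_id ?vsvalK ?subvsP //.
  by rewrite capvC.
apply: (lagrangian_maximal X_lagrangian) => x xX.
rewrite (skewC B) -wl lfunE /= (daddv_pi_other XY_cap xX).
by rewrite !linear0.
Qed.

Lemma fixed_vectors_bounds (K : set Mp) : nbhs 1%g K -> exists r e : F,
  [/\ r != 0, e != 0, OF r /\ OF e, (forall f, fixed_by K f ->
      forall y : subvs_of Y, f y != 0 -> lattice (r *: y)) &
     forall f, fixed_by K f -> forall y v : subvs_of Y, lattice v -> f (y + e *: v) = f y].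
Proof.
move=> nK; pose d := \dim {:subvs_of Y}; pose bY := vbasis {:subvs_of Y}.
have /choice[r hr] (i : 'I_d) : exists r : F, r != 0 /\ forall f, fixed_by K f ->
    forall y : subvs_of Y, f y != 0 -> OF (r * coord bY i y).
  have [x xX hx] := dual_vector (coord bY i : {linear subvs_of Y -> F^o}).
  have [r r0 h] := fixed_support_bounded nK xX; exists r; split=> // f ff y fy.
  by rewrite hx; exact: h ff y fy.
have /choice[e he] (i : 'I_d) : exists e : F, e != 0 /\ forall f, fixed_by K f ->
    forall b (z : subvs_of Y), OF b -> f (z + (e * b) *: bY`_i) = f z.
  by have [e e0 h] := fixed_smooth bY`_i nK; exists e.
have /choice[n hn] (i : 'I_d) : exists n, OF (2 ^+ n * (r i)^-1) /\ OF (2 ^+ n * (e i)^-1).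
  have [n1 o1] := OF_2X_mul compactOF (r i)^-1; have [n2 o2] := OF_2X_mul compactOF (e i)^-1.
  by exists (maxn n1 n2); split; [exact: OF_2X_le (leq_maxl _ _) o1|exact: OF_2X_le (leq_maxr _ _) o2].
pose N := \max_(i < d) n i; exists (2 ^+ N), (2 ^+ N).
have nN i : (n i <= N)%N by exact: leq_bigmax.
have o2 : OF (2 ^+ N : F) by apply: OFX; exact: OF_nat.
split; [exact: F2X_neq0|exact: F2X_neq0|by []| |].
- move=> f ff y fy i; rewrite linearZ /=.
  have -> : 2 ^+ N * coord bY i y = 2 ^+ N * (r i)^-1 * (r i * coord bY i y).
    by rewrite -mulrA mulKf //; exact: (hr i).1.
  apply: OFM; first exact: OF_2X_le (nN i) (hn i).1.
  exact: (hr i).2 f ff y fy.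
move=> f ff y v lv; rewrite (coord_vbasis (memvf v)) scaler_sumr -/bY.
suff key (s : seq 'I_d) : f (y + \sum_(i <- s) 2 ^+ N *: (coord bY i v *: bY`_i)) = f y.
  by rewrite -[index_enum _]/(index_enum 'I_d) key.
elim: s y => [|i s IHs] y; first by rewrite big_nil addr0.
rewrite big_cons addrA IHs scalerA.
have -> : 2 ^+ N * coord bY i v = e i * (2 ^+ N * (e i)^-1 * coord bY i v).
  by rewrite -(mulrA (2 ^+ N)) mulrCA mulVKf //; exact: (he i).1.
apply: (he i).2 => //; apply: OFM; last exact: lv.
exact: OF_2X_le (nN i) (hn i).2.
Qed.

(** Admissibility of the Weil representation: fixed functions are supported in one lattice and
    periodic under a smaller one, and compactness of [OF] makes the cosets finite in number. *)
Lemma fixed_vectors_points (K : set Mp) : nbhs 1%g K ->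
  exists N (z : 'I_N -> subvs_of Y), forall f, fixed_by K f ->
    (forall j, f (z j) = 0) -> f = 0.
Proof.
move=> nK; have [r [e [r0 e0 [or oe] hr he]]] := fixed_vectors_bounds nK.
pose d := \dim {:subvs_of Y}; pose bY := vbasis {:subvs_of Y}.
have [s [sO hs]] := compactOF (c := fun=> r * e) (fun _ _ => conj (mulf_neq0 r0 e0) (OFM or oe)).
pose I := {ffun 'I_d -> 'I_(size s)}.
pose z (J : I) : subvs_of Y := r^-1 *: \sum_i (nth 0 s (J i)) *: bY`_i.
exists #|I|, (fun j => z (enum_val j)) => f ff fz.
apply: Cc_eq => y; apply/eqP/negPn/negP => fy; have ly := hr f ff y fy.
have /choice[J hJ] (i : 'I_d) : exists j : 'I_(size s),
    OF ((coord bY i (r *: y) - nth 0 s j) / (r * e)).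
  have [x xs ox] := hs _ (ly i).
  by exists (Ordinal (etrans (index_mem _ _) xs)); rewrite /= nth_index.
pose J' : I := [ffun i => J i].
suff fE : f y = f (z J').
  by have := fz (enum_rank J'); rewrite enum_rankK -fE; apply/eqP.
pose v := (r * e)^-1 *: (r *: y - \sum_i (nth 0 s (J i)) *: bY`_i).
have -> : y = z J' + e *: v.
  rewrite /v /z scalerA invfM mulrCA mulfV // mulr1 scalerBr scalerA mulVf // scale1r.
  rewrite addrC; apply/eqP; rewrite eq_sym addrC addrCA.
  rewrite (eq_bigr (fun i => nth 0 s (J i) *: bY`_i)) ?subrr ?addr0 // => i _.
  by rewrite ffunE.
apply: he => // i; rewrite /v linearZ /= linearB /=.
rewrite (coord_sum_free (fun i => nth 0 s (J i)) i (basis_free (vbasisP _))) mulrC.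
exact: hJ.
Qed.

End FixedVectors.

(** * Descent to the fixed field *)

Section FixedSubfield.
Variable A : set Z2.

Definition KA_pred : {pred calK} := [pred x | `[< fixed_field A x >]].

Fact KA_divring : divring_closed KA_pred.
Proof.
split=> [|x y /asboolP hx /asboolP hy|x y /asboolP hx /asboolP hy]; apply/asboolP => a Aa.
- by rewrite rmorph1.
- by rewrite rmorphB hx ?hy.
- by rewrite fmorph_div hx ?hy.
Qed.
HB.instance Definition _ := GRing.isDivringClosed.Build calK KA_pred KA_divring.

Record KA := MkKA { KA_val :> calK; KAP : KA_val \in KA_pred }.
HB.instance Definition _ := [isSub for KA_val].
HB.instance Definition _ := [Choice of KA by <:].
HB.instance Definition _ := [SubChoice_isSubIntegralDomain of KA by <:].
HB.instance Definition _ := [SubIntegralDomain_isSubField of KA by <:].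

Definition KA2K : {rmorphism KA -> calK} := \val.

Lemma KA2K_fixed x : fixed_field A (KA2K x).
Proof. by have /asboolP := KAP x. Qed.

Lemma KA2K_exists x : fixed_field A x -> exists y, KA2K y = x.
Proof. by move=> /asboolP hx; exists (MkKA hx). Qed.

End FixedSubfield.
Arguments KA2K {A}.

Section DescendedSpace.
Variables (F : fieldExtType Q2) (V : vectType F).
Local Notation SV := (Cc (adic V) calK).
Local Notation A := (squares_in_Z2 F).
Local Notation EV := (Cc_even V calK).

Definition descended : {pred EV} := [pred f : EV | `[< forall (a : Z2) (u : F) (u0 : u != 0),
   A a -> u ^+ 2 = Z2emb F a -> twist a u0 (f : SV) = f >]].

Fact descended_zmod_closed : zmod_closed descended.
Proof.
split=> [|f g /asboolP hf /asboolP hg]; apply/asboolP => a u u0 Aa u2.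
  by apply: Cc_eq => y; rewrite twistE Cc0 rmorph0.
apply: Cc_eq => y.
have hfy : sigma a (f (u^-1 *: y)) = f y := congr1 (fun g : SV => g y) (hf a u u0 Aa u2).
have hgy : sigma a (g (u^-1 *: y)) = g y := congr1 (fun g : SV => g y) (hg a u u0 Aa u2).
by rewrite twistE -[X in sigma a X]/(f (u^-1 *: y) - g (u^-1 *: y)) rmorphB hfy hgy.
Qed.
HB.instance Definition _ := GRing.isZmodClosed.Build EV descended descended_zmod_closed.

Record desc_space := MkDesc { desc_val :> EV; descP : desc_val \in descended }.
HB.instance Definition _ := [isSub for desc_val].
HB.instance Definition _ := [Choice of desc_space by <:].
HB.instance Definition _ := [SubChoice_isSubZmodule of desc_space by <:].

Lemma desc_twist (f : desc_space) (a : Z2) (u : F) (u0 : u != 0) :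
  A a -> u ^+ 2 = Z2emb F a -> twist a u0 (f : SV) = f.
Proof. by have /asboolP h := descP f; exact: h. Qed.

Fact desc_scale_subproof (c : KA A) (f : desc_space) : KA2K c *: (f : EV) \in descended.
Proof.
apply/asboolP => a u u0 Aa u2.
by rewrite -[RHS](congr1 (fun g => KA2K c *: g) (desc_twist f u0 Aa u2)) twistZ KA2K_fixed.
Qed.
Definition desc_scale (c : KA A) (f : desc_space) : desc_space :=
  MkDesc (desc_scale_subproof c f).

Fact desc_scaleA (a b : KA A) v : desc_scale a (desc_scale b v) = desc_scale (a * b) v.
Proof.
apply: val_inj; rewrite -[LHS]/(KA2K a *: (KA2K b *: desc_val v)).
by rewrite scalerA -rmorphM.
Qed.
Fact desc_scale1 : left_id 1 desc_scale.
Proof.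
by move=> v; apply: val_inj; rewrite -[LHS]/(KA2K 1 *: desc_val v) rmorph1 scale1r.
Qed.
Fact desc_scaleDr : right_distributive desc_scale +%R.
Proof.
move=> c u v; apply: val_inj.
by rewrite -[LHS]/(KA2K c *: (desc_val u + desc_val v)) scalerDr.
Qed.
Fact desc_scaleDl v : {morph desc_scale^~ v : a b / a + b}.
Proof.
move=> a b; apply: val_inj.
by rewrite -[LHS]/(KA2K (a + b) *: desc_val v) rmorphD scalerDl.
Qed.
HB.instance Definition _ := GRing.Zmodule_isLmodule.Build (KA A) desc_space
  desc_scaleA desc_scale1 desc_scaleDr desc_scaleDl.

Lemma desc_valD (f g : desc_space) : desc_val (f + g) = desc_val f + desc_val g.
Proof. by []. Qed.
Lemma desc_valZ c (f : desc_space) : desc_val (c *: f) = KA2K c *: desc_val f.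
Proof. by []. Qed.

End DescendedSpace.

Section SquaresGroup.
Variable F : fieldExtType Q2.
Local Notation A := (squares_in_Z2 F).

Lemma squares_root (a : Z2) : A a -> exists2 u : F, u != 0 & u ^+ 2 = Z2emb F a.
Proof. by move=> [_ [u [u0 _ _] u2]]; exists u. Qed.

Lemma squares_mem (a : Z2) (u : F) : a \is a GRing.unit -> u ^+ 2 = Z2emb F a -> A a.
Proof. by move=> au u2; have [] := squares_in_Z2P au u2. Qed.

Lemma squares1 : A 1.
Proof. by apply: (@squares_mem 1 1); rewrite ?unitr1 // expr1n rmorph1. Qed.

Lemma squaresM a b : A a -> A b -> A (a * b).
Proof.
move=> Aa Ab; have [u _ u2] := squares_root Aa; have [v _ v2] := squares_root Ab.
apply: (@squares_mem _ (u * v)); last by rewrite exprMn u2 v2 rmorphM.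
by rewrite unitrM (squares_in_Z2_unit Aa) (squares_in_Z2_unit Ab).
Qed.

Lemma squaresV a : A a -> A a^-1.
Proof.
move=> Aa; have [u _ u2] := squares_root Aa; have au := squares_in_Z2_unit Aa.
by apply: (@squares_mem _ u^-1); rewrite ?unitrV // exprVn u2 rmorphV.
Qed.

(** Either square root will do, since even functions do not see its sign; the default 1 keeps it
    nonzero for all a. *)
Definition root_of (a : Z2) : F := xget 1 [set u : F | u != 0 /\ u ^+ 2 = Z2emb F a].

Lemma root_of_neq0 a : root_of a != 0.
Proof. by rewrite /root_of; case: xgetP => [u -> []|]; rewrite ?oner_neq0. Qed.

Lemma root_of_sq a : A a -> root_of a ^+ 2 = Z2emb F a.
Proof.
move=> /squares_root[u u0 u2]; rewrite /root_of; case: xgetP => [v -> []//|h].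
by have := h u (conj u0 u2).
Qed.

End SquaresGroup.

Lemma Z2_unit_cancel (a x y : Z2) m : a \is a GRing.unit ->
  (a * x) m = (a * y) m -> x m = y m.
Proof. by move=> au e; rewrite -(mulKr au x) -(mulKr au y) !(Z2M a^-1) e. Qed.

Section EvenTwist.
Variables (F : fieldExtType Q2) (V : vectType F).
Local Notation SV := (Cc (adic V) calK).
Local Notation A := (squares_in_Z2 F).
Local Notation EV := (Cc_even V calK).

Lemma even_eq (f g : EV) : (forall y, f y = g y) -> f = g.
Proof. by move=> fg; apply: val_inj; apply: Cc_eq. Qed.

Lemma evenE (f : EV) (y : V) : f (- y) = f y.
Proof. by have /asboolP := Cc_evenP f; apply. Qed.

Lemma evenD (f g : EV) (y : V) : (f + g) y = f y + g y. Proof. by []. Qed.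
Lemma evenZ c (f : EV) (y : V) : (c *: f) y = c * f y. Proof. by []. Qed.
Lemma even0 (y : V) : (0 : EV) y = 0. Proof. by []. Qed.

Lemma even_sum I (r : seq I) (P : pred I) (f : I -> EV) (y : V) :
  (\sum_(i <- r | P i) f i) y = \sum_(i <- r | P i) f i y.
Proof.
elim: r => [|i r IHr]; first by rewrite !big_nil.
by rewrite !big_cons; case: (P i); rewrite ?evenD IHr.
Qed.

Fact even_twist_subproof a (f : EV) :
  twist a (root_of_neq0 F a) (f : SV) \in @even_fun F V calK.
Proof. by apply/asboolP => y; rewrite !twistE scalerN evenE. Qed.

Definition even_twist a (f : EV) : EV := MkCc_even (even_twist_subproof a f).

Lemma even_twistE a f (y : V) : even_twist a f y = sigma a (f ((root_of F a)^-1 *: y)).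
Proof. by []. Qed.

Lemma even_twistD a f g : even_twist a (f + g) = even_twist a f + even_twist a g.
Proof. by apply: even_eq => y; rewrite evenD !even_twistE evenD rmorphD. Qed.

Lemma even_twistZ a c f : even_twist a (c *: f) = sigma a c *: even_twist a f.
Proof. by apply: even_eq => y; rewrite evenZ !even_twistE evenZ rmorphM. Qed.

(* f and its twists only see a mod 2^m *)
Definition has_level m (f : EV) :=
  (forall a b : Z2, a \is a GRing.unit -> b \is a GRing.unit -> a m = b m ->
     forall y, sigma a (f y) = sigma b (f y)) /\
  (forall (c : Z2) (v : F), c \is a GRing.unit -> v ^+ 2 = Z2emb F c -> c m = (1 %% 2 ^ m)%N ->
     forall y : V, f (v *: y) = f y).

Lemma twist_indep m f (a b : Z2) (u w : F) (u0 : u != 0) (w0 : w != 0) : has_level m f ->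
  a \is a GRing.unit -> b \is a GRing.unit -> a m = b m ->
  u ^+ 2 = Z2emb F a -> w ^+ 2 = Z2emb F b ->
  twist a u0 (f : SV) = twist b w0 (f : SV).
Proof.
move=> [h1 h2] au bu ab u2 w2; apply: Cc_eq => y; rewrite !twistE (h1 a b) //.
have bau : b / a \is a GRing.unit by rewrite unitrM bu unitrV.
have v2 : (w / u) ^+ 2 = Z2emb F (b / a) by rewrite exprMn exprVn u2 w2 rmorphM rmorphV.
have c1 : (b / a) m = (1 %% 2 ^ m)%N.
  have -> : (b / a) m = (a / a) m by rewrite !Z2M ab.
  by rewrite divrr.
have -> : u^-1 *: (y : V) = (w / u) *: (w^-1 *: (y : V)).
  by rewrite scalerA; congr (_ *: _); field; rewrite u0 w0.
by rewrite (h2 (b / a)).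
Qed.

Lemma has_levelZ m f (z : calK) : z ^+ (2 ^ m) = 1 -> has_level m f -> has_level m (z *: f).
Proof.
move=> zm [h1 h2]; split=> [a b au bu ab y|c v cu v2 c1 y]; last by rewrite !evenZ (h2 c).
by rewrite !evenZ !rmorphM /= (h1 a b) // !(sigmaE _ zm) // ab.
Qed.

Section Descent.
Variables (m : nat) (f : EV).
Hypothesis m_gt0 : (0 < m)%N.

Definition level_class (b : 'I_(2 ^ m)) : bool := `[< exists2 a, A a & a m = b >].

Definition class_rep (b : 'I_(2 ^ m)) : Z2 := xget 1 [set a : Z2 | A a /\ a m = b].

Lemma class_repP b : level_class b -> A (class_rep b) /\ class_rep b m = b.
Proof.
move=> /asboolP[a Aa ab]; rewrite /class_rep; case: xgetP => [c -> //|h].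
by have := h a (conj Aa ab).
Qed.

(** The Galois trace of f over the image of A modulo 2^m, on which alone the twists of a function of
    level m depend; A permutes its terms. *)
Definition descent_trace : EV := \sum_(b | level_class b) even_twist (class_rep b) f.

Lemma descent_trace_descended : has_level m f -> descent_trace \in @descended F V.
Proof.
move=> hl; apply/asboolP => a u u0 Aa u2; have au := squares_in_Z2_unit Aa.
pose h (b : 'I_(2 ^ m)) : 'I_(2 ^ m) := Ordinal (ltn_pmod (a m * b) (expn_gt0 2 m)).
have hinj : injective h.
  move=> b b' /(congr1 val) /= e; apply: val_inj.
  have := @Z2_unit_cancel a b%:R b'%:R m au.
  by rewrite !Z2M !Z2_natr !modnMmr => /(_ e); rewrite !modn_small.
have hcl b : level_class b = level_class (h b).
  apply/asboolP/asboolP => -[c Ac cb].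
    by exists (a * c); [exact: squaresM|rewrite Z2M cb].
  exists (a^-1 * c); first by apply: squaresM => //; exact: squaresV.
  have := @Z2_unit_cancel a (a^-1 * c) b%:R m au.
  by rewrite mulVKr // cb Z2M Z2_natr /= modnMmr => /(_ erefl) ->; rewrite modn_small.
apply: Cc_eq => y; rewrite twistE /descent_trace !even_sum rmorph_sum [RHS](reindex_inj hinj).
rewrite (eq_bigl _ _ hcl); apply: eq_bigr => b hb; rewrite -hcl in hb.
have [Ab bE] := class_repP hb; have bu := squares_in_Z2_unit Ab.
have hb' : level_class (h b) by rewrite -hcl.
have [Ahb hbE] := class_repP hb'.
have ub0 : root_of F (class_rep b) * u != 0 by rewrite mulf_neq0 // root_of_neq0.
have abu : a * class_rep b \is a GRing.unit by rewrite unitrM au.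
have e1 : (a * class_rep b) m = class_rep (h b) m by rewrite Z2M bE hbE.
have sq : (root_of F (class_rep b) * u) ^+ 2 = Z2emb F (a * class_rep b).
  by rewrite exprMn u2 root_of_sq // mulrC rmorphM.
have := twist_indep ub0 (root_of_neq0 F (class_rep (h b))) hl abu
  (squares_in_Z2_unit Ahb) e1 sq (root_of_sq Ahb).
move=> /(congr1 (fun g : SV => g y)); rewrite !twistE => e2.
by rewrite -e2 sigmaM // scalerA -invfM.
Qed.

End Descent.

Lemma class_one_exists m : (0 < m)%N -> level_class (Ordinal (ltn_pmod 1 (expn_gt0 2 m))).
Proof. by move=> m0; apply/asboolP; exists 1; [exact: squares1|]. Qed.

(** With z a primitive 2^m-th root of unity, f is the mean of the z^-i times the trace of z^i f:
    summing over i leaves only the class of 1. *)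
Lemma descended_span m f : (0 < m)%N -> has_level m f ->
  exists n (c : 'I_n -> calK) (g : 'I_n -> desc_space V), f = \sum_k c k *: desc_val (g k).
Proof.
move=> m0 hl; have [z zP] := calK_prim_root m; have z0 : z != 0.
  apply/eqP => z0; have := prim_expr_order zP; rewrite z0 expr0n expn_eq0 /=.
  by move=> /esym/eqP; rewrite oner_eq0.
have ziP (i : nat) : (z ^+ i) ^+ (2 ^ m) = 1 by rewrite exprAC (prim_expr_order zP) expr1n.
have hd (i : 'I_(2 ^ m)) : descent_trace m (z ^+ i *: f) \in @descended F V.
  by apply: descent_trace_descended => //; exact: has_levelZ.
pose N : calK := (2 ^ m)%:R.
have N0 : N != 0 by rewrite -(fmorph_eq0 K2C) rmorph_nat pnatr_eq0 expn_eq0.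
exists (2 ^ m)%N, (fun i => N^-1 * z ^- i), (fun i => MkDesc (hd i)).
pose b1 : 'I_(2 ^ m) := Ordinal (ltn_pmod 1 (expn_gt0 2 m)).
have ex b : level_class b -> \sum_(i < 2 ^ m) z ^- i * sigma (class_rep b) (z ^+ i) = if b == b1 then N else 0.
  move=> hb; have [Ab bE] := class_repP hb; have bu := squares_in_Z2_unit Ab.
  pose w := z ^+ b / z; have w1 : w ^+ (1 * 2 ^ m) = 1.
    by rewrite mul1n exprMn exprVn (prim_expr_order zP) ziP invr1 mulr1.
  have := @sum_root_powers _ w (2 ^ m) 1 0 w1; rewrite expr0 expr1 => h.
  transitivity (\sum_(i < 2 ^ m) w ^+ (0 + 1 * i)).
    apply: eq_bigr => i _; rewrite (sigmaE bu (ziP i)) bE add0n mul1n /w exprMn exprVn.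
    by rewrite mulrC -!exprM mulnC.
  rewrite h; congr (if _ then _ else _).
  rewrite -(inj_eq (mulIf z0)) divfK // mul1r -{2}[z]expr1 (eq_prim_root_expr zP).
  by rewrite -val_eqE /= (modn_small (ltn_ord b)).
have gE (k : 'I_(2 ^ m)) (y : V) : descent_trace m (z ^+ k *: f) y =
    \sum_(b : 'I_(2 ^ m) | level_class b) sigma (class_rep b) (z ^+ k) * even_twist (class_rep b) f y.
  by rewrite /descent_trace even_sum; apply: eq_bigr => b _; rewrite even_twistZ evenZ.
have tw1 : even_twist (class_rep b1) f = f.
  have [Ab bE] := class_repP (class_one_exists m0); have bu := squares_in_Z2_unit Ab.
  have w2 : (1 : F) ^+ 2 = Z2emb F 1 by rewrite expr1n rmorph1.
  apply: val_inj; rewrite -[LHS]/(twist (class_rep b1) (root_of_neq0 F (class_rep b1)) (f : SV)).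
  rewrite (twist_indep _ (oner_neq0 _) hl bu (unitr1 _) bE (root_of_sq Ab) w2).
  by apply: Cc_eq => y; rewrite twistE sigma1 invr1 scale1r.
apply: even_eq => y; rewrite even_sum.
transitivity (N^-1 * \sum_(b : 'I_(2 ^ m) | level_class b)
    (\sum_(i < 2 ^ m) z ^- i * sigma (class_rep b) (z ^+ i)) * even_twist (class_rep b) f y).
  rewrite (bigD1 b1) /=; last exact: class_one_exists.
  rewrite [X in _ + X]big1 ?addr0; last by move=> b /andP[hb bb]; rewrite ex // (negPf bb) mul0r.
  have hb1 : level_class b1 := class_one_exists m0.
  have := congr1 (fun g : EV => g y) tw1; rewrite /= => e.
  by rewrite ex // eqxx e mulKf.
under eq_bigr do rewrite mulr_suml.
rewrite exchange_big mulr_sumr; apply: eq_bigr => i _.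
rewrite evenZ gE -mulrA; congr (_ * _); rewrite mulr_sumr.
by apply: eq_bigr => b _; rewrite mulrA.
Qed.

(* Artin's argument. *)
Lemma descended_free n (e : 'I_n -> desc_space V) :
  free_family e -> free_family (fun i => desc_val (e i)).
Proof.
elim: n e => [|n IHn] e fe c c0; first by case.
have fe' : free_family (fun i => e (lift ord0 i)).
  move=> d d0 i; pose d' (j : 'I_n.+1) := oapp d 0 (unlift ord0 j).
  have := fe d' _ (lift ord0 i); rewrite /d' liftK; apply.
  rewrite big_ord_recl unlift_none scale0r add0r -[RHS]d0.
  by apply: eq_bigr => j _; rewrite liftK.
have {IHn}IH := IHn _ fe'.
have [c00|c00] := eqVneq (c ord0) 0.
  move: c0; rewrite big_ord_recl c00 scale0r add0r => /IH h i.
  by case: (unliftP ord0 i) => [j ->|->].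
pose d i := (c ord0)^-1 * c i.
have d0 : \sum_i d i *: desc_val (e i) = 0.
  under eq_bigr do rewrite /d -scalerA.
  by rewrite -scaler_sumr c0 scaler0.
have d1 : d ord0 = 1 by rewrite /d mulVf.
have fixd i : fixed_field A (d i).
  move=> a Aa; have tw (g : desc_space V) : even_twist a (desc_val g) = desc_val g.
    by apply: val_inj; exact: (desc_twist g (root_of_neq0 F a) Aa (root_of_sq Aa)).
  have even_twist0 : even_twist a 0 = 0.
    by apply: even_eq => y; rewrite even_twistE !even0 rmorph0.
  have d0' : \sum_i sigma a (d i) *: desc_val (e i) = 0.
    transitivity (even_twist a (\sum_i d i *: desc_val (e i))); last by rewrite d0.
    rewrite (big_morph _ (even_twistD a) even_twist0).
    by apply: eq_bigr => j _; rewrite even_twistZ tw.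
  have := IH (fun i => sigma a (d (lift ord0 i)) - d (lift ord0 i)).
  have e0 : \sum_i (sigma a (d (lift ord0 i)) - d (lift ord0 i)) *: desc_val (e (lift ord0 i)) = 0.
    under eq_bigr do rewrite scalerBl.
    rewrite sumrB; move: d0 d0'; rewrite !big_ord_recl d1 rmorph1 => /eqP + /eqP.
    by rewrite !addr_eq0 => /eqP h1 /eqP h2; apply/eqP; rewrite subr_eq0 -eqr_opp -h1 -h2.
  move=> /(_ e0) h; case: (unliftP ord0 i) => [j ->|->]; last by rewrite d1 rmorph1.
  by apply/eqP; rewrite -subr_eq0 h.
have /choice[k hk] i := KA2K_exists (fixd i).
have : \sum_i k i *: e i = 0.
  apply: val_inj; rewrite -[RHS]d0.
  have vs I (r : seq I) (g : I -> desc_space V) : desc_val (\sum_(i <- r) g i) = \sum_(i <- r) desc_val (g i).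
    by elim: r => [|i r IHr]; rewrite ?big_nil // !big_cons desc_valD IHr.
  by rewrite [LHS]vs; apply: eq_bigr => i _; rewrite desc_valZ hk.
move=> /fe/(_ ord0) k0; have := hk ord0; rewrite k0 rmorph0 d1 => /esym/eqP.
by rewrite oner_eq0.
Qed.

End EvenTwist.

(** * A common base change to the algebraic numbers *)

Section CommonModel.
Variables (F : fieldExtType Q2) (V : vectType F).
Local Notation EV := (Cc_even V calK).

(** The tensor product with [algC] is modelled by the [algC]-span of the even functions among all
    functions on V, so that identities are checked pointwise. *)
Definition algC_span : {pred (V -> algC^o)} := [pred t : V -> algC^o |
  `[< exists n (a : 'I_n -> algC) (f : 'I_n -> EV), forall y, t y = \sum_k a k * K2C (f k y) >]].

Fact algC_span_submod : submod_closed algC_span.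
Proof.
split=> [|c s t /asboolP[n [a [f hs]]] /asboolP[n' [a' [f' ht]]]]; apply/asboolP.
  by exists 0%N, (fun=> 0), (fun=> 0) => y; rewrite big_ord0.
exists (n + n')%N, (fun k => match fintype.split k with inl j => c * a j | inr j => a' j end).
exists (fun k => match fintype.split k with inl j => f j | inr j => f' j end) => y.
rewrite -[LHS]/(c * s y + t y) hs ht big_split_ord mulr_sumr /=.
congr (_ + _); apply: eq_bigr => k _.
  by rewrite (unsplitK (inl k)) mulrA.
by rewrite (unsplitK (inr k)).
Qed.
HB.instance Definition _ :=
  GRing.isSubmodClosed.Build algC (V -> algC^o) algC_span algC_span_submod.

Record algC_model := MkModel { model_val :> V -> algC^o; modelP : model_val \in algC_span }.
HB.instance Definition _ := [isSub for model_val].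
HB.instance Definition _ := [Choice of algC_model by <:].
HB.instance Definition _ := [SubChoice_isSubLmodule of algC_model by <:].

Lemma model_eq (s t : algC_model) : (forall y, s y = t y) -> s = t.
Proof. by move=> st; apply: val_inj; apply/funext. Qed.

Lemma modelD (s t : algC_model) y : (s + t) y = s y + t y. Proof. by []. Qed.
Lemma model_sum n (c : 'I_n -> algC) (t : 'I_n -> algC_model) y :
  (\sum_i c i *: t i) y = \sum_i c i * t i y.
Proof. by elim: n c t => [|n IHn] c t; rewrite ?big_ord0 // !big_ord_recl modelD IHn. Qed.

Fact model_inj_subproof (f : EV) : (fun y => K2C (f y)) \in algC_span.
Proof. by apply/asboolP; exists 1%N, (fun=> 1), (fun=> f) => y; rewrite big_ord1 mul1r. Qed.
Definition model_inj (f : EV) : algC_model := MkModel (model_inj_subproof f).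

Lemma model_injE f y : model_inj f y = K2C (f y). Proof. by []. Qed.

Lemma model_inj_linear : linear_for (K2C \; *:%R) model_inj.
Proof.
move=> c f g; apply: model_eq => y.
rewrite -[RHS]/(K2C c * K2C (f y) + K2C (g y)) model_injE.
by rewrite -[f in LHS]/f -rmorphM -rmorphD.
Qed.

Definition model_lin : {linear EV -> algC_model | (K2C \; *:%R)} :=
  HB.pack model_inj (GRing.isLinear.Build calK EV algC_model (K2C \; *:%R) model_inj model_inj_linear).

Lemma model_span (t : algC_model) : exists n (a : 'I_n -> algC) (f : 'I_n -> EV),
  t = \sum_k a k *: model_lin (f k).
Proof.
have /asboolP[n [a [f ht]]] := modelP t; exists n, a, f.
by apply: model_eq => y; rewrite model_sum ht.
Qed.

Lemma model_free n (e : 'I_n -> EV) : free_family e -> free_family (fun k => model_lin (e k)).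
Proof.
move=> fe; have [|f f0|m [y [d hd]]] := @free_functions_dual calK EV V (fun f y => f y) n e _ _ fe.
- by [].
- by apply: even_eq => y; rewrite f0.
move=> c c0 k; have c0y j : \sum_l c l * K2C (e l (y j)) = 0.
  by have := congr1 (fun t : algC_model => t (y j)) c0; rewrite model_sum.
transitivity (\sum_l c l * K2C (k == l)%:R).
  rewrite (bigD1 k) //= eqxx rmorph1 mulr1 big1 ?addr0 // => l.
  by rewrite eq_sym => /negPf->; rewrite rmorph0 mulr0.
transitivity (\sum_j K2C (d k j) * \sum_l c l * K2C (e l (y j))); last first.
  by rewrite big1 // => j _; rewrite c0y mulr0.
under [RHS]eq_bigr do rewrite mulr_sumr.
rewrite exchange_big; apply: eq_bigr => l _.
rewrite -(hd k l) (rmorph_sum K2C) mulr_sumr; apply: eq_bigr => j _.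
by rewrite rmorphM mulrCA.
Qed.

Lemma model_base_change : is_base_change model_lin.
Proof. exact: free_span_base_change model_free model_span. Qed.

Local Notation A := (squares_in_Z2 F).
Definition KA2C : {rmorphism KA A -> algC} := K2C \o KA2K.

Lemma desc_model_linear : linear_for (KA2C \; *:%R) (fun f : desc_space V => model_inj (desc_val f)).
Proof.
move=> c f g; rewrite desc_valD desc_valZ; exact: model_inj_linear.
Qed.

Definition desc_model : {linear desc_space V -> algC_model | (KA2C \; *:%R)} :=
  HB.pack (fun f : desc_space V => model_inj (desc_val f))
   (GRing.isLinear.Build (KA A) (desc_space V) algC_model (KA2C \; *:%R) _ desc_model_linear).

Lemma desc_model_base_change :
  (forall f : EV, exists2 m, (0 < m)%N & has_level m f) -> is_base_change desc_model.
Proof.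
move=> hlev; apply: free_span_base_change => [n e fe|t].
  exact: (model_free (descended_free fe)).
have [n [a [f ->]]] := model_span t.
pose P t := exists n (a : 'I_n -> algC) (v : 'I_n -> desc_space V), t = \sum_k a k *: desc_model (v k).
apply: (big_ind P) => [|s s' [n1 [a1 [v1 ->]]] [n2 [a2 [v2 ->]]]|k _].
- by exists 0%N, (fun=> 0), (fun=> 0); rewrite big_ord0.
- exists (n1 + n2)%N, (fun k => match fintype.split k with inl j => a1 j | inr j => a2 j end).
  exists (fun k => match fintype.split k with inl j => v1 j | inr j => v2 j end).
  rewrite big_split_ord /=; congr (_ + _); apply: eq_bigr => k _.
    by rewrite (unsplitK (inl k)).
  by rewrite (unsplitK (inr k)).
have [m m0 hm] := hlev (f k); have [n1 [c [g fE]]] := descended_span m0 hm.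
exists n1, (fun j => a k * K2C (c j)), g.
rewrite fE (semilinear_sum model_lin) scaler_sumr; apply: eq_bigr => j _.
by rewrite scalerA.
Qed.

End CommonModel.

(** * Realisation over the fixed field *)

Section Realisation.
Variables (F : fieldExtType Q2) (W : vectType F) (B : {skew_symmetric W}).
Hypothesis B_symplectic : is_psymplectic B.
Variables (X Y : {vspace W}).
Hypothesis X_lagrangian : orthov B X = X.
Hypothesis XY_cap : (X :&: Y)%VS = 0%VS.
Variable psi : smooth_character F calK.
Hypothesis psi_nontrivial : exists x, psi x != 1.
Hypothesis compactOF : OF_compact F.
Variables (Mp : topologicalGroupType) (p : Mp -> Sp B) (p_cover : double_cover p).
Variable omega : smooth_rep Mp (Cc (adic (subvs_of Y)) calK).
Hypothesis omega_weil : is_weil_rep X psi p omega.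
Variable omega_even : smooth_rep Mp (Cc_even (subvs_of Y) calK).
Hypothesis omega_evenP : is_even_part omega omega_even.
Local Notation A := (squares_in_Z2 F).
Local Notation EV := (Cc_even (subvs_of Y) calK).

(** The finitely many values of f generate a field of finite level. If v^2 is close to 1, then v is
    close to 1 or -1, and evenness reduces to 1. There v y - y is a period of f, because y ranges
    over a bounded support; the bounds come from the stabiliser of f. *)
Lemma even_has_level (f : EV) : exists2 m, (0 < m)%N & has_level m f.
Proof.
have [|n [S [u [_ _ hS h0]]]] := locally_constant_steps (u0 := 0)
  (@Cc_support_compact _ _ (f : Cc _ _)) (Cc_locally_constant (f : Cc _ _)).
  by move=> y fy; apply: subset_closure.
have [k0 hk0] := sigma_level [seq u i | i <- enum 'I_n].
have [r [e [r0 e0 _ hr he]]] := fixed_vectors_bounds B_symplectic X_lagrangian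
  XY_cap psi_nontrivial compactOF p_cover omega_weil (stabiliser_nbhs omega f).
have ff : fixed_by omega [set g | omega g f = f] f by [].
have [m1 hm1] := OF_near_pm1 compactOF (char_OF_half compactOF psi_nontrivial) (mulf_neq0 r0 e0).
pose m := (maxn k0 m1).+1; exists m => //; split=> [a b au bu ab y|].
  have [->|fy] := eqVneq (f y) 0; first by rewrite !rmorph0.
  have [i Si] := h0 y fy; rewrite (hS i y Si).
  by apply: (hk0 m) => //; [rewrite leqW ?leq_maxl|rewrite map_f ?mem_enum].
have key (c : Z2) (v : F) (y : subvs_of Y) : v ^+ 2 = Z2emb F c -> c m = (1 %% 2 ^ m)%N ->
    f y != 0 -> f (v *: y) = f y.
  move=> v2 c1 fy; have ly := hr f ff y fy.
  have near w : OF ((w - 1) / (r * e)) -> f (w *: y) = f y.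
    move=> ow; have -> : w *: y = y + e *: (((w - 1) / (r * e)) *: (r *: y)).
      rewrite !scalerA -[X in X + _]scale1r -scalerDl; congr (_ *: _).
      by field; rewrite r0 e0.
    by apply: he => //; exact: latticeZ.
  have o2 : OF ((v ^+ 2 - 1) / 2 ^+ m1).
    have [z cE] := Z2_shift c m; rewrite v2 cE c1 modn_small; last first.
      by rewrite -[X in (X < _)%N](expn0 2) ltn_exp2l.
    rewrite rmorphD rmorph1 addrC addKr rmorphM rmorphXn rmorph_nat.
    have m1m : (m1 <= m)%N by rewrite leqW ?leq_maxr.
    rewrite -(subnK m1m) exprD mulrAC mulfK ?F2X_neq0 //.
    by apply: OFM; [apply: OFX; exact: OF_nat|exact: OF_Z2].
  have [|o|o] := hm1 v; [by []|exact: near|].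
  rewrite -[LHS]evenE -scaleNr; apply: near.
  by rewrite -opprD mulNr; exact: OFN.
(* Where f y = 0, the previous case is applied to v^-1 at the point v y. *)
move=> c v cu v2 c1 y; have [fy|fy] := eqVneq (f y) 0; last exact: key v2 c1 fy.
apply/eqP; rewrite fy; apply/negPn/negP => fvy.
have v0 : v != 0 by have [] := squares_in_Z2P cu v2.
have cV : (c^-1) m = (1 %% 2 ^ m)%N.
  by rewrite -[RHS]/((1 : Z2) m); apply: (Z2_unit_cancel cu); rewrite mulrV // mulr1 c1.
have vV : v^-1 ^+ 2 = Z2emb F c^-1 by rewrite exprVn v2 rmorphV.
have := key _ _ (v *: y) vV cV fvy; rewrite scalerA mulVf // scale1r fy => fv0.
by rewrite -fv0 eqxx in fvy.
Qed.

Lemma desc_rep_subproof g (f : desc_space (subvs_of Y)) :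
  omega_even g (desc_val f) \in @descended F (subvs_of Y).
Proof.
apply/asboolP => a u u0 Aa u2; rewrite omega_evenP.
rewrite (twist_weil B_symplectic X_lagrangian XY_cap psi_nontrivial compactOF p_cover omega_weil u0) //.
  by rewrite (desc_twist f u0 Aa u2).
exact: squares_in_Z2_unit Aa.
Qed.
Definition desc_op g f := MkDesc (desc_rep_subproof g f).

Lemma desc_op_linear g : linear (desc_op g).
Proof.
move=> c v w; apply: val_inj; rewrite -[LHS]/(omega_even g (KA2K c *: desc_val v + desc_val w)).
by rewrite linearP.
Qed.
Definition desc_lin g : {linear desc_space (subvs_of Y) -> desc_space (subvs_of Y)} :=
  HB.pack (desc_op g) (GRing.isLinear.Build (KA A) _ _ *:%R (desc_op g) (desc_op_linear g)).

Fact desc_rep_one v : desc_lin 1%g v = v.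
Proof. by apply: val_inj; exact: rep_one. Qed.
Fact desc_rep_mul g h v : desc_lin (g * h)%g v = desc_lin g (desc_lin h v).
Proof. by apply: val_inj; exact: rep_mul. Qed.
Fact desc_rep_smooth v : open [set g | desc_lin g v = v].
Proof.
have := rep_smooth omega_even (desc_val v); congr open; rewrite predeqE => g /=.
by split=> [e|/(congr1 (@desc_val _ _))]; first exact: val_inj.
Qed.
Definition desc_rep : smooth_rep Mp (desc_space (subvs_of Y)) :=
  SmoothRep desc_rep_one desc_rep_mul desc_rep_smooth.

Lemma realisable_over_fixed_field :
  realisable_over \val omega_even (K2C @` fixed_field A).
Proof.
pose i := model_lin (subvs_of Y).
have comp g : exists t : {linear algC_model (subvs_of Y) -> algC_model (subvs_of Y)},
    forall v, t (i v) = i (omega_even g v).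
  have lh : linear_for (K2C \; *:%R) (fun v => i (omega_even g v)).
    by move=> c v w; rewrite linearP; exact: model_inj_linear.
  pose h : {linear Cc_even (subvs_of Y) calK -> algC_model (subvs_of Y) | (K2C \; *:%R)} :=
    HB.pack (fun v => i (omega_even g v)) (GRing.isLinear.Build _ _ _ (K2C \; *:%R) _ lh).
  by have [t ht _] := model_base_change h; exists t.
have [tau htau] := choice comp.
exists (KA A), (@KA2C F), (desc_space (subvs_of Y)), desc_rep, (algC_model (subvs_of Y)), tau.
exists i, (desc_model (subvs_of Y)); split.
- rewrite predeqE => x; split=> [[c _ <-]|[y fy <-]].
    by exists (KA2K c) => //; exact: KA2K_fixed.
  by have [c cy] := KA2K_exists fy; exists c; rewrite // -cy.
- exact: model_base_change.
- by apply: desc_model_base_change; exact: even_has_level.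
- exact: htau.
- by move=> g v; rewrite [LHS](htau g (desc_val v)).
Qed.

End Realisation.

(** * The character field *)

Section CyclotomicTrace.

(** The trace from Q(z) to Q: the odd residues index the conjugates, and the odd powers of z^j add
    up to 0 or to plus or minus 2^h. *)
Lemma odd_trace_rational h (z : calK) (p : {poly rat}) : (2 ^ h.+1).-primitive_root z ->
  exists r : rat, \sum_(i < 2 ^ h) sigma (1 + 2 * i)%:R (pQ calK p).[z] = ratr r.
Proof.
move=> zP; have bu (i : nat) : ((1 + 2 * i)%:R : Z2) \is a GRing.unit.
  by apply: Z2_nat_unit; rewrite oddD oddM.
have term (j : nat) : exists r : rat, \sum_(i < 2 ^ h) (z ^+ j) ^+ (1 + 2 * i) = ratr r.
  have w1 : (z ^+ j) ^+ (2 * 2 ^ h) = 1 by rewrite -expnS exprAC (prim_expr_order zP) expr1n.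
  rewrite (sum_root_powers 1 w1); case: eqP => [w2|_]; last by exists 0; rewrite ratKE rmorph0.
  have : (z ^+ j) ^+ 2 == 1 ^+ 2 by rewrite w2 expr1n.
  rewrite eqf_sqr => /orP[/eqP->|/eqP->].
    by exists (2 ^ h)%:R; rewrite ratKE rmorph_nat expr1n.
  by exists (- (2 ^ h)%:R); rewrite ratKE rmorphN rmorph_nat expr1 mulNrn.
have /choice[r hr] := term.
exists (\sum_(j < size p) p`_j * r j); rewrite ratKE rmorph_sum.
transitivity (\sum_(i < 2 ^ h) \sum_(j < size p) ratK p`_j * (z ^+ j) ^+ (1 + 2 * i)).
  apply: eq_bigr => i _; rewrite (sigma_poly p (bu i) zP) Z2_natr.
  rewrite (expr_mod _ (prim_expr_order zP)) (horner_coef_wide _ (size_poly _ _)).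
  by apply: eq_bigr => j _; rewrite coef_map_id0 ?ratKE ?rmorph0 // exprAC.
rewrite exchange_big; apply: eq_bigr => j _.
by rewrite -mulr_sumr hr rmorphM.
Qed.

End CyclotomicTrace.

Section FourierData.
Variables (F : fieldExtType Q2) (psi : smooth_character F calK).
Hypotheses (compactOF : OF_compact F) (psi_nontrivial : exists x, psi x != 1).
Variables (c0 : F) (c00 : c0 != 0) (lam : calK).
Hypothesis lam_fixed : fixed_field (squares_in_Z2 F) lam.

Local Notation q w := (- (2^-1 * c0 * w)).

(** On [OF], the character a -> psi(a q(b^2)) is the m-th power of theta: a -> psi(a q(t0^2)). For b
    = B y x, psi(a q(b^2)) is the multiplier at y of the lifted transvection of parameter c0 a along
    x. *)
Definition theta_near (t0 b : F) (m : nat) :=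
  forall a, OF a -> psi (a * q (b ^+ 2 - m%:R * t0 ^+ 2)) = 1.

(** Taking t0 = 2^-n large makes theta of order beyond the level of lam, and makes [theta_near]
    force (b / t0)^2 so close to m that m agrees with an element of A as far as lam can tell. *)
Lemma char_choose_scale : exists (t0 : F) (h : nat), [/\ t0 != 0,
  (forall a, OF a -> psi (a * q (t0 ^+ 2)) ^+ (2 ^ h.+1) = 1),
  (exists2 a, OF a & psi (a * q (t0 ^+ 2)) ^+ (2 ^ h) != 1),
  (forall z : calK, (2 ^ h.+1).-primitive_root z -> exists p : {poly rat}, lam = (pQ calK p).[z]) &
  forall b m, odd m -> theta_near t0 b m -> sigma m%:R lam = lam].
Proof.
have [L hL] := calK_level [:: lam]; have [L' hL'] := sigma_level [:: lam].
have [d [d0 od] hd] := squares_in_Z2_gap compactOF (char_OF_half compactOF psi_nontrivial) L'.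
have [r0 r00 hr] := char_annihilator_bounded compactOF psi_nontrivial.
have [x1 px1] := psi_nontrivial.
(* [n1] serves the gap estimate on (b / t0)^2 - m, [n2] the lower bound on the order of theta. *)
have [n1 o1] := OF_2X_mul compactOF (2 / (r0 * c0 * d)).
have [n2 o2] := OF_2X_mul compactOF (x1 * (2 / c0) / 2 ^+ L).
pose n := maxn n1 n2; pose t0 : F := (2 ^+ n)^-1.
have t00 : t0 != 0 by rewrite invr_eq0 F2X_neq0.
have oX m : OF (2 ^+ m : F) by apply: OFX; exact: OF_nat.
have rr0 : 2 / (c0 * t0 ^+ 2) != 0.
  by rewrite mulf_neq0 ?invr_eq0 ?mulf_neq0 ?expf_neq0 ?F2_neq0.
have [h1 hh1] := char_order_bounded psi compactOF rr0.
have ex : exists h, `[< forall a, OF a -> psi (a * q (t0 ^+ 2)) ^+ (2 ^ h) = 1 >].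
  exists h1; apply/asboolP => a oa; apply: hh1.
  have -> : 2 / (c0 * t0 ^+ 2) * (a * q (t0 ^+ 2)) = - a.
    by field; rewrite c00 t00 F2_neq0.
  exact: OFN.
(* Minimality of this exponent supplies the value of theta of exact order. *)
have [h /asboolP hh min] := ex_minnP ex.
(* Otherwise theta^(2^L) = 1, although it takes the value psi(x1) != 1. *)
have Lh : (L < h)%N.
  rewrite ltnNge; apply/negP => hLe.
  pose a := - (x1 * (2 / c0) / 2 ^+ L) * 2 ^+ n * 2 ^+ n.
  have oa : OF a.
    apply: OFM => //; rewrite mulNr; apply: OFN; rewrite mulrC.
    by apply: (OF_2X_le _ o2); exact: leq_maxr.
  case/eqP: px1; have := hh a oa => e.
  have -> : x1 = (2 ^ L)%:R * (a * q (t0 ^+ 2)).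
    by rewrite natrX /a /t0; field; rewrite c00 !F2X_neq0 F2_neq0.
  by rewrite charMn -(subnKC hLe) expnD exprM e expr1n.
case: h Lh hh min => // h Lh hh min; exists t0, h; split=> //.
- apply: contrapT => nex; have := min h; rewrite ltnn => hmin; suff : false by [].
  apply: hmin; apply/asboolP => a oa; apply/eqP/negPn/negP => ha.
  by apply: nex; exists a.
- by move=> z zP; apply: (hL _ z (ltnW Lh) zP lam); rewrite mem_head.
move=> b m om near; have := hr _ near => ob.
have [|a Aa am] := hd (b / t0) m om.
  have -> : ((b / t0) ^+ 2 - m%:R) / d =
      - (2 ^+ n * (2 / (r0 * c0 * d))) * (r0 * q (b ^+ 2 - m%:R * t0 ^+ 2)) * 2 ^+ n.
    by rewrite /t0; field; rewrite r00 c00 d0 F2X_neq0 F2_neq0 oner_neq0.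
  apply: (OFM (OFM (OFN _) ob) (oX n)).
  by apply: (OF_2X_le _ o1); exact: leq_maxl.
have mu' : (m%:R : Z2) \is a GRing.unit by exact: Z2_nat_unit.
rewrite (hL' L' m%:R a) ?mem_head ?Z2_natr ?am //; first exact: lam_fixed.
exact: squares_in_Z2_unit Aa.
Qed.

Variables (t0 : F) (h : nat) (z : calK) (p : {poly rat}).
Hypotheses (t00 : t0 != 0) (zP : (2 ^ h.+1).-primitive_root z) (lamE : lam = (pQ calK p).[z]).
Hypothesis theta_order : forall a, OF a -> psi (a * q (t0 ^+ 2)) ^+ (2 ^ h.+1) = 1.
Hypothesis theta_exact : exists2 a, OF a & psi (a * q (t0 ^+ 2)) ^+ (2 ^ h) != 1.
Hypothesis near_fixed : forall b m, odd m -> theta_near t0 b m -> sigma m%:R lam = lam.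

(** The exponents 1 + 2 i with i < 2^h index the Galois conjugates of theta, whose order is
    2^(h+1). *)
Definition near_orbit (b : F) := exists i : 'I_(2 ^ h), theta_near t0 b (1 + 2 * i).

Lemma theta_near_unique b (i j : 'I_(2 ^ h)) :
  theta_near t0 b (1 + 2 * i) -> theta_near t0 b (1 + 2 * j) -> i = j.
Proof.
move=> hi hj; have [a oa ha] := theta_exact; set w := psi _ in ha.
have wP : (2 ^ h.+1).-primitive_root w.
  have [k wk k_dvd] := prim_order_exists (expn_gt0 2 h.+1) (theta_order oa : w ^+ _ = 1).
  have /(dvdn_pfactor _ _ (isT : prime 2))[k' le_k' kE] := k_dvd.
  move: wk; rewrite kE; move: le_k'; rewrite leq_eqVlt => /orP[/eqP-> //|lt_k' wk].
  by case/eqP: ha; apply/eqP; rewrite -(prim_order_dvd wk) dvdn_exp2l.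
have wE m : psi (a * q (b ^+ 2 - m%:R * t0 ^+ 2)) = psi (a * q (b ^+ 2)) / w ^+ m.
  by rewrite /w -charMn -charN -charD; congr (psi _); ring.
have : w ^+ (1 + 2 * i) = w ^+ (1 + 2 * j).
  have := etrans (hi a oa) (esym (hj a oa)); rewrite !wE.
  by move/(mulfI (char_neq0 psi _))/invr_inj.
move/eqP; rewrite (eq_prim_root_expr wP) eqn_modDl expnS -!muln_modr eqn_mul2l /=.
by rewrite !modn_small ?ltn_ord // => /eqP; exact: val_inj.
Qed.

(* The coefficients are traces from Q(z) to Q, hence rational; the Fourier sum    *)
(* collects the conjugates of lam attached to the conjugates of the character     *)
(* theta of t0, and only those conjugates by squares of F survive. *)
Lemma fourier_coefficients (rho : F) : rho != 0 ->
  exists (I : finType) (a : I -> F) (c : I -> rat), (forall J, OF (a J)) /\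
    forall b, OF (rho * b) ->
      (near_orbit b -> \sum_J ratr (c J) * psi (a J * q (b ^+ 2)) = lam) /\
      (~ near_orbit b -> \sum_J ratr (c J) * psi (a J * q (b ^+ 2)) = 0).
Proof.
move=> rho0; have oX m : OF (2 ^+ m : F) by apply: OFX; exact: OF_nat.
have rr0 : 2 * rho ^+ 2 / c0 != 0.
  by rewrite !mulf_neq0 ?invr_eq0 ?expf_neq0 ?F2_neq0.
have [k1 hk1] := char_order_bounded psi compactOF rr0.
have [k0 [k00 ok0] hk0] := char_ball psi.
have [n1 o1] := OF_2X_mul compactOF (c0 / (2 * rho ^+ 2 * k0)).
have [n2 o2] := OF_2X_mul compactOF (c0 * t0 ^+ 2 / (2 * k0)).
pose n := maxn n1 n2; pose dlt : F := 2 ^+ n.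
(* A finite net of [OF] modulo [dlt]. The characters in play are trivial on [dlt] times [OF], so
   triviality on the net means triviality on [OF] ([net]). *)
have [s [sO hs]] := compactOF (c := fun=> dlt) (fun _ _ => conj (F2X_neq0 F n) (oX n)).
pose k := maxn k1 h.+1; pose r := size s; pose al (i : 'I_r) : F := nth 0 s i.
have oal i : OF (al i) by apply/sO/mem_nth.
have bord a b : OF a -> OF (rho * b) -> psi (a * q (b ^+ 2)) ^+ (2 ^ k) = 1.
  move=> oa ob; rewrite /k -(subnKC (leq_maxl k1 h.+1)) expnD exprM hk1 ?expr1n //.
  have -> : 2 * rho ^+ 2 / c0 * (a * q (b ^+ 2)) = - a * (rho * b) ^+ 2.
    by field; rewrite c00 F2_neq0.
  by apply: OFM; [exact: OFN|exact: OFX].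
have tord a : OF a -> psi (a * q (t0 ^+ 2)) ^+ (2 ^ k) = 1.
  move=> oa; rewrite /k -(subnKC (leq_maxr k1 h.+1)) expnD exprM theta_order //.
  by rewrite expr1n.
have ord m a b : OF a -> OF (rho * b) -> psi (a * q (b ^+ 2 - m%:R * t0 ^+ 2)) ^+ (2 ^ k) = 1.
  move=> oa ob.
  have -> : a * q (b ^+ 2 - m%:R * t0 ^+ 2) = a * q (b ^+ 2) + - (m%:R * (a * q (t0 ^+ 2))) by ring.
  by rewrite charD charN charMn exprMn exprVn bord // exprAC tord // expr1n invr1 mulr1.
have net m b : OF (rho * b) -> (forall i, psi (al i * q (b ^+ 2 - m%:R * t0 ^+ 2)) = 1) ->
    theta_near t0 b m.
  move=> ob hal a oa; have [x xs ox] := hs a oa.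
  pose ix : 'I_r := Ordinal (etrans (index_mem x s) xs).
  have xE : al ix = x by rewrite /al /= nth_index.
  have aE : a * q (b ^+ 2 - m%:R * t0 ^+ 2) = al ix * q (b ^+ 2 - m%:R * t0 ^+ 2) +
      k0 * ((a - x) / dlt * (- (2 ^+ n * (c0 / (2 * rho ^+ 2 * k0))) * (rho * b) ^+ 2
        + m%:R * (2 ^+ n * (c0 * t0 ^+ 2 / (2 * k0))))).
    by rewrite xE /dlt; field; rewrite k00 rho0 F2X_neq0 F2_neq0.
  rewrite aE charD hal mul1r hk0 //; apply: OFM => //; apply: OFD.
    apply: OFM; last exact: OFX.
    by apply: OFN; apply: (OF_2X_le _ o1); exact: leq_maxl.
  by apply: OFM; [exact: OF_nat|apply: (OF_2X_le _ o2); exact: leq_maxr].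
(* Integer combinations of the net with coefficients modulo 2^k replace the quotient of [OF] by
   [dlt]: the sum over this grid factors into geometric sums. *)
pose I : finType := {ffun 'I_r -> 'I_(2 ^ k)}.
pose aJ (J : I) : F := \sum_i (J i)%:R * al i.
have oaJ J : OF (aJ J).
  by apply: (big_ind (@OF F)) => [||i _]; [exact: OF0|exact: OFD|apply: OFM => //; exact: OF_nat].
pose N : calK := (2 ^ k)%:R.
have N0 : N != 0 by rewrite -(fmorph_eq0 K2C) rmorph_nat pnatr_eq0 expn_eq0.
have /choice[c hc] J : exists c : rat, ratr c =
    N ^- r * \sum_(i < 2 ^ h) sigma (1 + 2 * i)%:R (lam * psi (- (aJ J * q (t0 ^+ 2)))).
  have : psi (- (aJ J * q (t0 ^+ 2))) ^+ (2 ^ h.+1) = 1.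
    by rewrite charN exprVn theta_order ?invr1.
  move=> /(prim_rootP zP)[i ->].
  have [x hx] := odd_trace_rational (p * 'X^i) zP.
  exists (((2 ^ k)%:R ^- r) * x); rewrite ratKE rmorphM -(ratKE x) -hx fmorphV rmorphXn rmorph_nat.
  congr (_ * _); apply: eq_bigr => j _; congr (sigma _ _).
  have := hornerM (map_poly ratK p) (map_poly ratK 'X^i) z.
  by rewrite -rmorphM map_polyXn hornerXn => ->; rewrite lamE.
exists I, aJ, c; split=> // b ob.
pose zt (m : nat) (i : 'I_r) := psi (al i * q (b ^+ 2 - m%:R * t0 ^+ 2)).
have ztE (m : nat) (J : I) : \prod_i zt m i ^+ J i = psi (aJ J * q (b ^+ 2 - m%:R * t0 ^+ 2)).
  rewrite mulr_suml (big_morph psi (charD psi) (char0 psi)); apply: eq_bigr => i _.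
  by rewrite -mulrA charMn.
have inner (m : nat) : \sum_J psi (aJ J * q (b ^+ 2 - m%:R * t0 ^+ 2)) =
    if [forall i, zt m i == 1] then N ^+ r else 0.
  under eq_bigr do rewrite -ztE.
  rewrite -(bigA_distr_bigA (fun i (j : 'I_(2 ^ k)) => zt m i ^+ j)).
  have one i : \sum_(j < 2 ^ k) zt m i ^+ j = if zt m i == 1 then N else 0.
    have := @sum_root_powers _ (zt m i) (2 ^ k) 1 0; rewrite mul1n expr1 expr0.
    by under eq_bigr do rewrite mul1n; apply; exact: ord.
  case: ifPn => [/forallP al1|].
    under eq_bigr do rewrite one al1.
    by rewrite prodr_const card_ord.
  by rewrite negb_forall => /existsP[i ni]; rewrite (bigD1 i) //= one (negPf ni) mul0r.
have near (m : nat) : [forall i, zt m i == 1] <-> theta_near t0 b m.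
  split=> [/forallP h1|th]; first by apply: net => // i; apply/eqP; exact: h1.
  by apply/forallP => i; apply/eqP; exact: th.
have bu (i : nat) : ((1 + 2 * i)%:R : Z2) \is a GRing.unit.
  by apply: Z2_nat_unit; rewrite oddD oddM.
(* Expanding the traces with [char_sigma] and summing over J first leaves the conjugates of lam
   whose exponent matches b. *)
have main : \sum_J ratr (c J) * psi (aJ J * q (b ^+ 2)) =
    \sum_(i < 2 ^ h) (if [forall j, zt (1 + 2 * i)%N j == 1] then sigma (1 + 2 * i)%:R lam else 0).
  transitivity (\sum_(J : I) \sum_(i < 2 ^ h) N ^- r * sigma (1 + 2 * i)%:R lam *
     psi (aJ J * q (b ^+ 2 - (1 + 2 * i)%:R * t0 ^+ 2))).
    apply: eq_bigr => J _; rewrite hc -[LHS]mulrA mulr_suml [LHS]mulr_sumr; apply: eq_bigr => i _.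
    rewrite rmorphM -char_sigma // rmorph_nat -!mulrA -charD; congr (_ * (_ * psi _)).
    by ring.
  rewrite exchange_big; apply: eq_bigr => i _; rewrite -mulr_sumr inner.
  by case: ifP => _; rewrite ?mulr0 // mulrAC mulVf ?mul1r // expf_neq0.
split=> [[i0 th0]|nn]; rewrite main.
  rewrite (bigD1 i0) //= (introT idP (iffRL (near _) th0)) (near_fixed _ th0); last by rewrite oddD oddM.
  rewrite -[RHS]addr0; congr (_ + _); apply: big1 => i ni; case: ifP => // /near th.
  by case/eqP: ni; exact: theta_near_unique th th0.
by apply: big1 => i _; case: ifP => // /near th; case: nn; exists i.
Qed.

End FourierData.

Lemma clopen_indicator_smooth (T : topologicalType) (R : fieldType) (A : set T) :
  compact A -> open A -> closed A ->
  (fun x => (`[< A x >])%:R : R^o) \in @smooth_compact T R.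
Proof.
move=> cA oA clA; apply/asboolP; split=> [x|].
  have [Ax|nAx] := pselect (A x).
    by apply: filterS (open_nbhs_nbhs (conj oA Ax)) => z Az; rewrite !asboolT.
  have oC : open (~` A) by exact: closed_openC.
  by apply: filterS (open_nbhs_nbhs (conj oC nAx)) => z nAz; rewrite !asboolF.
apply: (subclosed_compact (@closed_closure _ _) cA).
rewrite [X in _ `<=` X](proj1 (closure_id _) clA); apply: closureS => x /=.
by case: asboolP => //; rewrite eqxx.
Qed.

(** * Hecke operators of cosets of a compact open subgroup *)

Section CosetIndicators.
Variables (G : topologicalGroupType) (K : set G).
Hypotheses (sK : subgroup K) (coK : Defs.compact_open K).

Fact coset_indicator_subproof n :
  (fun g => (`[< K (n^-1 * g)%g >])%:R : rat^o) \in @smooth_compact G rat.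
Proof.
have [cK oK] := compact_open_translate n coK.
apply: (@clopen_indicator_smooth _ _ [set g | K (n^-1 * g)%g]) => //.
apply: (proj1 (continuous_closedP _) (@mulgl_continuous G n^-1%g)).
apply: open_subgroup_closed => //; apply: open_nbhs_nbhs.
by split; [exact: coK.2|exact: subgroup1].
Qed.

Definition coset_indicator n : Cc G rat := MkCc (coset_indicator_subproof n).

Lemma coset_indicatorE n g : coset_indicator n g = (`[< K (n^-1 * g)%g >])%:R.
Proof. by []. Qed.

Lemma coset_indicator_mem k : K k -> coset_indicator k = coset_indicator 1%g.
Proof.
move=> Kk; apply: val_inj; apply/funext => g; rewrite /= invg1 mul1g.
congr (nat_of_bool _)%:R; apply: asbool_equiv_eq; split=> h.
  by rewrite -(mulVKg k g); exact: subgroupM.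
by apply: subgroupM => //; exact: subgroupV.
Qed.

Variables (mu : set G -> rat) (mu_haar : left_haar mu).
Variables (V : lmodType calK) (pi : smooth_rep G V).

Lemma hecke_op_linear_function a (phi phi' : Cc G rat) v :
  hecke_op mu pi (a *: phi + phi') v =
  ratr a *: hecke_op mu pi phi v + hecke_op mu pi phi' v.
Proof.
pose h f g := (ratr (Cc_fun f g) : calK) *: pi g v.
have lhh : locally_constant (fun g => (h phi g, h phi' g)).
  move=> g; apply: filterS (filterI (hecke_integrand_locally_constant pi phi v g)
    (hecke_integrand_locally_constant pi phi' v g)) => x [].
  by rewrite /h => -> ->.
have [|n [S [u [coS dS hS h0]]]] := locally_constant_steps (u0 := (0, 0))
  (compactU (@Cc_support_compact _ _ phi) (@Cc_support_compact _ _ phi')) lhh.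
  by move=> x; rewrite xpair_eqE negb_and => /orP[] /hecke_integrand_support; [left|right].
have hE : h (a *: phi + phi') =1 (fun g => ratr a *: h phi g + h phi' g).
  move=> g; rewrite /h !ratKE -[(a *: phi + phi') g]/(a * phi g + phi' g).
  by rewrite rmorphD rmorphM scalerDl scalerA.
have nz x : h phi x != 0 \/ h phi' x != 0 -> exists i, S i x.
  by move=> hx; apply: h0; rewrite xpair_eqE negb_and; apply/orP.
rewrite /hecke_op (@haar_int_steps _ _ mu_haar _ (h phi) n S (fun i => (u i).1)) //; first last.
- by move=> x hx; apply: nz; left.
- by move=> i x Si; have := hS i x Si; case: (u i) => ? ? [].
rewrite (@haar_int_steps _ _ mu_haar _ (h phi') n S (fun i => (u i).2)) //; first last.
- by move=> x hx; apply: nz; right.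
- by move=> i x Si; have := hS i x Si; case: (u i) => ? ? [].
rewrite (@haar_int_steps _ _ mu_haar _ (h (a *: phi + phi')) n S
  (fun i => ratr a *: (u i).1 + (u i).2)) //; first last.
- move=> x; rewrite hE // => hx; apply: nz; have [hv|] := eqVneq (h phi x) 0; last by left.
  by right; apply: contraNneq hx => hw; rewrite hv hw scaler0 addr0.
- by move=> i x Si; rewrite hE //; have := hS i x Si; case: (u i) => ? ? [-> ->].
rewrite scaler_sumr -big_split; apply: eq_bigr => i _ /=.
by rewrite scalerDr !scalerA mulrC.
Qed.

Lemma hecke_op_sum (I : finType) (c : I -> rat) (phi : I -> Cc G rat) v :
  hecke_op mu pi (\sum_i c i *: phi i) v = \sum_i ratr (c i) *: hecke_op mu pi (phi i) v.
Proof.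
elim: index_enum => [|i s IHs]; last by rewrite !big_cons hecke_op_linear_function IHs.
rewrite !big_nil; have := hecke_op_linear_function (-1) 0 0 v.
by rewrite scaler0 addr0 ratKE rmorphN1 scaleN1r addNr.
Qed.

Lemma hecke_coset n v :
  hecke_op mu pi (coset_indicator n) v = pi n (hecke_op mu pi (coset_indicator 1%g) v).
Proof.
pose h := fun g => (ratr (coset_indicator 1%g g) : calK) *: pi g v.
have [|m [S [u [coS dS hS h0]]]] := locally_constant_steps (u0 := 0)
  (@Cc_support_compact _ _ (coset_indicator 1%g))
  (hecke_integrand_locally_constant pi (coset_indicator 1%g) v).
  exact: hecke_integrand_support.
have hE g : (ratr (coset_indicator n g) : calK) *: pi g v = pi n (h (n^-1 * g)%g).
  by rewrite /h linearZ /= -rep_mul mulVKg invg1 mul1g.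
rewrite /hecke_op (haar_int_steps mu_haar coS dS hS h0).
rewrite (@haar_int_steps _ _ mu_haar _ _ m (fun i => [set x | S i (n^-1 * x)%g])
  (fun i => pi n (u i))).
- by rewrite linear_sum; apply: eq_bigr => i _; rewrite linearZ /= haar_translate.
- by move=> i; exact: compact_open_translate.
- by move=> i j x; exact: dS.
- by move=> i x Si; rewrite hE; congr (pi n _); exact: hS.
- move=> x; rewrite hE => hx; apply: h0; apply: contraNneq hx => e.
  by rewrite [h _]e linear0.
Qed.

Lemma hecke_subgroup_fixed k v : K k ->
  pi k (hecke_op mu pi (coset_indicator 1%g) v) = hecke_op mu pi (coset_indicator 1%g) v.
Proof. by move=> Kk; rewrite -hecke_coset coset_indicator_mem. Qed.

Lemma hecke_subgroup_id v : (forall k, K k -> pi k v = v) ->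
  hecke_op mu pi (coset_indicator 1%g) v = ratr (mu K) *: v.
Proof.
move=> Kv; rewrite /hecke_op (@haar_int_steps _ _ mu_haar _ _ 1 (fun=> K) (fun=> v)) ?big_ord1 //.
- by move=> i j _ _ _; rewrite !ord1.
- by move=> i x Kx; rewrite coset_indicatorE invg1 mul1g asboolT // Kv // ratKE rmorph1 scale1r.
- move=> x; rewrite coset_indicatorE invg1 mul1g; case: asboolP => [Kx _|_]; first by exists ord0.
  by rewrite ratKE rmorph0 scale0r eqxx.
Qed.

End CosetIndicators.

(** The pointwise stabiliser in C of the orbit C v: normalised by C, and open because the orbit is
    finite. *)
Lemma orbit_stabiliser (G : topologicalGroupType) (V : lmodType calK) (pi : smooth_rep G V)
    (C : set G) v : subgroup C -> nbhs 1%g C -> compact C ->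
  exists K : set G, [/\ subgroup K, Defs.compact_open K,
    forall c k, C c -> K k -> K (c^-1 * k * c)%g & forall k, K k -> pi k v = v].
Proof.
move=> sC nC cC; have sS := stabiliser_subgroup pi v.
have [n [r [rC rS _]]] := coset_reps_exist sS (stabiliser_nbhs pi v) cC.
pose K := [set g | C g /\ forall c, C c -> pi g (pi c v) = pi c v].
have sK : subgroup K.
  split=> [|g h [Cg hg] [Ch hh]|g [Cg hg]].
  - by split=> [|c _]; [exact: subgroup1|rewrite rep_one].
  - by split=> [|c Cc]; [exact: subgroupM|rewrite rep_mul hh ?hg].
  - split=> [|c Cc]; first exact: subgroupV.
    by rewrite -{1}(hg c Cc) -rep_mul mulVg rep_one.
have nK : nbhs 1%g K.
  have nS (i : 'I_n) : nbhs 1%g [set g | pi g (pi (r i) v) = pi (r i) v].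
    exact: stabiliser_nbhs.
  have nA : nbhs 1%g [set g | forall i, pi g (pi (r i) v) = pi (r i) v].
    exact: filter_forall.
  apply: filterS (filterI nC nA) => g [Cg hg]; split=> // c Cc.
  have [i hi] := rS c Cc; have -> : pi c v = pi (r i) v.
    by rewrite -[c](mulVKg (r i)) rep_mul hi.
  exact: hg.
exists K; split=> // [|c k Cc [Ck hk]|k [_ hk]].
- split; last exact: subgroup_open.
  apply: (subclosed_compact _ cC); first exact: open_subgroup_closed.
  by move=> x [].
- split=> [|d Cd]; first by apply: subgroupM => //; apply: subgroupM => //; exact: subgroupV.
  by rewrite !rep_mul -(rep_mul pi c d) hk -?rep_mul ?mulgA ?mulVg ?mul1g //; exact: subgroupM.
- by have := hk 1%g (subgroup1 sC); rewrite rep_one.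
Qed.

(** * The character field of the even part *)

Section CharacterFieldOfEvenPart.
Variables (F : fieldExtType Q2) (W : vectType F) (B : {skew_symmetric W}).
Hypotheses (W_neq0 : (0 < \dim {:W})%N) (B_symplectic : is_psymplectic B).
Variables (X Y : {vspace W}).
Hypotheses (X_lagrangian : orthov B X = X) (Y_lagrangian : orthov B Y = Y).
Hypotheses (XY_full : (X + Y)%VS = {:W}%VS) (XY_cap : (X :&: Y)%VS = 0%VS).
Variables (psi : smooth_character F calK) (psi_nontrivial : exists x, psi x != 1).
Variables (Mp : topologicalGroupType) (p : Mp -> Sp B) (p_cover : double_cover p).
Variables (omega : smooth_rep Mp (Cc (adic (subvs_of Y)) calK)).
Hypothesis omega_weil : is_weil_rep X psi p omega.
Variable omega_even : smooth_rep Mp (Cc_even (subvs_of Y) calK).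
Hypothesis omega_evenP : is_even_part omega omega_even.
Variables (mu : set Mp -> rat) (mu_haar : left_haar mu).

Local Notation A := (squares_in_Z2 F).
Local Notation EV := (Cc_even (subvs_of Y) calK).
Let compactOF : OF_compact F.
Proof. exact: (cover_OF_compact W_neq0 B_symplectic Y_lagrangian p_cover mu_haar). Qed.

Lemma even_twistVK (V : vectType F) a : A a -> cancel (@even_twist F V a^-1) (even_twist a).
Proof.
move=> Aa f; have au := squares_in_Z2_unit Aa.
apply: even_eq => y; rewrite !even_twistE sigmaVK // scalerA.
(* The chosen roots of a and a^-1 are inverse only up to sign, which evenness absorbs. *)
set c := _ * _; have : c ^+ 2 == 1 ^+ 2.
  rewrite exprMn !exprVn !root_of_sq //; last exact: squaresV.
  by rewrite rmorphV // invrK mulfV ?expr1n // -unitfE rmorph_unit.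
by rewrite eqf_sqr => /orP[/eqP->|/eqP->]; rewrite ?scaleN1r ?evenE ?scale1r.
Qed.

Lemma even_twist_weil a g (f : EV) : A a ->
  even_twist a (omega_even g f) = omega_even g (even_twist a f).
Proof.
move=> Aa; apply: val_inj; apply: etrans (esym (omega_evenP _ _)).
apply: etrans (twist_weil B_symplectic X_lagrangian XY_cap psi_nontrivial compactOF p_cover
  omega_weil (root_of_neq0 F a) (squares_in_Z2_unit Aa) (root_of_sq Aa) g f).
by congr (twist a _ _); exact: omega_evenP.
Qed.

(** The twist by a in A commutes with the Hecke operator of a rational function, so sigma_a(t) is
    again its trace and equals t by uniqueness. *)
Lemma character_field_sub : character_field \val mu omega_even `<=` K2C @` fixed_field A.
Proof.
apply: (subfield_gen_sub (fixed_field_subfield _)) => _ [t [phi tr] <-].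
exists t => // a Aa; have au := squares_in_Z2_unit Aa.
apply: (is_trace_unique (hecke_op_linear mu_haar omega_even phi) _ tr).
apply: (@is_trace_semilinear _ _ (@even_twist F _ a) (@even_twist F _ a^-1) _ (sigma a^-1)) tr.
- exact: even_twistD.
- exact: even_twistZ.
- exact: even_twistVK.
- by apply: (@can_inj _ _ _ (@even_twist F _ a^-1)); rewrite -{1}(invrK a); exact/even_twistVK/squaresV.
- exact: sigmaVK.
apply: hecke_op_commute => //; first exact: even_twistD.
  by move=> q v; rewrite even_twistZ fmorph_rat.
by move=> g v; exact: even_twist_weil.
Qed.

Lemma even_bump (y0 : subvs_of Y) : exists f : EV, f y0 != 0.
Proof.
have [d [d0 od] hd] := OF_denoms [seq coord (vbasis {:subvs_of Y}) i y0 | i : 'I_(\dim {:subvs_of Y})].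
pose L := [set y : adic (subvs_of Y) | lattice (d *: (y : subvs_of Y))].
have cL : compact L := subvs_lattice_compact W_neq0 B_symplectic Y_lagrangian p_cover mu_haar d0.
have clL : closed L.
  exact: (proj1 (continuous_closedP _) (@linear_adic_continuous _ _ _
    ( *:%R d : {linear subvs_of Y -> subvs_of Y})) _ (@lattice_closed _ _)).
have oL : open L.
  rewrite openE => y Ly; exists 1; first by split; [exact: oner_neq0|exact: OF1].
  move=> v lv; rewrite scale1r /L /= scalerDr; apply: latticeD => //; exact: latticeZ.
have fP := @clopen_indicator_smooth _ calK L cL oL clL.
have fE : MkCc fP \in @even_fun F (subvs_of Y) calK.
  apply/asboolP => y /=; congr (nat_of_bool _)%:R; apply: asbool_equiv_eq.
  by rewrite /L /= scalerN; split=> /latticeN; rewrite ?opprK.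
exists (MkCc_even fE); rewrite /= asboolT ?oner_neq0 // => i.
by rewrite linearZ; apply/hd/map_f; rewrite mem_enum.
Qed.

(** The Fourier combination of the operators of N(X), applied after the projector of K up to the
    factor mu(K), has its image in the K-fixed functions supported on S and acts there by mu(K) lam.
    Its trace is mu(K) lam times the dimension of that space, finite by [fixed_vectors_points]. *)
Lemma fixed_field_trace lam : lam != 0 -> fixed_field A lam ->
  exists (phi : Cc Mp rat) (m : rat), m != 0 /\
    is_trace (hecke_op mu omega_even phi) (ratr m * lam).
Proof.
move=> lam0 Flam.
have [C [sC nC cC]] := haar_compact_subgroup mu_haar.
have [x xX x0] := lagrangian_neq0 W_neq0 X_lagrangian.
have [s sL hs] := weil_unipotent B_symplectic X_lagrangian omega_weil.
have [c0 [c00 oc0] hC] := unipotent_lift_small B_symplectic X_lagrangian p_cover sL xX nC.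
have [t0 [h [t00 tord tex lamz near]]] := char_choose_scale compactOF psi_nontrivial c00 Flam.
have [z zP] := calK_prim_root h.+1; have [q lamE] := lamz z zP.
(* A point of S, with exponent 1; the image of [f0] is nonzero there, so the space has positive
   dimension. *)
have [y0 y0x] : exists y0 : subvs_of Y, B (vsval y0) x = t0.
  have [w wx] := symplectic_neq0 B_symplectic x0.
  have /memv_addP[x' xX' [y' yY' wE]] : w \in (X + Y)%VS by rewrite XY_full memvf.
  have wE' : B w x = B x' x + B y' x by rewrite wE; exact: linearDl.
  rewrite wE' (lagrangian_isotropic X_lagrangian xX' xX) add0r in wx.
  exists ((t0 / B y' x) *: Subvs yY'); rewrite linearZ linearZl_LR /=.
  by rewrite divfK.
have [f0 f0y] := even_bump y0.
(* K is normalised by C, which contains all the lifts [n J]; these therefore preserve the K-fixed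
   vectors. *)
have [K [sK coK nK Kf0]] := orbit_stabiliser omega_even f0 sC nC cC.
have nbK : nbhs 1%g K by apply: open_nbhs_nbhs; split; [exact: coK.2|exact: subgroup1].
have fixE (f : EV) : (forall k, K k -> omega_even k f = f) -> fixed_by omega K f.
  by move=> Kf k Kk; rewrite -omega_evenP Kf.
have [rho rho0 hrho] := fixed_support_bounded B_symplectic X_lagrangian psi_nontrivial compactOF
  p_cover omega_weil nbK xX.
have [I [a [c [oa hc]]]] := fourier_coefficients compactOF c00 zP lamE tord tex near rho0.
pose n J := s (transvection B_symplectic (c0 * a J) x).
have Cn J : C (n J) by exact: hC.
pose phi := \sum_J c J *: coset_indicator sK coK (n J).
pose e v := hecke_op mu omega_even (coset_indicator sK coK 1%g) v.
pose T := hecke_op mu omega_even phi.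
have TE v : T v = \sum_J ratr (c J) *: omega_even (n J) (e v).
  by rewrite /T hecke_op_sum //; apply: eq_bigr => J _; rewrite hecke_coset.
have eK v k : K k -> omega_even k (e v) = e v by exact: hecke_subgroup_fixed.
have nE J (f : EV) y : omega_even (n J) f y = psi (a J * - (2^-1 * c0 * B (vsval y) x ^+ 2)) * f y.
  by rewrite [in LHS]omega_evenP hs //; congr (psi _ * _); ring.
have Ty v y : T v y = (\sum_J ratr (c J) * psi (a J * - (2^-1 * c0 * B (vsval y) x ^+ 2))) * e v y.
  by rewrite TE even_sum mulr_suml; apply: eq_bigr => J _; rewrite evenZ nE mulrA.
pose S y := near_orbit psi c0 t0 h (B (vsval (y : subvs_of Y)) x).
have eOF v y : e v y != 0 -> OF (rho * B (vsval y) x) by apply/hrho/fixE/eK.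
have TS v y : S y -> T v y = lam * e v y.
  move=> Sy; have [e0|/eOF ob] := eqVneq (e v y) 0; first by rewrite Ty e0 !mulr0.
  by rewrite Ty (hc _ ob).1.
have TnS v y : ~ S y -> T v y = 0.
  move=> nSy; have [e0|/eOF ob] := eqVneq (e v y) 0; first by rewrite Ty e0 mulr0.
  by rewrite Ty (hc _ ob).2 ?mul0r.
pose U : set EV := [set f | (forall k, K k -> omega_even k f = f) /\ forall y, f y != 0 -> S y].
have TU v : U (T v).
  split=> [k Kk|y Ty0]; last by apply: contrapT => /(TnS v)/eqP; rewrite (negPf Ty0).
  rewrite TE linear_sum; apply: eq_bigr => J _; rewrite linearZ /= -rep_mul.
  rewrite -{2}(eK v _ (nK _ _ (Cn J) Kk)) -[in RHS]rep_mul.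
  by rewrite !mulgA mulgV mul1g.
have eU f : (forall k, K k -> omega_even k f = f) -> e f = ratr (mu K) *: f.
  exact: hecke_subgroup_id.
have TUE f : U f -> T f = (ratr (mu K) * lam) *: f.
  move=> [Kf Sf]; apply: even_eq => y; rewrite evenZ.
  have [Sy|nSy] := pselect (S y); first by rewrite TS // eU // evenZ mulrCA mulrA.
  rewrite TnS //; suff -> : f y = 0 by rewrite mulr0.
  by apply/eqP/negPn/negP => /Sf.
have [N [pt hpt]] := fixed_vectors_points B_symplectic X_lagrangian XY_cap psi_nontrivial compactOF
  p_cover omega_weil nbK.
pose ev (f : EV) : 'rV[calK]_N := \row_j f (pt j).
have [|m [b [fb bU bs]]] := @exists_basis _ _ U N ev.
  move=> m d f Uf /rowP ev0; apply: val_inj; apply: hpt => [|j].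
    apply: fixE => k Kk; rewrite linear_sum; apply: eq_bigr => i _.
    by rewrite linearZ /= (Uf i).1.
  rewrite even_sum; have := ev0 j; rewrite summxE mxE => ej; rewrite -[RHS]ej.
  by apply: eq_bigr => i _; rewrite evenZ !mxE.
have muK : ratr (mu K) != 0 :> calK by rewrite ratKE fmorph_eq0; exact: haar_open_subgroup_neq0.
have m0 : (m != 0)%N.
  have Sy0 : S y0.
    exists (Ordinal (expn_gt0 2 h : (0 < 2 ^ h)%N)) => a' oa'.
    by rewrite y0x /= muln0 addn0 mul1r subrr mulr0 oppr0 mulr0 char0.
  have [d dE] := bs _ (TU f0); apply/eqP => m0; move: dE; rewrite big1; last first.
    by move=> i; suff : (i < 0)%N by []; rewrite -m0.
  move/(congr1 (fun f : EV => f y0)); rewrite even0 TS // eU // evenZ.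
  by apply/eqP; apply: mulf_neq0 => //; exact: mulf_neq0.
exists phi, (mu K *+ m); split.
  by rewrite mulrn_eq0 negb_or m0 (haar_open_subgroup_neq0 mu_haar).
exists m, b, (ratr (mu K) * lam)%:M; split=> //.
- by move=> v; exact: bs.
- move=> j; rewrite -/(T _) TUE // (bigD1 j) //= mxE eqxx big1 ?addr0 // => i ni.
  by rewrite mxE (negPf ni) scale0r.
- by rewrite mxtrace_scalar !ratKE rmorphMn mulrnAl.
Qed.

Lemma character_field_even_part :
  character_field \val mu omega_even = K2C @` fixed_field A.
Proof.
rewrite eqEsubset; split=> [|_ [lam Flam <-]]; first exact: character_field_sub.
set E := character_field _ _ _; have [E1 EN ED En E0] := subfield_gen_closed
  [set K2C t | t in [set t | exists phi : Cc Mp rat, is_trace (hecke_op mu omega_even phi) t]].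
have [->|lam0] := eqVneq lam 0; first by rewrite rmorph0.
have [phi [m [m0 tr]]] := fixed_field_trace lam0 Flam.
have [_ _ EV'] := subfield_genP
  [set K2C t | t in [set t | exists phi : Cc Mp rat, is_trace (hecke_op mu omega_even phi) t]].
have Et : E (K2C (ratr m * lam)) by apply: sub_gen_smallest; exists (ratr m * lam) => //; exists phi.
have Eint (k : int) : E k%:~R by case: k => k; [exact: (En _ _ E1)|exact: (EN _ (En _ _ E1))].
have Ediv u v : E u -> E v -> E (u / v) by move=> Eu Ev; have := EV' u v; rewrite !inE; apply.
have Em : E (ratr m).
  by rewrite -(divq_num_den m) rmorphM fmorphV !rmorph_int; apply: Ediv; exact: Eint.
have -> : K2C lam = K2C (ratr m * lam) / ratr m.
  by rewrite rmorphM fmorph_rat mulrAC divff ?mul1r // fmorph_eq0.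
exact: Ediv.
Qed.

End CharacterFieldOfEvenPart.

Theorem theorem8p2
  (F : fieldExtType Q2) (W : vectType F) (B : {skew_symmetric W})
  (W_neq0 : (0 < \dim {:W})%N) (B_symplectic : is_psymplectic B)
  (X Y : {vspace W})
  (X_lagrangian : orthov B X = X) (Y_lagrangian : orthov B Y = Y)
  (XY_full : (X + Y)%VS = {:W}%VS) (XY_cap : (X :&: Y)%VS = 0%VS)
  (psi : smooth_character F calK) (psi_nontrivial : exists x, psi x != 1)
  (Mp : topologicalGroupType) (p : Mp -> Sp B)
  (p_cover : double_cover p) (p_nonsplit : ~ split_cover p)
  (omega : smooth_rep Mp (Cc (adic (subvs_of Y)) calK))
  (omega_weil : is_weil_rep X psi p omega)
  (omega_even : smooth_rep Mp (Cc_even (subvs_of Y) calK))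
  (omega_evenP : is_even_part omega omega_even)
  (mu : set Mp -> rat) (mu_haar : left_haar mu) :
  let A := squares_in_Z2 F in
  let E := character_field \val mu omega_even in
  realisable_over \val omega_even E /\
  [/\ A = Z2units -> E = range (ratr : rat -> algC),
      A = Z2bracket 3 -> E = subfield_gen [set sqrtC (- 2)],
      A = Z2bracket 5 -> E = subfield_gen [set sqrtC (- 1)],
      A = Z2bracket (- 1) -> E = subfield_gen [set sqrtC 2] &
      A = Z2squares -> E = subfield_gen [set z | 8.-primitive_root z]].
Proof.
move=> A E; have compactOF := cover_OF_compact W_neq0 B_symplectic Y_lagrangian p_cover mu_haar.
have EA : E = K2C @` fixed_field A.
  exact: (character_field_even_part W_neq0 B_symplectic X_lagrangian Y_lagrangian XY_full XY_cap
    psi_nontrivial p_cover omega_weil omega_evenP mu_haar).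
rewrite EA; split.
  exact: (realisable_over_fixed_field B_symplectic X_lagrangian XY_cap psi_nontrivial compactOF
    p_cover omega_weil omega_evenP).
split=> ->.
- exact: fixed_field_Z2units.
- exact: fixed_field_bracket3.
- exact: fixed_field_bracket5.
- exact: fixed_field_bracketN1.
- exact: fixed_field_squares.
Qed.
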